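(* Let $\mathfrak{g}$ be a complex simple Lie algebra and let $\mathfrak{q}$ be a maximal parabolic subalgebra of quasi-Heisenberg type of one of the types $B_n(i)$ ($3\le i\le n$), $C_n(i)$ ($2\le i\le n-1$), $D_n(i)$ ($3\le i\le n-3$), $E_6(3)$, $E_6(5)$, $E_7(2)$, $E_7(6)$, $E_8(1)$, $F_4(4)$. Let $V(\mu+\epsilon)$ be a special constituent of $\mathfrak{l}\otimes\mathfrak{z}(\mathfrak{n})$ of type 1a or type 2, let $\alpha_\mathfrak{q}$ be the simple root that determines $\mathfrak{q}$, and let $$Y_l^*=\big(\mathrm{ad}(X_{-\mu})\,\mathrm{ad}(X_{-\epsilon})\otimes\mathrm{Id}\big)\bar\omega\in\mathfrak{l}\otimes\mathfrak{z}(\bar{\mathfrak{n}}),\qquad \bar\omega=\sum_{\gamma_t\in\Delta(\mathfrak{z}(\mathfrak{n}))}X_{\gamma_t}\otimes X_{-\gamma_t},$$ which is a lowest weight vector for the dual module $V(\mu+\epsilon)^*$. Put $$C(\mu,\epsilon)=\sum_{\gamma_t}N_{\mu,\epsilon-\gamma_t}N_{-\mu,\gamma_t-\epsilon}N_{\epsilon,-\gamma_t}N_{-\epsilon,\gamma_t},$$ the sum being over $\gamma_t\in\Delta_{\mu+\epsilon}(\mathfrak{z}(\mathfrak{n}))$. Then for every $s\in\mathbb{C}$: (1) If $V(\mu+\epsilon)$ is of type 1a, then $$[\pi_s(X_\mu),\Omega_2(Y_l^* )]_e=-\frac{\|\alpha_\mathfrak{q}\|^2}{2}\,C(\mu,\epsilon)\,(s-s_2)\,R(X_{-\epsilon})_e,\qquad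 s_2=\frac{|\Delta_{\mu+\epsilon}(\mathfrak{g}(1))|}{2}-1,$$ where $|\Delta_{\mu+\epsilon}(\mathfrak{g}(1))|$ is the number of elements of $\Delta_{\mu+\epsilon}(\mathfrak{g}(1))$. (2) If $V(\mu+\epsilon)$ is of type 2 (so $\epsilon=\mu$), then $$[\pi_s(X_\mu),\Omega_2(Y_l^* )]_e=-\frac{\|\alpha_\mathfrak{q}\|^2}{2}\,C(\mu,\mu)\,(s+1)\,R(X_{-\mu})_e.$$
   Context: Parabolic. $G$ is a complex, simple, connected, simply connected Lie group with Lie algebra $\mathfrak{g}$, $\mathfrak{b}=\mathfrak{h}\oplus\mathfrak{u}$ a Borel subalgebra with Cartan subalgebra $\mathfrak{h}$; $\Delta,\Delta^+,\Pi$ are the roots, positive roots, simple roots; $\kappa$ is the Killing form, $\langle\cdot,\cdot\rangle$ the induced form on $\mathfrak{h}^*$, $\|\alpha\|^2=\langle\alpha,\alpha\rangle$. ''$\mathfrak{q}$ is of type $\mathcal{T}(i)$'' means $\mathfrak{g}$ has type $\mathcal{T}$ and $\mathfrak{q}$ is the standard maximal parabolic determined by $\alpha_\mathfrak{q}=\alpha_i$ (Bourbaki numbering): $\mathfrak{q}=\mathfrak{l}\oplus\mathfrak{n}$, $\mathfrak{l}=\mathfrak{h}$ plus root spaces for roots in $\mathrm{span}(\Pi\setminus\{\alpha_\mathfrak{q}\})$, $\mathfrak{n}$ the remaining positive root spaces. Quasi-Heisenberg type: $[\mathfrak{n},[\mathfrak{n},\mathfrak{n}]]=0$, $\dim[\mathfrak{n},\mathfrak{n}]>1$.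 Grading by the coefficient of $\alpha_\mathfrak{q}$: $\mathfrak{g}=\bigoplus_{j=-2}^2\mathfrak{g}(j)$, $\mathfrak{l}=\mathfrak{g}(0)$, $\mathfrak{z}(\mathfrak{n})=\mathfrak{g}(2)$ (center of $\mathfrak{n}$), $\mathfrak{z}(\bar{\mathfrak{n}})=\mathfrak{g}(-2)$, $\bar{\mathfrak{n}}=\mathfrak{g}(-1)\oplus\mathfrak{g}(-2)$. $Q=N_G(\mathfrak{q})=LN$; $L$ acts by $\mathrm{Ad}$. $\Delta(W)$ is the set of roots whose root spaces lie in $W$, and $\Delta_\nu(W)=\{\alpha\in\Delta(W):\nu-\alpha\in\Delta\}$. $\mu$ is the highest weight of the irreducible $L$-module $\mathfrak{g}(1)$; $\gamma$ (the highest root) is that of $\mathfrak{z}(\mathfrak{n})$. Special constituents. An irreducible $L$-constituent $V(\nu)$ (highest weight $\nu$) of $\mathfrak{l}\otimes\mathfrak{z}(\mathfrak{n})$ is special if $\nu\neq\gamma$ and $\nu=\mu+\epsilon$ for some $\epsilon\in\Delta(\mathfrak{g}(1))$. It is of type 1a if $\mu+\epsilon\notin\Delta$, $\epsilon\ne\mu$ and both $\mu,\epsilon$ are long roots; of type 2 if $\epsilon=\mu$ (and $2\mu\notin\Delta$). If $\mathfrak{g}$ is simply laced all roots are regarded as long. Normalization. Root vectors $X_\alpha\in\mathfrak{g}_\alpha$ and $H_\alpha\in\mathfrak{h}$ ($\alpha\in\Delta$) are chosen with $[X_\alpha,X_{-\alpha}]=H_\alpha$, $\kappa(X_\alpha,X_{-\alpha})=1$,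 $\beta(H_\alpha)=\langle\alpha,\beta\rangle$; $[X_\alpha,X_\beta]=N_{\alpha,\beta}X_{\alpha+\beta}$ if $\alpha+\beta\in\Delta$, and $N_{\alpha,\beta}=0$ if $\alpha+\beta\notin\Delta$, $\alpha+\beta\neq0$; $N_{\alpha_1,\alpha_2}=N_{\alpha_2,\alpha_3}=N_{\alpha_3,\alpha_1}$ for roots with $\alpha_1+\alpha_2+\alpha_3=0$; and $N_{\alpha,\beta}N_{-\alpha,-\beta}=-\frac{q_{\alpha,\beta}(1+p_{\alpha,\beta})}{2}\|\alpha\|^2$ if $\alpha+\beta\in\Delta$, where $p_{\alpha,\beta}$ (resp. $q_{\alpha,\beta}$) is the largest $j\ge0$ with $\beta-j\alpha\in\Delta$ (resp. $\beta+j\alpha\in\Delta$). Bundle. $\mathfrak{g}_0$ is a real form of $\mathfrak{g}$ in which $\mathfrak{q}$ has a real form, $G_0\subset G$ its analytic subgroup, $Q_0=N_{G_0}(\mathfrak{q})=L_0N_0$, $\bar N_0$ the unipotent subgroup opposite to $N_0$. $\lambda_\mathfrak{q}$ is the fundamental weight of $\alpha_\mathfrak{q}$, $\chi_\mathfrak{q}$ the character of $L$ with differential $\lambda_\mathfrak{q}$, $\chi^s=|\chi_\mathfrak{q}|^s$ on $L_0$ extended trivially to $N_0$; $\mathcal{L}_s$ is the resulting line bundle restricted to $\bar N_0\subset G_0/Q_0$, with sections $C^\infty(\bar N_0,\mathbb{C}_{\chi^s})$. With $Y=Y_{\bar{\mathfrak{n}}}+Y_\mathfrak{q}$ along $\mathfrak{g}=\bar{\mathfrak{n}}\oplus\mathfrak{q}$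 and $(R(X)f)(\bar n)=\frac{d}{dt}f(\bar n\exp(tX))|_{t=0}$ (extended to $\mathcal{U}(\bar{\mathfrak{n}})$), $\mathfrak{g}$ acts by $(\pi_s(Y)f)(\bar n)=s\lambda_\mathfrak{q}((\mathrm{Ad}(\bar n^{-1})Y)_\mathfrak{q})f(\bar n)-(R((\mathrm{Ad}(\bar n^{-1})Y)_{\bar{\mathfrak{n}}})f)(\bar n)$. For a differential operator $D$, $D_e$ is the functional $f\mapsto(Df)(e)$. $\Omega_2$. $\omega=\sum_{\gamma_j\in\Delta(\mathfrak{z}(\mathfrak{n}))}X_{-\gamma_j}\otimes X_{\gamma_j}$ and $\tau_2:\mathfrak{g}(1)\to\mathfrak{l}\otimes\mathfrak{z}(\mathfrak{n})$, $\tau_2(X)=\frac12(\mathrm{ad}(X)^2\otimes\mathrm{Id})\omega$. Via $\kappa$, $(\mathfrak{l}\otimes\mathfrak{z}(\mathfrak{n}))^*\cong\mathfrak{l}\otimes\mathfrak{z}(\bar{\mathfrak{n}})$, with $A\otimes B$ acting as $\kappa(A,\cdot)\kappa(B,\cdot)$; $V(\mu+\epsilon)^*$ is the constituent corresponding to the dual of $V(\mu+\epsilon)$. $\tilde\tau_2(Y^* )(X)=Y^*(\tau_2(X))$ is a quadratic polynomial on $\mathfrak{g}(1)$, i.e. an element of $\mathrm{Sym}^2(\mathfrak{g}(-1))$ via $\kappa$ (the linear form $\kappa(\cdot,X_{-\alpha})$ corresponds to $X_{-\alpha}$), and $\Omega_2(Y^* )=R(\sigma(\tilde\tau_2(Y^*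 )))$ with $\sigma:\mathrm{Sym}^2(\mathfrak{g}(-1))\to\mathcal{U}(\bar{\mathfrak{n}})$ symmetrization. *)

(* Defs.v *)
From HB Require Import structures.
From mathcomp Require Import all_boot all_order all_algebra.
From mathcomp Require Import all_classical all_reals all_analysis.
From mathcomp Require Import complex.

Set Implicit Arguments.
Unset Strict Implicit.
Unset Printing Implicit Defensive.

Import Order.TTheory GRing.Theory Num.Theory.
Import numFieldNormedType.Exports.

Local Open Scope ring_scope.
Local Open Scope complex_scope.

Record lieAlgebra (K : fieldType) := LieAlgebra {
  lie_sort :> vectType K;
  br : lie_sort -> lie_sort -> lie_sort;
  br_linear_l : forall a x y z, br (a *: x + y) z = a *: br x z + br y z;
  br_linear_r : forall a x y z, br z (a *: x + y) = a *: br z x + br z y;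
  br_alternating : forall x, br x x = 0;
  br_jacobi : forall x y z, br x (br y z) + br y (br z x) + br z (br x y) = 0
}.

Section LieAlgebra.
Variables (K : fieldType) (g : lieAlgebra K).
Implicit Types (U V W : {vspace g}) (x y : g).

Definition ad x : 'End(g) := linfun (br x).

Lemma adE x y : ad x y = br x y.
Proof.
pose f := HB.pack (br x)
  (GRing.isLinear.Build K g g *:%R (br x) (fun a u v => br_linear_r a u v x))
  : {linear g -> g}.
by rewrite /ad -[br x]/(f : g -> g) lfunE.
Qed.

Definition brV U V : {vspace g} :=
  <<[seq br x y | x <- vbasis U, y <- vbasis V]>>%VS.

Definition subalgebra U := (brV U U <= U)%VS.
Definition ideal U := (brV fullv U <= U)%VS.

Definition simple_lie :=
  brV fullv fullv <> 0%VS /\ (forall U, ideal U -> U = 0%VS \/ U = fullv).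

Definition nilpotent_lie U := exists k, iter k (brV U) U = 0%VS.

Definition cartan_subalgebra U :=
  [/\ subalgebra U, nilpotent_lie U
    & forall x, (forall y, y \in U -> br x y \in U) -> x \in U].

Definition ltrace (f : 'End(g)) : K :=
  \sum_(i < \dim {:g}) coord (vbasis fullv) i (f (vbasis fullv)`_i).

Definition killing x y : K := ltrace (ad x \o ad y)%VF.

(* g (x) g is modelled by coefficient matrices with respect to the basis
   b (x) b, where b is the fixed basis [vbasis fullv] of g. *)
Definition gtensor := 'M[K]_(\dim {:g}).
Local Notation b i := (vbasis {:g})`_i.

Definition tens x y : gtensor :=
  \matrix_(i, j) (coord (vbasis fullv) i x * coord (vbasis fullv) j y).

Definition tensV U V : {vspace gtensor} :=
  <<[seq tens x y | x <- vbasis U, y <- vbasis V]>>%VS.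

(* u (x) v acting on g (x) g *)
Definition tens_map (u v : 'End(g)) (Z : gtensor) : gtensor :=
  \sum_i \sum_j Z i j *: tens (u (b i)) (v (b j)).

Lemma tens_mapE (u v : 'End(g)) x y :
  tens_map u v (tens x y) = tens (u x) (v y).
Proof.
apply/matrixP => k l; rewrite /tens_map summxE [RHS]mxE.
rewrite {2}(coord_vbasis (memvf x)) {2}(coord_vbasis (memvf y)).
rewrite !linear_sum /= big_distrl /=; apply: eq_bigr => i _.
rewrite summxE big_distrr /=; apply: eq_bigr => j _.
by rewrite !linearZ /= !mxE mulrACA.
Qed.

Definition tens_act x (Z : gtensor) : gtensor :=
  tens_map (ad x) \1%VF Z + tens_map \1%VF (ad x) Z.

(* The bilinear form on g (x) g with
   (A (x) B, C (x) D) |-> killing A C * killing B D. *)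
Definition tens_pair (Y Z : gtensor) : K :=
  \sum_i \sum_j \sum_k \sum_l
    Y i j * Z k l * (killing (b i) (b k) * killing (b j) (b l)).

(* A Lie algebra l acting on a space M through rho; V is a subspace of M. *)
Definition submodule (M : vectType K) (rho : g -> M -> M) (l : {vspace g})
    (V : {vspace M}) :=
  forall x v, x \in l -> v \in V -> rho x v \in V.

Definition irreducible_submodule (M : vectType K) (rho : g -> M -> M)
    (l : {vspace g}) (V : {vspace M}) :=
  [/\ V <> 0%VS, submodule rho l V
    & forall W : {vspace M}, (W <= V)%VS -> submodule rho l W ->
        W = 0%VS \/ W = V].

(* The truncated exponential series; it is the exponential when a is
   nilpotent, the only case in which it is used. *)
Definition nilexp (a : 'End(g)) : 'End(g) :=
  \sum_(k < (\dim {:g}).+1) (k`!%:R)^-1 *: iter k (fun u => (a \o u)%VF) \1%VF.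

(* Roots: a is an element of the dual space of h. *)
Definition hdual (h : {vspace g}) := 'Hom(subvs_of h, K^o).

Definition root_space (h : {vspace g}) (a : hdual h) : {vspace g} :=
  (\bigcap_(j < \dim {:subvs_of h})
     lker (ad (vsval (vbasis {:subvs_of h})`_j)
           - a (vbasis {:subvs_of h})`_j *: \1%VF))%VS.

Lemma mem_root_space (h : {vspace g}) (a : hdual h) x :
  reflect (forall H, br (vsval H) x = a H *: x) (x \in root_space a).
Proof.
pose b := vbasis {:subvs_of h}.
pose U j := lker (ad (vsval b`_j) - a b`_j *: \1%VF).
have memU j : (x \in U j) = (br (vsval b`_j) x == a b`_j *: x).
  by rewrite memv_ker add_lfunE opp_lfunE scale_lfunE id_lfunE adE subr_eq0.
have -> : (x \in root_space a)
    = [forall j : 'I_(\dim {:subvs_of h}), x \in U j].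
  apply/idP/forallP => [xa j | xa].
    by apply: subvP xa; apply: bigcapv_inf (subvv _).
  by rewrite memvE; apply/subv_bigcapP => j _; rewrite -memvE; exact: xa.
apply: (iffP forallP) => [xa H | xa j]; last by rewrite memU xa.
rewrite (coord_vbasis (memvf H)).
suff lin (c : 'I_(\dim {:subvs_of h}) -> K) :
    br (vsval (\sum_i c i *: b`_i)) x = (\sum_i c i * a b`_i) *: x.
  rewrite lin linear_sum; congr (_ *: _).
  by apply: eq_bigr => i _; rewrite linearZ.
pose F (t : subvs_of h) := br (vsval t) x.
have FP k u v : F (k *: u + v) = k *: F u + F v by rewrite /F linearP br_linear_l.
have FD : {morph F : u v / u + v}.
  by move=> u v; rewrite -[u]scale1r FP !scale1r.
have F0 : F 0 = 0 by apply: (addrI (F 0)); rewrite -FD !addr0.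
rewrite -/(F _) (big_morph F FD F0) scaler_suml; apply: eq_bigr => i _.
rewrite -[_ *: b`_i]addr0 FP F0 addr0 -scalerA /F.
by have := xa i; rewrite memU => /eqP ->.
Qed.

Definition is_root (h : {vspace g}) (a : hdual h) :=
  a != 0 /\ root_space a <> 0%VS.

End LieAlgebra.

(* Dynkin types with Bourbaki numbering; indices start at 1. *)
Inductive dynkin_type : Type :=
  | TypeB of nat | TypeC of nat | TypeD of nat
  | TypeE6 | TypeE7 | TypeE8 | TypeF4.

Definition dynkin_rank T : nat :=
  match T with
  | TypeB n | TypeC n | TypeD n => n
  | TypeE6 => 6 | TypeE7 => 7 | TypeE8 => 8 | TypeF4 => 4
  end.

Definition dynkin_edge T (i j : nat) : bool :=
  match T with
  | TypeB _ | TypeC _ | TypeF4 => i.+1 == j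
  | TypeD n => ((i.+1 == j) && (j < n)%N) || ((i.+2 == j) && (j == n))
  | TypeE6 | TypeE7 | TypeE8 =>
      (i, j) \in [:: (1, 3); (3, 4); (2, 4); (4, 5); (5, 6); (6, 7); (7, 8)]%N
  end.

(* cartan_entry T i j = 2 <alpha_i, alpha_j> / <alpha_j, alpha_j> *)
Definition cartan_entry T (i j : nat) : int :=
  if i == j then 2
  else if dynkin_edge T i j || dynkin_edge T j i then
    match T with
    | TypeB n => if j == n then - 2 else - 1
    | TypeC n => if i == n then - 2 else - 1
    | TypeF4 => if (i == 2%N) && (j == 3%N) then - 2 else - 1
    | _ => - 1
    end
  else 0.

Definition listed_type T (i : nat) : bool :=
  match T with
  | TypeB n => (3 <= i <= n)%N
  | TypeC n => (2 <= i <= n.-1)%N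
  | TypeD n => (3 <= i <= n - 3)%N
  | TypeE6 => (i == 3%N) || (i == 5%N)
  | TypeE7 => (i == 2%N) || (i == 6%N)
  | TypeE8 => i == 1%N
  | TypeF4 => i == 4%N
  end.

(* A Cartan subalgebra, its roots, and a choice of simple roots
   (equivalently, of a Borel subalgebra h + u). *)
Record rootDatum (K : fieldType) (g : lieAlgebra K) := RootDatum {
  hh : {vspace g};
  hh_cartan : cartan_subalgebra hh;
  roots : seq (hdual hh);
  roots_uniq : uniq roots;
  rootsP : forall a, a \in roots <-> is_root a;
  rk : nat;
  base : rk.-tuple (hdual hh);
  base_basis : basis_of fullv base;
  base_roots : {subset base <= roots};
  base_sign : forall a, a \in roots ->
    exists c : 'I_rk -> nat,
      a = \sum_(i < rk) base`_i *+ c i \/ a = - \sum_(i < rk) base`_i *+ c i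
}.

Section Parabolic.
Variables (R : realType) (g : lieAlgebra R[i]) (D : rootDatum g).
Local Notation h := (hh D).
Local Notation h' := (hdual (hh D)).
Implicit Types (a c nu : h') (W : {vspace g}).

(* The isomorphism of h' with h given by the Killing form. *)
Definition sharp a : subvs_of h :=
  xget 0 [set t | forall H, killing (vsval t) (vsval H) = a H]%classic.

Definition ip a c : R[i] := killing (vsval (sharp a)) (vsval (sharp c)).

Definition long a := forall c, c \in roots D -> ip c c <= ip a a.

Definition has_type (T : dynkin_type) :=
  rk D = dynkin_rank T /\
  forall i j : 'I_(rk D),
    2 * ip (base D)`_i (base D)`_j / ip (base D)`_j (base D)`_j
    = (cartan_entry T i.+1 j.+1)%:~R.

Definition positive a := [forall i, 0 <= coord (base D) i a].

Definition rootsV W : seq h' :=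
  [seq a <- roots D | (root_space a <= W)%VS].

Definition rootsV_at nu W : seq h' :=
  [seq a <- rootsV W | nu - a \in roots D].

Definition simple_except (q : 'I_(rk D)) : seq h' :=
  [seq (base D)`_(val j) | j <- enum 'I_(rk D) & j != q].

Definition levi q : {vspace g} :=
  (h + \sum_(a <- roots D | a \in <<simple_except q>>%VS) root_space a)%VS.

Definition nilrad q : {vspace g} :=
  (\sum_(a <- roots D | positive a && (a \notin <<simple_except q>>%VS))
     root_space a)%VS.

Definition parabolic q : {vspace g} := (levi q + nilrad q)%VS.

Definition quasi_heisenberg q :=
  brV (nilrad q) (brV (nilrad q) (nilrad q)) = 0%VS /\
  (1 < \dim (brV (nilrad q) (nilrad q)))%N.

Definition grading (q : 'I_(rk D)) (j : int) : {vspace g} :=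
  ((if j == 0%R then h else 0) +
   \sum_(a <- roots D | coord (base D) q a == j%:~R%R) root_space a)%VS.

Definition zn q := grading q 2.
Definition znbar q := grading q (- 2).
Definition nbar q := (grading q (- 1) + grading q (- 2))%VS.

Definition highest_weight q (M : vectType R[i]) (rho : g -> M -> M)
    (V : {vspace M}) nu :=
  exists v : M,
    [/\ v \in V, v != 0, forall H : subvs_of h, rho (vsval H) v = nu H *: v
      & forall a x, a \in rootsV (levi q) -> positive a -> x \in root_space a ->
          rho x v = 0].

Definition fundamental_weight (q : 'I_(rk D)) (lam : h') :=
  forall j : 'I_(rk D),
    2 * ip lam (base D)`_j / ip (base D)`_j (base D)`_j = (j == q)%:R.

(* mu and gamma are the highest weights of g(1) and of z(n). *)
Definition special_constituent q (mu gamma eps : h')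
    (V : {vspace gtensor g}) :=
  [/\ (V <= tensV (levi q) (zn q))%VS,
      irreducible_submodule (@tens_act _ g) (levi q) V,
      highest_weight q (@tens_act _ g) V (mu + eps),
      mu + eps <> gamma
    & eps \in rootsV (grading q 1)].

Definition type1a (mu eps : h') :=
  [/\ mu + eps \notin roots D, eps <> mu, long mu & long eps].

Definition type2 (mu eps : h') := eps = mu /\ mu + mu \notin roots D.

End Parabolic.

Definition largest (P : nat -> Prop) (m : nat) :=
  P m /\ forall j, P j -> (j <= m)%N.

Record rootVectors (R : realType) (g : lieAlgebra R[i]) (D : rootDatum g) :=
  RootVectors {
  X : hdual (hh D) -> g;
  Hc : hdual (hh D) -> subvs_of (hh D);
  N : hdual (hh D) -> hdual (hh D) -> R[i];
  X_root : forall a, a \in roots D -> X a \in root_space a;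
  X_opp : forall a, a \in roots D -> br (X a) (X (- a)) = vsval (Hc a);
  X_killing : forall a, a \in roots D -> killing (X a) (X (- a)) = 1;
  Hc_val : forall a c, a \in roots D -> c \in roots D -> c (Hc a) = ip a c;
  N_br : forall a c, a \in roots D -> c \in roots D -> a + c \in roots D ->
    br (X a) (X c) = N a c *: X (a + c);
  N_0 : forall a c, a \in roots D -> c \in roots D -> a + c \notin roots D ->
    a + c <> 0 -> N a c = 0;
  N_cyclic : forall a1 a2 a3,
    a1 \in roots D -> a2 \in roots D -> a3 \in roots D ->
    a1 + a2 + a3 = 0 -> N a1 a2 = N a2 a3 /\ N a2 a3 = N a3 a1;
  N_opp : forall a c (p q : nat),
    a \in roots D -> c \in roots D -> a + c \in roots D ->
    largest (fun j => c - a *+ j \in roots D) p ->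
    largest (fun j => c + a *+ j \in roots D) q ->
    N a c * N (- a) (- c) = - ((q * (1 + p))%N%:R / 2 * ip a a)
}.

(* S is a real form of the complex subalgebra W. *)
Definition real_form (R : realType) (g : lieAlgebra R[i]) (W : {vspace g})
    (S : set g) : Prop :=
  [/\ forall x, S x -> x \in W,
      S 0,
      forall (r : R) x y, S x -> S y -> S (r%:C *: x + y),
      forall x y, S x -> S y -> S (br x y)
    & forall x, x \in W ->
        exists! p : g * g, [/\ S p.1, S p.2 & x = p.1 + 'i *: p.2]].

Fixpoint Ck (R : realType) (m k : nat) (f : 'rV[R]_m -> R) : Prop :=
  match k with
  | 0 => continuous f
  | k'.+1 => (forall x v, derivable f x v) /\ forall v, Ck k' ('D_v f)
  end.

Section Bundle.
Variables (R : realType) (g : lieAlgebra R[i]) (D : rootDatum g).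
Variables (q : 'I_(rk D)) (g0 : set g).

(* The group Nbar_0 is realised, through Ad, as the group of the automorphisms
   exp (ad x) of g, with x in nbar and g0 (Ad is injective on a unipotent
   subgroup); its law is composition.  A line_section f is a complex function of
   which only the values on Nbar_0 matter. *)
Definition line_section := 'End(g) -> R[i].

(* exp is a diffeomorphism from the Lie algebra of Nbar_0 to Nbar_0. *)
Definition smooth_section (f : line_section) :=
  forall (m : nat) (e : 'I_m -> g),
    (forall i, e i \in nbar q /\ g0 (e i)) ->
    let F (t : 'rV[R]_m) := f (nilexp (ad (\sum_i (t ord0 i)%:C *: e i))) in
    forall k, Ck k (fun t => complex.Re (F t)) /\ Ck k (fun t => complex.Im (F t)).

Definition Rreal (A : g) (f : line_section) : line_section := fun n =>
  let F (t : R) := f (n \o nilexp (ad (t%:C *: A)))%VF in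
  derive1 (fun t => complex.Re (F t)) 0 +i* derive1 (fun t => complex.Im (F t)) 0.

Definition re_part (Y : g) : g :=
  xget 0 [set A | g0 A /\ exists2 B, g0 B & Y = A + 'i *: B]%classic.
Definition im_part (Y : g) : g :=
  xget 0 [set B | g0 B /\ exists2 A, g0 A & Y = A + 'i *: B]%classic.

(* complex linear extension to nbar *)
Definition RX (Y : g) (f : line_section) : line_section := fun n =>
  Rreal (re_part Y) f n + 'i * Rreal (im_part Y) f n.

(* An element of the enveloping algebra of nbar is given by a linear
   combination of words in nbar. *)
Definition words := seq (R[i] * seq g).

Definition RU (u : words) (f : line_section) : line_section := fun n =>
  \sum_(cw <- u) cw.1 * foldr RX f cw.2 n.

Definition proj_q (Y : g) : g := daddv_pi (parabolic q) (nbar q) Y.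
Definition proj_nbar (Y : g) : g := daddv_pi (nbar q) (parabolic q) Y.
Definition proj_h (Y : g) : subvs_of (hh D) :=
  vsproj (hh D)
    (daddv_pi (hh D) (\sum_(a <- roots D) root_space a)%VS Y).

(* As a character of l, extended trivially to n, lam is evaluated on the
   component in h. *)
Definition pi_s (lam : hdual (hh D)) (s : R[i]) (Y : g) (f : line_section) : line_section :=
  fun n =>
    let AY := (n^-1)%VF Y in
    s * lam (proj_h (proj_q AY)) * f n - RX (proj_nbar AY) f n.

End Bundle.

Section Omega2.
Variables (R : realType) (g : lieAlgebra R[i]) (D : rootDatum g).
Variables (B : rootVectors D) (q : 'I_(rk D)).

Definition omega : gtensor g :=
  \sum_(c <- rootsV D (zn q)) tens (X B (- c)) (X B c).
Definition omega_bar : gtensor g :=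
  \sum_(c <- rootsV D (zn q)) tens (X B c) (X B (- c)).

Definition tau2 (x : g) : gtensor g :=
  2^-1 *: tens_map (ad x \o ad x)%VF \1%VF omega.

Definition tau2_tilde (Y : gtensor g) (x : g) : R[i] := tens_pair Y (tau2 x).

Definition polar (f : g -> R[i]) (x y : g) : R[i] :=
  (f (x + y) - f x - f y) / 2.

(* An element of Sym^2 is given by a linear combination of products of two
   vectors.  Since X_{- a} is dual to X_a under the Killing form, the quadratic
   form f on g(1) is the sum of
   polar f X_a X_c * killing (.) X_{- a} * killing (.) X_{- c}. *)
Definition sym2_of (f : g -> R[i]) : seq (R[i] * (g * g)) :=
  [seq (polar f (X B a) (X B c), (X B (- a), X B (- c)))
     | a <- rootsV D (grading q 1), c <- rootsV D (grading q 1)].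

Definition symmetrize (S : seq (R[i] * (g * g))) : words g :=
  [seq (t.1 / 2, [:: t.2.1; t.2.2]) | t <- S] ++
  [seq (t.1 / 2, [:: t.2.2; t.2.1]) | t <- S].

Definition Omega2 (g0 : set g) (Y : gtensor g) : line_section g -> line_section g :=
  RU g0 (symmetrize (sym2_of (tau2_tilde Y))).

Definition Ylow (mu eps : hdual (hh D)) : gtensor g :=
  tens_map (ad (X B (- mu)) \o ad (X B (- eps)))%VF \1%VF omega_bar.

Definition Cconst (mu eps : hdual (hh D)) : R[i] :=
  \sum_(c <- rootsV_at (mu + eps) (zn q))
    N B mu (eps - c) * N B (- mu) (c - eps) * N B eps (- c) * N B (- eps) c.

End Omega2.

Definition op_commutator (R : realType) (g : lieAlgebra R[i])
    (P Q : line_section g -> line_section g) (f : line_section g) : line_section g :=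
  fun n => P (Q f) n - Q (P f) n.

(* Main.v *)
(* For a section f, pi_s(X_mu) f is a sum of products phi_l * h, where
   phi_l(n) = l(n^-1 X_mu) for a linear form l on g and h is f or one of its
   right derivatives.  Since R(X) phi_l = - phi_(l o ad X), the Leibniz rule
   shows that [pi_s(X_mu), R(X_(-a)) R(X_(-c))] at e only involves
   R([X_(-c), [X_(-a), X_mu]]) and s times the values of lambda_q at the
   h-components of [X_(-a), X_mu] and [X_(-c), X_mu]; these vanish unless
   a = mu, respectively c = mu.  If P(a, c) are the coefficients of the
   quadratic form defining Omega_2, then P(a, c) = 0 unless a + c = mu + eps, and
   P(mu, eps) = C(mu, eps) / 2, whence the coefficient of s.

   It remains to evaluate the sum of P(a, c) [X_(-c), [X_(-a), X_mu]].  P is the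
   trace of ad X_(-eps) ad X_(-mu) ad X_a ad X_c on z(nbar), symmetrized in a, c.
   As the trace is invariant under root vectors of l, P(a, c) is a multiple of
   P(mu, eps), and the product formula for the N's shows that each root
   a != mu, eps contributes |mu|^2 C(mu, eps) / 4 in type 1a.  Finally
   |mu| = |alpha_q|: no root of g(1) is longer than alpha_q, and reflections in
   the simple roots of l move alpha_q to an l-dominant root of g(1), which is mu
   since mu is the highest weight. *)
Require Import Defs.
From HB Require Import structures.
From mathcomp Require Import all_boot all_order all_algebra.
From mathcomp Require Import all_classical all_reals all_analysis.
From mathcomp Require Import complex.
From mathcomp Require Import ring lra zify.

(* Otherwise [roots] denotes the roots of a graph. *)
Import Defs.

Set Implicit Arguments.
Unset Strict Implicit.
Unset Printing Implicit Defensive.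

Import Order.TTheory GRing.Theory Num.Theory.
Import numFieldNormedType.Exports.
Import passmx.

Local Open Scope ring_scope.
Local Open Scope complex_scope.

(* Unification must not unfold these into matrix computations. *)
#[local] Opaque root_space ltrace ad killing sharp ip.

#[local] Transparent ltrace killing.

(** * Brackets, traces and the Killing form *)

Section LieBasics.
Variables (K : fieldType) (g : lieAlgebra K).
Implicit Types x y z : g.

(** Two features of the definitions shape the proof. A [rootDatum] gives h as a nilpotent
    self-normalizing subalgebra, with its roots and a base, but no decomposition of g into root
    spaces; the root theory is drawn from the normalized X_a and from eigenvectors of ad H. A smooth
    section is smooth in exponential coordinates, so right derivatives have to be read there: nbar
    is two-step, hence exp X exp(tA) = exp(X + t(A + [X, A]/2)) is a straight line in these
    coordinates. This rests on an exact product formula for the truncated series [nilexp].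

    The value s_2 is a count. In type 1a with mu and eps orthogonal, the roots a = mu and a = eps
    contribute nothing to the sum of double brackets, and the remaining ones, two fewer than
    Delta_(mu+eps)(g(1)), contribute equally. If mu and eps are not orthogonal, no mu + eps -
    gamma_t is a root, so C(mu, eps) and the whole quadratic form vanish. In type 2 the root mu
    stands alone, and [X_(-mu), [X_(-mu), X_mu]] turns s into s + 1. *)

Lemma brDr x y z : br x (y + z) = br x y + br x z.
Proof. by rewrite -!adE linearD. Qed.
Lemma brZr x c y : br x (c *: y) = c *: br x y.
Proof. by rewrite -!adE linearZ. Qed.
Lemma br0r x : br x 0 = 0.
Proof. by rewrite -adE linear0. Qed.
Lemma brNr x y : br x (- y) = - br x y.
Proof. by rewrite -!adE linearN. Qed.

Lemma brDl x y z : br (x + y) z = br x z + br y z.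
Proof. by have := br_linear_l 1 x y z; rewrite !scale1r. Qed.
Lemma br0l x : br 0 x = 0.
Proof. by apply: (addrI (br 0 x)); rewrite -brDl !addr0. Qed.
Lemma brZl c x z : br (c *: x) z = c *: br x z.
Proof. by have := br_linear_l c x 0 z; rewrite br0l !addr0. Qed.

Lemma brC x y : br x y = - br y x.
Proof.
apply/eqP; rewrite -addr_eq0; apply/eqP.
have := br_alternating (x + y).
by rewrite brDl !brDr !br_alternating add0r addr0.
Qed.

Lemma brNl x y : br (- x) y = - br x y.
Proof. by rewrite brC brNr -brC. Qed.

Lemma br_sumr (I : Type) (r : seq I) (P : pred I) (F : I -> g) x :
  br x (\sum_(i <- r | P i) F i) = \sum_(i <- r | P i) br x (F i).
Proof. by rewrite -adE linear_sum; apply: eq_bigr => i _; exact: adE. Qed.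

Lemma br_suml (I : Type) (r : seq I) (P : pred I) (F : I -> g) x :
  br (\sum_(i <- r | P i) F i) x = \sum_(i <- r | P i) br (F i) x.
Proof.
by rewrite brC br_sumr -sumrN; apply: eq_bigr => i _; rewrite -brC.
Qed.

Lemma br_derivation x y z : br x (br y z) = br (br x y) z + br y (br x z).
Proof.
have := br_jacobi x y z.
rewrite (brC z x) brNr (brC z) => /eqP; rewrite addr_eq0 opprK => /eqP /(canRL (addrK _)).
by rewrite opprK.
Qed.

Lemma adD x y : ad (x + y) = ad x + ad y.
Proof. by apply/lfunP => z; rewrite add_lfunE !adE brDl. Qed.
Lemma adZ c x : ad (c *: x) = c *: ad x.
Proof. by apply/lfunP => z; rewrite scale_lfunE !adE brZl. Qed.
Lemma adN x : ad (- x) = - ad x.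
Proof. by apply/lfunP => z; rewrite opp_lfunE !adE brNl. Qed.
Lemma ad0 : ad (0 : g) = 0.
Proof. by apply/lfunP => z; rewrite zero_lfunE !adE br0l. Qed.

Lemma ad_br x y : ad (br x y) = (ad x \o ad y)%VF - (ad y \o ad x)%VF.
Proof.
apply/lfunP => z; rewrite add_lfunE opp_lfunE !comp_lfunE !adE.
by rewrite (br_derivation x y z) addrK.
Qed.

Lemma mem_brV (U V : {vspace g}) x y : x \in U -> y \in V -> br x y \in brV U V.
Proof.
move=> xU yV; rewrite (coord_vbasis xU) (coord_vbasis yV) br_suml.
apply: memv_suml => i _; rewrite br_sumr; apply: memv_suml => j _.
rewrite brZl brZr memvZ // memvZ //; apply: memv_span.
by apply/allpairsP; exists ((vbasis U)`_i, (vbasis V)`_j);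
  split; rewrite ?mem_nth ?size_tuple //.
Qed.

Lemma ltraceE (f : 'End(g)) :
  ltrace f = \tr (mxof (vbasis fullv) (vbasis fullv) f).
Proof.
by apply: eq_bigr => i _; rewrite !mxE /= vecof_delta.
Qed.

Lemma ltraceD (f1 f2 : 'End(g)) : ltrace (f1 + f2) = ltrace f1 + ltrace f2.
Proof. by rewrite !ltraceE linearD /= mxtraceD. Qed.
Lemma ltraceZ c (f : 'End(g)) : ltrace (c *: f) = c * ltrace f.
Proof. by rewrite !ltraceE linearZ /= mxtraceZ. Qed.
Lemma ltraceC (f1 f2 : 'End(g)) : ltrace (f1 \o f2)%VF = ltrace (f2 \o f1)%VF.
Proof.
by rewrite !ltraceE !(@mxof_comp _ _ _ _ _ (vbasis {:g})) ?vbasisP // mxtrace_mulC.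
Qed.

Lemma killingC x y : killing x y = killing y x.
Proof. exact: ltraceC. Qed.
Lemma killingDl x y z : killing (x + y) z = killing x z + killing y z.
Proof. by rewrite /killing adD comp_lfunDl ltraceD. Qed.
Lemma killingZl c x z : killing (c *: x) z = c * killing x z.
Proof. by rewrite /killing adZ -comp_lfunZl ltraceZ. Qed.
Lemma killingDr x y z : killing x (y + z) = killing x y + killing x z.
Proof. by rewrite !(killingC x) killingDl. Qed.
Lemma killingZr c x z : killing x (c *: z) = c * killing x z.
Proof. by rewrite !(killingC x) killingZl. Qed.
Lemma killing0l x : killing 0 x = 0.
Proof. by rewrite -(scale0r 0) killingZl mul0r. Qed.
Lemma killing0r x : killing x 0 = 0.
Proof. by rewrite killingC killing0l. Qed.
Lemma killingNl x y : killing (- x) y = - killing x y.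
Proof. by rewrite -scaleN1r killingZl mulN1r. Qed.
Lemma killingNr x y : killing x (- y) = - killing x y.
Proof. by rewrite killingC killingNl killingC. Qed.

Lemma killing_suml (I : Type) (r : seq I) (P : pred I) (F : I -> g) y :
  killing (\sum_(i <- r | P i) F i) y = \sum_(i <- r | P i) killing (F i) y.
Proof.
by apply: (big_morph (fun x => killing x y)) => [u v|]; rewrite ?killingDl ?killing0l.
Qed.
Lemma killing_sumr (I : Type) (r : seq I) (P : pred I) (F : I -> g) y :
  killing y (\sum_(i <- r | P i) F i) = \sum_(i <- r | P i) killing y (F i).
Proof. by rewrite killingC killing_suml; apply: eq_bigr => i _; rewrite killingC. Qed.

(** Cyclicity of the trace, applied to ad [x, y] = ad x ad y - ad y ad x. *)
Lemma killing_br x y z : killing (br x y) z = killing x (br y z).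
Proof.
have E (a b c : g) : ltrace ((ad a \o ad b) \o ad c)%VF = ltrace (ad b \o (ad c \o ad a))%VF.
  by rewrite -comp_lfunA ltraceC comp_lfunA.
rewrite /killing !ad_br comp_lfunDl comp_lfunDr !ltraceD.
rewrite comp_lfunNl comp_lfunNr -!scaleN1r !ltraceZ.
by rewrite (E y x) -(comp_lfunA (ad x)).
Qed.

End LieBasics.
#[local] Opaque ltrace killing.

#[local] Transparent killing.

(** * The pairing on the tensor square of g *)

Section TensorPairing.
Variables (K : fieldType) (g : lieAlgebra K).
Implicit Types (x y z w : g) (Y Z : gtensor g) (u v : 'End(g)).
Local Notation b i := (vbasis {:g})`_i.
#[local] Opaque killing.

Lemma tens_map_sum (I : Type) (r : seq I) (P : pred I) (F : I -> gtensor g) u v :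
  tens_map u v (\sum_(i <- r | P i) F i) = \sum_(i <- r | P i) tens_map u v (F i).
Proof.
rewrite /tens_map [RHS]exchange_big; apply: eq_bigr => i _ /=.
rewrite [RHS]exchange_big; apply: eq_bigr => j _ /=.
by rewrite summxE scaler_suml.
Qed.

Lemma killing_coord x y : killing x y = \sum_i \sum_k
  coord (vbasis {:g}) i x * coord (vbasis {:g}) k y * killing (b i) (b k).
Proof.
rewrite {1}(coord_vbasis (memvf x)) killing_suml; apply: eq_bigr => i _.
rewrite {1}(coord_vbasis (memvf y)) killing_sumr; apply: eq_bigr => k _.
by rewrite killingZl killingZr mulrA.
Qed.

Lemma tens_pair_tens x y z w :
  tens_pair (tens x y) (tens z w) = killing x z * killing y w.
Proof.
rewrite (killing_coord x z) (killing_coord y w) mulr_suml; apply: eq_bigr => i _.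
rewrite exchange_big mulr_suml; apply: eq_bigr => k _ /=.
rewrite mulr_sumr; apply: eq_bigr => j _; rewrite mulr_sumr; apply: eq_bigr => l _.
by rewrite !mxE; ring.
Qed.

Lemma tens_pair_suml (I : Type) (r : seq I) (P : pred I) (F : I -> gtensor g) Z :
  tens_pair (\sum_(i <- r | P i) F i) Z = \sum_(i <- r | P i) tens_pair (F i) Z.
Proof.
rewrite /tens_pair [RHS]exchange_big; apply: eq_bigr => i _ /=.
rewrite [RHS]exchange_big; apply: eq_bigr => j _ /=.
rewrite [RHS]exchange_big; apply: eq_bigr => k _ /=.
rewrite [RHS]exchange_big; apply: eq_bigr => l _ /=.
by rewrite summxE !mulr_suml.
Qed.

Lemma tens_pair_sumr (I : Type) (r : seq I) (P : pred I) (F : I -> gtensor g) Y :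
  tens_pair Y (\sum_(i <- r | P i) F i) = \sum_(i <- r | P i) tens_pair Y (F i).
Proof.
rewrite /tens_pair [RHS]exchange_big; apply: eq_bigr => i _ /=.
rewrite [RHS]exchange_big; apply: eq_bigr => j _ /=.
rewrite [RHS]exchange_big; apply: eq_bigr => k _ /=.
rewrite [RHS]exchange_big; apply: eq_bigr => l _ /=.
by rewrite summxE mulr_sumr mulr_suml.
Qed.

Lemma tens_pairZr c Y Z : tens_pair Y (c *: Z) = c * tens_pair Y Z.
Proof.
rewrite /tens_pair mulr_sumr; apply: eq_bigr => i _.
rewrite mulr_sumr; apply: eq_bigr => j _; rewrite mulr_sumr; apply: eq_bigr => k _.
by rewrite mulr_sumr; apply: eq_bigr => l _; rewrite !mxE; ring.
Qed.

(** Each ad is skew for the Killing form, so the adjoint of a product of two has no sign and the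
    reverse order. *)
Lemma killing_br2 x y z w : killing (br x (br y z)) w = killing z (br y (br x w)).
Proof. by rewrite brC killingNl killing_br brC killingNl killing_br !opprK. Qed.

End TensorPairing.
#[local] Opaque killing.


(** * Products of nilpotent exponentials *)

Section DividedPowers.
Variable E : nzRingType.
Hypothesis mulrn_tf : forall (x : E) n, x *+ n.+1 = 0 -> x = 0.
Implicit Types (x y : E) (al be : nat -> E).

(** [al k] stands for x^k / k!; the recurrence expresses this without dividing, in a ring known only
    to be torsion-free. *)
Definition divided_powers x al := al 0%N = 1 /\ forall k, al k.+1 *+ k.+1 = x * al k.

Lemma mulrn_cancel x y n : x *+ n.+1 = y *+ n.+1 -> x = y.
Proof.
move=> E0; apply/eqP; rewrite -subr_eq0; apply/eqP/(mulrn_tf (n := n)).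
by rewrite mulrnBl E0 subrr.
Qed.

Lemma divided_powers_comm x al y : divided_powers x al -> x * y = y * x ->
  forall k, al k * y = y * al k.
Proof.
move=> [al0 alS] xy; elim=> [|k IH]; first by rewrite al0 mul1r mulr1.
apply: (mulrn_cancel (n := k)); rewrite -mulrnAl -mulrnAr alS -mulrA IH.
by rewrite mulrA xy mulrA.
Qed.

(* W' = (S + C t) W determines W from its constant term. *)
Lemma linear_ode_uniq (W U : {poly E}) (S C : E) :
  W^`() = (S%:P + C%:P * 'X) * W -> U^`() = (S%:P + C%:P * 'X) * U ->
  W`_0 = U`_0 -> W = U.
Proof.
have coefS (V : {poly E}) : V^`() = (S%:P + C%:P * 'X) * V -> forall k,
    V`_k.+1 *+ k.+1 = S * V`_k + C * (if k is k'.+1 then V`_k' else 0).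
  move=> E0 k; rewrite -coef_deriv E0 mulrDl coefD coefCM -mulrA coefCM.
  by rewrite -commr_polyX coefMX; case: k.
move=> /coefS WS /coefS US E0; apply/polyP => k.
have [m] := ubnP k; elim: m k => // m IH [//|k]; rewrite ltnS => km.
apply: (mulrn_cancel (n := k)); rewrite WS US IH //.
by case: k km => // k km; rewrite IH //; exact: ltnW.
Qed.

Variable N : nat.
(** The path t |-> exp(tx) as a polynomial in t with noncommuting coefficients; exp x is its value
    at 1. *)
Definition exp_poly al : {poly E} := \poly_(k < N.+1) al k.
Definition vanishing al := forall k, (N < k)%N -> al k = 0.

Lemma coef_exp_poly al k : vanishing al -> (exp_poly al)`_k = al k.
Proof. by move=> van; rewrite coef_poly ltnS; case: leqP => // /van. Qed.

Lemma exp_poly1 al : (exp_poly al).[1] = \sum_(k < N.+1) al k.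
Proof. by rewrite horner_poly; apply: eq_bigr => k _; rewrite expr1n mulr1. Qed.

Lemma deriv_exp_poly x al : divided_powers x al -> vanishing al ->
  (exp_poly al)^`() = x%:P * exp_poly al.
Proof.
move=> [_ alS] van; apply/polyP => k.
by rewrite coef_deriv coefCM !coef_exp_poly ?alS.
Qed.

Lemma horner1M (p r : {poly E}) : (p * r).[1] = p.[1] * r.[1].
Proof. by rewrite hornerM_comm // /comm_poly mulr1 mul1r. Qed.

Lemma exp_poly_comm x al y : divided_powers x al -> vanishing al -> x * y = y * x ->
  exp_poly al * y%:P = y%:P * exp_poly al.
Proof.
move=> dal van xy; apply/polyP => k; rewrite coefMC coefCM coef_exp_poly //.
exact: (divided_powers_comm dal xy).
Qed.

(** Both exp(tx) exp(ty) and exp(t(x + y)) solve W' = (x + y) W with constant term 1, so they agree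
    as polynomials in t. *)
Lemma exp_commuting x y al be ta : x * y = y * x ->
  divided_powers x al -> divided_powers y be -> divided_powers (x + y) ta ->
  vanishing al -> vanishing be -> vanishing ta ->
  (\sum_(k < N.+1) al k) * (\sum_(k < N.+1) be k) = \sum_(k < N.+1) ta k.
Proof.
move=> xy dal dbe dta val vbe vta; rewrite -!exp_poly1 -horner1M; congr (_.[1]).
apply: (@linear_ode_uniq _ _ (x + y) 0).
- rewrite derivM (deriv_exp_poly dal val) (deriv_exp_poly dbe vbe) mul0r addr0.
  by rewrite [exp_poly al * _]mulrA (exp_poly_comm dal val xy) polyCD mulrDl !mulrA.
- by rewrite (deriv_exp_poly dta vta) mul0r addr0.
by rewrite coef0M !coef_exp_poly // dal.1 dbe.1 dta.1 mulr1.
Qed.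

(* Multiplying by t: both exp(tA) exp(tB) and exp(t(A + B)) exp(t^2 H) solve
   W' = (A + B + 2 t H) W. *)
Lemma exp_two_step A B H al be si et ta :
  A * B - B * A = H + H -> A * H = H * A -> B * H = H * B ->
  divided_powers A al -> divided_powers B be -> divided_powers (A + B) si ->
  divided_powers H et -> divided_powers (A + B + H) ta ->
  vanishing al -> vanishing be -> vanishing si -> vanishing et -> vanishing ta ->
  (\sum_(k < N.+1) al k) * (\sum_(k < N.+1) be k) = \sum_(k < N.+1) ta k.
Proof.
move=> ABH AH BH dal dbe dsi det dta val vbe vsi vet vta.
have SH : (A + B) * H = H * (A + B) by rewrite mulrDl mulrDr AH BH.
rewrite -(exp_commuting SH dsi det dta) //.
set C := H + H in ABH.
have AC : A * C = C * A by rewrite mulrDl mulrDr AH.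
have SC : (A + B) * C = C * (A + B) by rewrite [LHS]mulrDr [RHS]mulrDl SH.
(* In generating form: exp(tA) B = (B + tC) exp(tA), where C = [A, B] is central for A. *)
have alB k : al k.+1 * B = B * al k.+1 + C * al k.
  have AB : A * B = C + B * A by rewrite -ABH subrK.
  elim: k => [|k IH].
    have -> : al 1%N = A by have := dal.2 0%N; rewrite mulr1n dal.1 mulr1.
    by rewrite dal.1 mulr1 AB addrC.
  apply: (mulrn_cancel (n := k.+1)); transitivity (A * al k.+1 * B).
    by rewrite -dal.2 mulrnAl.
  rewrite -mulrA IH mulrDr mulrA AB mulrDl.
  rewrite [A * (C * _)]mulrA AC -[C * A * _]mulrA -(dal.2 k) -[B * A * _]mulrA -(dal.2 k.+1).
  by rewrite mulrnDl !mulrnAr [in RHS](mulrS (C * _) k.+1) [RHS]addrCA [RHS]addrA.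
have expB : exp_poly al * B%:P = (B%:P + C%:P * 'X) * exp_poly al.
  apply/polyP => k; rewrite coefMC mulrDl coefD coefCM -mulrA coefCM -commr_polyX coefMX.
  rewrite !coef_exp_poly //; case: k => [|k] /=.
    by rewrite dal.1 mul1r mulr1 mulr0 addr0.
  by rewrite alB.
(* [K] is exp(t^2 H), whose derivative is 2tH K = tC K. *)
pose K : {poly E} := \sum_(m < N.+1) (et m)%:P * 'X^(2 * m).
have K1 : K.[1] = \sum_(k < N.+1) et k.
  rewrite horner_sum; apply: eq_bigr => m _.
  by rewrite horner1M hornerC hornerXn expr1n mulr1.
have dK : K^`() = C%:P * 'X * K.
  have -> : C%:P * 'X * K = \sum_(m < N.+1) (C * et m)%:P * 'X^((2 * m).+1).
    rewrite mulr_sumr; apply: eq_bigr => m _; rewrite polyCM -!mulrA; congr (_ * _).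
    by rewrite mulrA -commr_polyX -mulrA -exprS.
  have CS m : C * et m = et m.+1 *+ (2 * m.+1).
    by rewrite mulnC mulrnA det.2 mulr2n -mulrDl.
  (* The top term of tC K carries [et N.+1], which vanishes; the others match the derivative of [K]
     term by term. *)
  rewrite big_ord_recr /= CS vet // mul0rn polyC0 mul0r addr0.
  rewrite /K big_ord_recl derivD deriv_mulC derivXn muln0 /= mulr0n mulr0 add0r.
  rewrite raddf_sum; apply: eq_bigr => m _ /=.
  rewrite deriv_mulC derivXn CS /bump /= add1n polyCMn mulrnAl mulrnAr.
  by congr (_ * _ *+ _); congr ('X^_); lia.
rewrite -K1 -!exp_poly1 -!horner1M; congr (_.[1]).
apply: (@linear_ode_uniq _ _ (A + B) C).
- rewrite derivM (deriv_exp_poly dal val) (deriv_exp_poly dbe vbe).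
  rewrite [exp_poly al * _]mulrA expB (polyCD A B) -[_ * _ * exp_poly be]mulrA.
  by rewrite -[(_ + _) * _ * _]mulrA -mulrDl addrA.
- rewrite derivM (deriv_exp_poly dsi vsi) dK [exp_poly si * _]mulrA [exp_poly si * _]mulrA.
  rewrite (exp_poly_comm dsi vsi SC) -[C%:P * _ * 'X]mulrA commr_polyX.
  by rewrite [RHS]mulrDl !mulrA.
rewrite !coef0M !coef_exp_poly // dal.1 dbe.1 dsi.1 !mul1r.
rewrite /K big_ord_recl coefD muln0 expr0 mulr1 coefC eqxx det.1 coef_sum big1 ?addr0 //.
by move=> m _; rewrite coefCM coefXn lift0 eq_sym muln_eq0 mulr0.
Qed.

End DividedPowers.

Section NilpotentExponential.
Variables (K : numFieldType) (V : vectType K).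
Implicit Types (a b c : 'End(V)) (v : V).

Definition endo_pow a k : 'End(V) := iter k (fun u => (a \o u)%VF) \1%VF.

(** The images of the powers of a decrease strictly until they are 0, since a nonzero stable image
    would survive in the power M. Thus a nilpotent a dies by degree dim V, and the truncated series
    is the full exponential. *)
Lemma nilpotent_dim a M : endo_pow a M = 0 ->
  forall k, (\dim {:V} <= k)%N -> endo_pow a k = 0.
Proof.
move=> aM0; pose U k := limg (endo_pow a k).
have US k : U k.+1 = (a @: U k)%VS by rewrite /U /endo_pow iterS limg_comp.
have Uanti k : (U k.+1 <= U k)%VS.
  elim: k => [|k IH]; last by rewrite US [U k.+1 in X in (_ <= X)%VS]US limgS.
  by rewrite {2}/U /endo_pow /= lim1g subvf.
have U0 k j : U k = 0%VS -> U (k + j)%N = 0%VS.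
  by move=> Uk; elim: j => [|j IH]; rewrite ?addn0 // addnS US IH limg0.
have Ust k : U k.+1 = U k -> U k = 0%VS.
  move=> st; have stj j : U (k + j)%N = U k.
    by elim: j => [|j IH]; rewrite ?addn0 // addnS US IH -US.
  rewrite -(stj M) addnC; apply: U0.
  by rewrite /U aM0; apply/eqP; rewrite -lkerE; apply/subvP => v _; rewrite memv_ker lfunE.
have dimU k : U k = 0%VS \/ (\dim (U k) + k <= \dim {:V})%N.
  elim: k => [|k [IH|IH]]; first by right; rewrite addn0 dimvS ?subvf.
    by left; rewrite -addn1; exact: U0.
  have [E|E] := eqVneq (U k.+1) (U k); first by left; rewrite E; exact: Ust.
  right; rewrite addnS; apply: leq_trans IH; rewrite -addSn leq_add2r.
  rewrite ltn_neqAle dimvS // andbT; apply: contraNneq E => dE.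
  by apply/eqP/eqP; rewrite eqEdim Uanti dE leqnn.
move=> k dk; have Uk : U k = 0%VS.
  rewrite -(subnKC dk); apply: U0; have [//|] := dimU (\dim {:V}).
  by rewrite -[X in (_ <= X)%N]add0n leq_add2r leqn0 dimv_eq0 => /eqP.
apply/lfunP => v; rewrite lfunE /=; apply/eqP; rewrite -memv0 -Uk.
exact: memv_img (memvf v).
Qed.

(** The characteristic polynomial has finitely many roots. This later turns a strict shift of degree
    into nilpotency. *)
Lemma eigen_nat_finite a : exists M, forall m v, (M <= m)%N -> a v = - m%:R *: v -> v = 0.
Proof.
pose n := \dim {:V}; apply: contrapT => no.
pose b := vbasis {:V}; pose p := char_poly (mxof b b a).
have p0 : p != 0 by apply: monic_neq0; exact: char_poly_monic.
have ex M : exists m, (M <= m)%N && root p (- m%:R).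
  have [[m [v [Mm av v0]]]|no'] := pselect (exists m v, [/\ (M <= m)%N, a v = - m%:R *: v & v != 0]).
    exists m; rewrite Mm -eigenvalue_root_char; apply/eigenvalueP; exists (rVof b v).
      by rewrite -(@rVof_app _ _ _ b b) ?vbasisP // av linearZ.
    by rewrite (@rVof_eq0 _ _ b) ?vbasisP.
  exfalso; apply: no; exists M => m v Mm av; apply/eqP/negPn/negP => v0.
  by apply: no'; exists m, v.
have chain j : exists s : seq nat, [/\ size s = j, uniq s & all (fun m => root p (- m%:R)) s].
  elim: j => [|j [s [sj us rs]]]; first by exists [::].
  have [m /andP[sm rm]] := ex (\max_(i <- s) i).+1.
  exists (m :: s); split; rewrite /= ?sj ?rm //= us andbT; apply/negP => ms.
  have le : (m <= \max_(i <- s) i)%N by exact: leq_bigmax_seq.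
  by have := leq_trans sm le; rewrite ltnn.
have [s [ss us rs]] := chain (size p).
have := @max_poly_roots _ p [seq - m%:R | m <- s] p0.
rewrite size_map ss ltnn => /(_ _ _) absurd; suff : false by [].
apply: absurd; first by rewrite all_map.
rewrite map_inj_uniq // => i j /oppr_inj /eqP; rewrite eqr_nat => /eqP //.
Qed.

End NilpotentExponential.

Section NilexpMul.
Variables (K : numFieldType) (g : lieAlgebra K).
Implicit Types (a b c : 'End(g)).
Local Notation dimg := (\dim {:g}).
Hypothesis g_proper : (0 < dim g)%N.
Let E := lfun_comp_nzRingType g_proper.

Definition nil_index a := forall k, (dimg < k)%N -> endo_pow a k = 0.

Definition exp_coef a (k : nat) : E := (k`!%:R)^-1 *: endo_pow a k.

Lemma nilexpE a : nilexp a = \sum_(k < dimg.+1) exp_coef a k.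
Proof. by []. Qed.

Lemma exp_coef_divided a : divided_powers (a : E) (exp_coef a).
Proof.
split=> [|k]; first by rewrite /exp_coef fact0 invr1 scale1r.
rewrite /exp_coef -scaler_nat scalerA.
have -> : (k.+1%:R * (k.+1)`!%:R^-1 : K) = (k`!%:R)^-1.
  by rewrite factS natrM invfM mulVKf // pnatr_eq0.
by rewrite [RHS](_ : _ = (a \o ((k`!%:R)^-1 *: endo_pow a k))%VF) // -comp_lfunZr.
Qed.

Lemma exp_coef_vanishing a : nil_index a -> vanishing dimg (exp_coef a).
Proof. by move=> na k dk; rewrite /exp_coef na // scaler0. Qed.

Lemma endo_tf (x : E) n : x *+ n.+1 = 0 -> x = 0.
Proof.
move=> /eqP; rewrite -[x *+ _](scaler_nat n.+1 (x : 'End(g))) scaler_eq0 pnatr_eq0 /=.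
by move/eqP.
Qed.

(** The Baker-Campbell-Hausdorff formula in the case where c, half the commutator of a and b,
    commutes with both. *)
Lemma nilexp_mul a b c :
  ((a \o b) - (b \o a) = c + c)%VF -> (a \o c = c \o a)%VF -> (b \o c = c \o b)%VF ->
  nil_index a -> nil_index b -> nil_index c -> nil_index (a + b) ->
  nil_index (a + b + c) ->
  (nilexp a \o nilexp b)%VF = nilexp (a + b + c).
Proof.
move=> abc ac bc na nb nc nab nabc.
have H := (exp_two_step endo_tf (A := a : E) (B := b : E) (H := c : E) abc ac bc
  (exp_coef_divided a) (exp_coef_divided b) (exp_coef_divided (a + b))
  (exp_coef_divided c) (exp_coef_divided (a + b + c))
  (exp_coef_vanishing na) (exp_coef_vanishing nb) (exp_coef_vanishing nab)
  (exp_coef_vanishing nc) (exp_coef_vanishing nabc)).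
rewrite !nilexpE; exact H.
Qed.

Lemma nilexp0 : nilexp (0 : 'End(g)) = \1%VF.
Proof.
rewrite /nilexp big_ord_recl /= fact0 invr1 scale1r big1 ?addr0 // => k _.
by rewrite /= comp_lfun0l scaler0.
Qed.

End NilexpMul.

(** * Smooth functions of several real variables *)

Section DirectionalDerivatives.
Local Open Scope classical_set_scope.
Variables (R : realType) (V : normedModType R).
Implicit Types (F G : V -> R) (x y v w : V).

Lemma derive_line F x v (s : R) :
  derivable F (s *: v + x) v ->
  is_derive s 1 (fun t : R => F (t *: v + x)) ('D_v F (s *: v + x)).
Proof.
have E : (fun h : R => h^-1 *: (((fun t : R => F (t *: v + x)) \o shift s) (h *: 1) - F (s *: v + x)))
    = (fun h : R => h^-1 *: ((F \o shift (s *: v + x)) (h *: v) - F (s *: v + x))).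
  apply/funext => h /=; congr (_ *: (F _ - _)).
  by rewrite -[h *: 1]/(h * 1) mulr1 scalerDl addrA.
move=> dF; apply: DeriveDef; first by rewrite /derivable E.
by rewrite /derive E.
Qed.

Lemma mvt_line F y w (h : R) : (forall z, derivable F z w) -> h != 0 ->
  exists2 c : R, `|c| <= `|h| & F (h *: w + y) - F y = h * 'D_w F (c *: w + y).
Proof.
move=> dF h0; pose f (t : R) := F (t *: w + y).
have df (t : R) : is_derive t 1 f ('D_w F (t *: w + y)) by exact: derive_line.
have cont (a b : R) : {within `[a, b], continuous f}.
  by apply: derivable_within_continuous => t _; have [] := df t.
have [hp|hn|h00] := ltgtP 0 h; last by rewrite h00 eqxx in h0.
  have [c /itvP cI] := MVT hp (fun t _ => df t) (cont 0 h).
  rewrite subr0 /f scale0r add0r => ->; exists c; last by rewrite mulrC.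
  by rewrite !ger0_norm ?cI // ltW.
have [c /itvP cI] := MVT hn (fun t _ => df t) (cont h 0).
rewrite sub0r /f scale0r add0r => E; exists c.
  by rewrite !ltr0_norm ?cI // lerN2 ltW ?cI.
by rewrite -[LHS]opprB E mulrN opprK mulrC.
Qed.

(** Derivatives are known only one direction at a time. By the mean value theorem (F(x + hv + hw) -
    F(x + hv)) / h is a value of D_w F at a point tending to x, where D_w F is continuous. *)
Lemma derive_addv F x v w : (forall z, derivable F z w) -> {for x, continuous ('D_w F)} ->
  derivable F x v -> 'D_(v + w) F x = 'D_v F x + 'D_w F x.
Proof.
move=> dw cw dv.
have step : (fun h : R => h^-1 *: ((F \o shift (h *: v + x)) (h *: w) - F (h *: v + x))) @ 0^'
    --> 'D_w F x.
  apply/cvgrPdist_lt => e e0.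
  have /cvgrPdist_lt /(_ e e0) := cw.
  move=> /nbhs_ballP[d /= d0 dcw].
  pose M := `|v| + `|w| + 1.
  have M0 : 0 < M by rewrite ltr_wpDl // addr_ge0.
  near=> h.
  have h0 : h != 0 by near: h; exact: nbhs_dnbhs_neq.
  have hd : `|h| < d / M by near: h; apply: dnbhs0_lt; rewrite divr_gt0.
  have [c ch] := mvt_line (h *: v + x) dw h0.
  rewrite /= => ->; rewrite -[h^-1 *: _]/(h^-1 * _) mulKf //; apply: dcw.
  rewrite -ball_normE /= [X in _ - X]addrA opprD addrCA subrr addr0 normrN.
  apply: le_lt_trans (ler_normD _ _) _; rewrite !normrZ.
  have cw' : `|c| * `|w| <= `|h| * `|w| by rewrite ler_wpM2r.
  apply: (@le_lt_trans _ _ (`|h| * M)); last by rewrite -ltr_pdivlMr.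
  have hp : 0 <= `|h| by [].
  by rewrite /M; lra.
have E : (fun h : R => h^-1 *: ((F \o shift x) (h *: (v + w)) - F x))
    = (fun h : R => h^-1 *: ((F \o shift x) (h *: v) - F x))
    \+ (fun h : R => h^-1 *: ((F \o shift (h *: v + x)) (h *: w) - F (h *: v + x))).
  apply/funext => h /=; rewrite -scalerDr; congr (_ *: _).
  have -> : h *: (v + w) + x = h *: w + (h *: v + x).
    by rewrite scalerDr addrA [h *: w + _]addrC.
  by rewrite [RHS]addrC [RHS]addrA subrK.
rewrite /derive E; apply: cvg_lim => //; apply: cvgD; last exact: step.
exact: dv.
Unshelve. all: by end_near.
Qed.

End DirectionalDerivatives.

Section Smooth.
Local Open Scope classical_set_scope.
Variable R : realType.

Definition smooth m (F : 'rV[R]_m -> R) := forall k, Ck k F.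

Lemma smooth_continuous m (F : 'rV[R]_m -> R) : smooth F -> continuous F.
Proof. exact: (fun sF => sF 0%N). Qed.

Lemma smooth_derivable m (F : 'rV[R]_m -> R) x v : smooth F -> derivable F x v.
Proof. by move=> /(_ 1%N)[+ _]; apply. Qed.

Lemma smooth_derive m (F : 'rV[R]_m -> R) v : smooth F -> smooth ('D_v F).
Proof. by move=> sF k; have [_] := sF k.+1; apply. Qed.

Lemma smooth_deriveD m (F : 'rV[R]_m -> R) v w x : smooth F ->
  'D_(v + w) F x = 'D_v F x + 'D_w F x.
Proof.
move=> sF; apply: derive_addv => [z||]; try exact: smooth_derivable.
by have := smooth_continuous (smooth_derive w sF); apply.
Qed.

Lemma smooth_deriveZ m (F : 'rV[R]_m -> R) (k : R) v x : smooth F ->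
  'D_(k *: v) F x = k * 'D_v F x.
Proof.
move=> sF; have [->|k0] := eqVneq k 0.
  rewrite scale0r mul0r; have dF := @smooth_derivable _ F x 0 sF.
  have := smooth_deriveD 0 0 x sF; rewrite addr0 => /eqP.
  by rewrite -subr_eq0 opprD addrA subrr sub0r oppr_eq0 => /eqP.
have dl := derive_line (s := 0) (F := F) (x := x) (v := v).
rewrite scale0r add0r in dl; have {dl} := dl (@smooth_derivable _ F x v sF).
pose f (t : R) := F (t *: v + x); rewrite -/f => df.
have [df1 df2] := df; rewrite -df2.
pose mk : R -> R := k *: (id : R -> R).
have dmk : is_derive (0 : R) (1 : R) mk (k *: (1 : R)) by exact: is_deriveZ.
have mk0 : mk 0 = 0 by rewrite /mk; exact: mulr0.
rewrite -mk0 in df.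
have [_ dcomp] := is_derive1_comp df dmk.
have -> : 'D_(k *: v) F x = 'D_1 (f \o mk) 0.
  rewrite /derive.
  suff -> : (fun h : R => h^-1 *: ((F \o shift x) (h *: (k *: v)) - F x))
    = (fun h : R => h^-1 *: (((f \o mk) \o shift 0) (h *: 1) - (f \o mk) 0)) by [].
  apply/funext => h /=.
  rewrite addr0 mk0 /f scale0r add0r.
  by rewrite -[h *: 1]/(h * 1) mulr1 -[mk h]/(k * h) scalerA mulrC.
by rewrite dcomp mulrC -[k *: 1]/(k * 1) mulr1 df2.
Qed.

Lemma Ck_eq m k (F G : 'rV[R]_m -> R) : F =1 G -> Ck k F -> Ck k G.
Proof. by move=> /funext ->. Qed.

Lemma CkD m k (F G : 'rV[R]_m -> R) : Ck k F -> Ck k G -> Ck k (F \+ G).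
Proof.
elim: k F G => [|k IH] F G.
  by move=> cF cG x; apply: continuousD; [exact: cF|exact: cG].
move=> [dF CF] [dG CG]; split=> [x v|v]; first exact: derivableD.
apply: Ck_eq (IH _ _ (CF v) (CG v)) => x /=.
by rewrite -[F \+ G]/(F + G) deriveD.
Qed.

Lemma CkM m k (F G : 'rV[R]_m -> R) : smooth F -> smooth G -> Ck k (F \* G).
Proof.
elim: k F G => [|k IH] F G sF sG.
  move=> x; apply: continuousM; exact: smooth_continuous.
split=> [x v|v]; first by apply: derivableM; exact: smooth_derivable.
apply: Ck_eq (CkD (IH _ _ sF (smooth_derive v sG)) (IH _ _ sG (smooth_derive v sF))) => x /=.
by rewrite -[F \* G]/(F * G) deriveM //; exact: smooth_derivable.
Qed.

Lemma smoothM m (F G : 'rV[R]_m -> R) : smooth F -> smooth G -> smooth (F \* G).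
Proof. by move=> sF sG k; exact: (@CkM m k F G sF sG). Qed.

Lemma smooth_cst m (c : R) : smooth (fun _ : 'rV[R]_m => c).
Proof.
move=> k; elim: k c => [|k IH] c; first exact: cst_continuous.
split=> [x v|v]; first exact: derivable_cst.
by apply: Ck_eq (IH 0) => x; rewrite derive_cst.
Qed.

Lemma smooth_sum m (I : Type) (r : seq I) (F : I -> 'rV[R]_m -> R) :
  (forall i, smooth (F i)) -> smooth (fun x => \sum_(i <- r) F i x).
Proof.
move=> sF k; elim: r => [|i r IH].
  by apply: Ck_eq (smooth_cst m 0 k) => x; rewrite big_nil.
by apply: Ck_eq (CkD (sF i k) IH) => x; rewrite big_cons.
Qed.

Lemma coord_quot m (i : 'I_m) (x v : 'rV[R]_m) :
  is_derive x v (fun t : 'rV[R]_m => t ord0 i) (v ord0 i).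
Proof.
have E : (fun h : R => h^-1 *: (((fun t : 'rV[R]_m => t ord0 i) \o shift x) (h *: v) - x ord0 i))
    @ 0^' --> v ord0 i.
  apply: cvg_near_cst; near=> h.
  have h0 : h != 0 by near: h; exact: nbhs_dnbhs_neq.
  rewrite /= !mxE addrK -[LHS]/(h^-1 * (h * v ord0 i)) mulKf //.
apply: DeriveDef; first by apply/cvg_ex; exists (v ord0 i).
exact: cvg_lim E.
Unshelve. all: by end_near.
Qed.

Lemma smooth_coord m (i : 'I_m) : smooth (fun t : 'rV[R]_m => t ord0 i).
Proof.
case=> [|k]; first by move=> x; exact: coord_continuous.
split=> [x v|v]; first by have [] := coord_quot i x v.
apply: Ck_eq (smooth_cst m (v ord0 i) k) => x.
by have [_ ->] := coord_quot i x v.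
Qed.

Lemma continuous_rV (V : normedModType R) n (L : V -> 'rV[R]_n) :
  (forall j, continuous (fun x => L x ord0 j)) -> continuous L.
Proof.
move=> cL x; apply/cvgrPdist_le => e e0.
have H : \forall y \near nbhs x, forall j : 'I_n, `|L x ord0 j - L y ord0 j| <= e.
  apply: filter_forall => j; have /cvgrPdist_le/(_ e e0) := cL j x; exact.
apply: filterS H => y Hy.
rewrite /Num.Def.normr/= mx_normrE (bigmax_le _ (ltW e0))//= => -[i j] _.
by rewrite !mxE /= !ord1; exact: Hy.
Qed.

Lemma smooth_linear m n (F : 'rV[R]_n -> R) (L : {linear 'rV[R]_m -> 'rV[R]_n}) :
  continuous L -> smooth F -> smooth (F \o L).
Proof.
move=> cL sF k; elim: k F sF => [|k IH] F sF.
  by move=> x; apply: continuous_comp; [exact: cL|exact: smooth_continuous].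
have E x v : (fun h : R => h^-1 *: (((F \o L) \o shift x) (h *: v) - (F \o L) x))
    = (fun h : R => h^-1 *: ((F \o shift (L x)) (h *: L v) - F (L x))).
  by apply/funext => h /=; rewrite linearP.
split=> [x v|v].
  by rewrite /derivable E; exact: smooth_derivable.
apply: Ck_eq (IH _ (smooth_derive (L v) sF)) => x /=.
by rewrite /derive E.
Qed.

End Smooth.

Section ComplexDerivative.
Variable R : realType.
Implicit Types (F G : R -> R[i]) (l k c : R[i]).

(** Differentiability at 0 of a complex function of a real variable, by real and imaginary parts to
    match [Rreal]. *)
Definition is_cder F l :=
  is_derive (0 : R) (1 : R) (fun t => complex.Re (F t)) (complex.Re l) /\
  is_derive (0 : R) (1 : R) (fun t => complex.Im (F t)) (complex.Im l).

Lemma is_cderE F l : is_cder F l ->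
  derive1 (fun t => complex.Re (F t)) 0 +i* derive1 (fun t => complex.Im (F t)) 0 = l.
Proof.
by case=> [[_ E1] [_ E2]]; rewrite !derive1E E1 E2; case: l {E1 E2}.
Qed.

Lemma is_cder_cst c : is_cder (fun=> c) 0.
Proof. by split; apply: DeriveDef; rewrite ?derive_cst //; exact: derivable_cst. Qed.

Lemma cReD l k : complex.Re (l + k) = complex.Re l + complex.Re k.
Proof. by case: l k => [a b] [c d]. Qed.
Lemma cImD l k : complex.Im (l + k) = complex.Im l + complex.Im k.
Proof. by case: l k => [a b] [c d]. Qed.
Lemma cReM l k : complex.Re (l * k) = complex.Re l * complex.Re k - complex.Im l * complex.Im k.
Proof. by case: l k => [a b] [c d]. Qed.
Lemma cImM l k : complex.Im (l * k) = complex.Re l * complex.Im k + complex.Im l * complex.Re k.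
Proof. by case: l k => [a b] [c d]. Qed.

Lemma is_cderD F G l k : is_cder F l -> is_cder G k ->
  is_cder (fun t => F t + G t) (l + k).
Proof.
move=> [F1 F2] [G1 G2]; rewrite /is_cder cReD cImD; split.
  rewrite (_ : (fun t => _) = (fun t => complex.Re (F t)) + (fun t => complex.Re (G t))).
    exact: is_deriveD.
  by apply/funext => t; rewrite cReD.
rewrite (_ : (fun t => _) = (fun t => complex.Im (F t)) + (fun t => complex.Im (G t))).
  exact: is_deriveD.
by apply/funext => t; rewrite cImD.
Qed.

Lemma is_cderM F G l k : is_cder F l -> is_cder G k ->
  is_cder (fun t => F t * G t) (l * G 0 + F 0 * k).
Proof.
move=> [F1 F2] [G1 G2]; pose rF t := complex.Re (F t); pose iF t := complex.Im (F t).
pose rG t := complex.Re (G t); pose iG t := complex.Im (G t).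
split.
  rewrite (_ : (fun t => _) = rF * rG - iF * iG); last by apply/funext => t; rewrite cReM.
  apply: is_derive_eq; rewrite cReD !cReM -/(rF 0) -/(iF 0) -/(rG 0) -/(iG 0).
  by rewrite /GRing.scale /=; ring.
rewrite (_ : (fun t => _) = rF * iG + iF * rG); last by apply/funext => t; rewrite cImM.
apply: is_derive_eq; rewrite cImD !cImM -/(rF 0) -/(iF 0) -/(rG 0) -/(iG 0).
by rewrite /GRing.scale /=; ring.
Qed.

Lemma is_cder_monomial c n : is_cder (fun t => (t ^+ n)%:C * c) ((n == 1)%N%:R * c).
Proof.
have dX : is_cder (fun t => (t ^+ n)%:C) (n == 1)%N%:R.
  split; last first.
    rewrite (_ : (fun t => _) = cst 0) //.
    apply: DeriveDef; rewrite ?derive_cst; first exact: derivable_cst.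
    by case: (n == 1)%N.
  have := @is_deriveX _ _ (id : R -> R) n 0 1 1 (is_derive_id _ _).
  rewrite (_ : id ^+ n = (fun t : R => t ^+ n)); last first.
    by apply/funext => t; elim: n => //= n IH; rewrite !exprS -IH.
  move=> H; apply: is_derive_eq H _.
  rewrite /GRing.scale /= mulr1.
  by case: n => [|[|n]]; rewrite ?mul0r //= ?expr0 ?mulr1 // expr0n /= mulr0.
have := is_cderM dX (is_cder_cst c); rewrite mulr0 addr0; exact.
Qed.

Lemma is_cder_sum (I : Type) (r : seq I) (F : I -> R -> R[i]) (l : I -> R[i]) :
  (forall i, is_cder (F i) (l i)) ->
  is_cder (fun t => \sum_(i <- r) F i t) (\sum_(i <- r) l i).
Proof.
move=> dF; elim: r => [|i r IH].
  rewrite big_nil (_ : (fun t => _) = cst 0); first exact: is_cder_cst.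
  by apply/funext => t; rewrite big_nil.
rewrite big_cons (_ : (fun t => _) = (fun t => F i t + \sum_(j <- r) F j t)).
  exact: is_cderD.
by apply/funext => t; rewrite big_cons.
Qed.

End ComplexDerivative.

(** * Roots and root strings *)

Section Roots.
Variables (R : realType) (g : lieAlgebra R[i]) (D : rootDatum g).
Local Notation h := (hh D).
Local Notation h' := (hdual (hh D)).
Implicit Types (a c w : h') (H : subvs_of h) (x y v : g).

(* An inductive wrapper around membership in a root space: unification then
   never tries to compute with the matrices behind vector subspaces. *)
Variant weight_vector a x : Prop :=
  WeightVector of (forall H, br (vsval H) x = a H *: x).

Lemma weight_vectorP a x : weight_vector a x <-> x \in root_space a.
Proof. by split=> [[xa]|/mem_root_space xa]; [apply/mem_root_space|split]. Qed.

Lemma weight_vectorE a x H : weight_vector a x -> br (vsval H) x = a H *: x.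
Proof. by case. Qed.

Lemma weight_vectorD a x y : weight_vector a x -> weight_vector a y ->
  weight_vector a (x + y).
Proof. by move=> [xa] [ya]; split=> H; rewrite brDr xa ya scalerDr. Qed.

Lemma weight_vectorZ a k x : weight_vector a x -> weight_vector a (k *: x).
Proof. by move=> [xa]; split=> H; rewrite brZr xa !scalerA mulrC. Qed.

Lemma weight_vector_br a c x y : weight_vector a x -> weight_vector c y ->
  weight_vector (a + c) (br x y).
Proof.
move=> [xa] [yc]; split => H.
by rewrite br_derivation xa yc brZl brZr -scalerDl add_lfunE.
Qed.

Lemma root_neq0 a : a \in roots D -> a != 0.
Proof. by move=> /rootsP[]. Qed.

Lemma mem_roots a x : a != 0 -> weight_vector a x -> x != 0 -> a \in roots D.
Proof.
move=> a0 /weight_vectorP xa x0; apply/rootsP; split=> // ra0.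
by move: xa; rewrite ra0 memv0 (negPf x0).
Qed.

Lemma weight_vector_eq0 a x : a != 0 -> a \notin roots D -> weight_vector a x -> x = 0.
Proof.
by move=> a0 /negP aD xa; apply/eqP/negPn/negP => x0; apply: aD; exact: mem_roots xa x0.
Qed.

Lemma hdual_sum_base a : a = \sum_i coord (base D) i a *: (base D)`_i.
Proof. exact: coord_basis (base_basis D) (memvf a). Qed.

(** The simple roots form a basis of the dual of h, so the roots separate its points. *)
Lemma roots_sep H : (forall a, a \in roots D -> a H = 0) -> H = 0.
Proof.
move=> H0; have fH (f : h') : f H = 0.
  rewrite (hdual_sum_base f) sum_lfunE big1 // => i _.
  by rewrite scale_lfunE H0 ?scaler0 // base_roots // mem_nth // size_tuple.
rewrite (coord_vbasis (memvf H)) big1 // => i _.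
have := fH (linfun (coord (vbasis {:subvs_of h}) i : subvs_of h -> R[i]^o)).
by rewrite lfunE /= => ->; rewrite scale0r.
Qed.

(** Induction on the list: over an algebraically closed field the leading map has an eigenvector in
    U, and its eigenspace in U is stable under the maps that commute with it. *)
Lemma ad_cartan_eigen (fs : seq 'End(g)) (U : {vspace g}) : U <> 0%VS ->
  (forall f u, f \in fs -> u \in U -> f u \in U) ->
  (forall f1 f2 u, f1 \in fs -> f2 \in fs -> f1 (f2 u) = f2 (f1 u)) ->
  exists2 v, v \in U /\ v != 0 & forall f, f \in fs -> exists z, f v = z *: v.
Proof.
elim: fs U => [|f fs IH] U U0 Ust fsC.
  exists (vpick U) => //; split; first exact: memv_pick.
  by rewrite vpick0; apply/eqP.
pose r := linfun (vsproj U \o f \o vsval) : 'End(subvs_of U).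
pose b := vbasis {:subvs_of U}.
have dim0 : (0 < \dim {:subvs_of U})%N.
  by rewrite dimvf /dim /= lt0n dimv_eq0; apply/eqP.
have [z /eigenvalueP[rv rvz rv0]] := eigenvalue_closed (mxof b b r) dim0.
pose u := vecof b rv.
have ru : r u = z *: u.
  by rewrite /u (@hom_vecof _ _ _ b b) ?vbasisP // rvz linearZ.
have u0 : vsval u != 0.
  apply: contraNneq rv0 => u0; rewrite -(@vecof_eq0 _ _ b) ?vbasisP //.
  by apply/eqP/subvs_inj; rewrite u0 linear0.
have fu : f (vsval u) = z *: vsval u.
  have := congr1 vsval ru; rewrite lfunE /= vsprojK ?linearZ //.
  by rewrite Ust ?mem_head // subvsP.
pose U' := (U :&: lker (f - z *: \1%VF))%VS.
have memU' y : (y \in U') = (y \in U) && (f y == z *: y).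
  by rewrite memv_cap memv_ker add_lfunE opp_lfunE scale_lfunE id_lfunE subr_eq0.
have [|f1 y ffs|f1 f2 y ffs gfs|v [vU v0] vfs] := IH U'.
- move=> /vspaceP /(_ (vsval u)); rewrite memv0 (negPf u0) memU' subvsP fu eqxx //.
- rewrite !memU' => /andP[yU /eqP fy]; rewrite Ust ?inE ?ffs ?orbT //=.
  by rewrite fsC ?inE ?eqxx ?ffs ?orbT // fy linearZ.
- by apply: fsC; rewrite inE ?ffs ?gfs orbT.
move: vU; rewrite memU' => /andP[vU /eqP fv].
exists v => // f1; rewrite inE => /predU1P[->|/vfs //]; by exists z.
Qed.

End Roots.

Section RootVectors.
Variables (R : realType) (g : lieAlgebra R[i]) (D : rootDatum g) (B : rootVectors D).

#[local] Transparent sharp ip.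

(** * The Cartan subalgebra, its Killing form and its weights *)

Section KillingCartan.
Local Notation h := (hh D).
Local Notation h' := (hdual (hh D)).
Implicit Types (a c w : h') (H : subvs_of h) (x y v : g).

Lemma X_weight a : a \in roots D -> weight_vector a (X B a).
Proof. by move=> aD; apply/weight_vectorP; exact: X_root. Qed.

Lemma killing_Hc a H : a \in roots D -> killing (vsval (Hc B a)) (vsval H) = a H.
Proof.
move=> aD; rewrite -(X_opp B aD) brC killingNl killing_br brC killingNr opprK.
rewrite (weight_vectorE _ (X_weight aD)).
by rewrite killingZr killingC (X_killing B aD) mulr1.
Qed.

Lemma killing_nondeg H : (forall H2 : subvs_of h, killing (vsval H) (vsval H2) = 0) -> H = 0.
Proof.
move=> H0; apply: (@roots_sep _ _ D) => a aD.
by rewrite -(killing_Hc _ aD) killingC; exact: H0.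
Qed.

(** The vector that [sharp] selects exists: it is the combination of the [Hc] of the simple roots
    with the coordinates of a. *)
Lemma sharpE a H : killing (vsval (sharp a)) (vsval H) = a H.
Proof.
rewrite /sharp; case: xgetP => [t _ -> //|no]; exfalso.
apply: (no (\sum_i coord (base D) i a *: Hc B (base D)`_i)) => H2.
rewrite [in RHS](hdual_sum_base a) sum_lfunE linear_sum killing_suml.
apply: eq_bigr => i _; rewrite linearZ killingZl scale_lfunE.
by rewrite killing_Hc // base_roots // mem_nth ?size_tuple.
Qed.

Lemma sharp_unique a H : (forall H2, killing (vsval H) (vsval H2) = a H2) -> sharp a = H.
Proof.
move=> Ha; apply/eqP; rewrite -subr_eq0; apply/eqP/killing_nondeg => H2.
by rewrite linearB killingDl killingNl sharpE Ha subrr.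
Qed.

Lemma sharp_root a : a \in roots D -> sharp a = Hc B a.
Proof. by move=> aD; apply: sharp_unique => H; exact: killing_Hc. Qed.

Lemma sharpZ k a : sharp (k *: a) = k *: sharp a.
Proof.
by apply: sharp_unique => H; rewrite linearZ killingZl sharpE scale_lfunE.
Qed.

Lemma ipE a c : ip a c = a (sharp c).
Proof. by rewrite /ip sharpE. Qed.

Lemma ipC a c : ip a c = ip c a.
Proof. by rewrite /ip killingC. Qed.

Lemma ipDl a c w : ip (a + c) w = ip a w + ip c w.
Proof. by rewrite !ipE add_lfunE. Qed.
Lemma ipZl k a w : ip (k *: a) w = k * ip a w.
Proof. by rewrite !ipE scale_lfunE. Qed.
Lemma ipDr a c w : ip w (a + c) = ip w a + ip w c.
Proof. by rewrite !(ipC w) ipDl. Qed.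
Lemma ipZr k a w : ip w (k *: a) = k * ip w a.
Proof. by rewrite !(ipC w) ipZl. Qed.
Lemma ipNl a w : ip (- a) w = - ip a w.
Proof. by rewrite -scaleN1r ipZl mulN1r. Qed.
Lemma ip0l w : ip (0 : h') w = 0.
Proof. by rewrite -(scale0r 0) ipZl mul0r. Qed.

Lemma ip_suml (I : Type) (r : seq I) (P : pred I) (F : I -> h') w :
  ip (\sum_(i <- r | P i) F i) w = \sum_(i <- r | P i) ip (F i) w.
Proof.
by apply: (big_morph (fun x : h' => ip x w)) => [u v|]; rewrite ?ipDl ?ip0l.
Qed.

(** By definition h is only nilpotent. Since H1 and H2 act on each X_a by scalars, [H1, H2] kills
    X_a; it lies in h, so every root vanishes on it. *)
Lemma cartan_br H1 H2 : br (vsval H1) (vsval H2) = 0.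
Proof.
have [sub _ _] := hh_cartan D.
have Hin : br (vsval H1) (vsval H2) \in h.
  by apply: (subvP sub); rewrite mem_brV ?subvsP.
rewrite -(vsprojK Hin) (@roots_sep _ _ D (vsproj h _)) ?linear0 // => a aD.
have [_ ra0] := (rootsP a).1 aD.
have [Xa] := X_weight aD.
have X0 : X B a != 0.
  by apply: contraTneq (oner_neq0 R[i]) => X0; rewrite -(X_killing B aD) X0 killing0l eqxx.
have := Xa (vsproj h (br (vsval H1) (vsval H2))).
rewrite vsprojK //.
have E := br_derivation (vsval H1) (vsval H2) (X B a).
rewrite !Xa !brZr !Xa !scalerA in E.
have -> : br (br (vsval H1) (vsval H2)) (X B a) = 0.
  by apply: (addIr ((a H1 * a H2) *: X B a)); rewrite -E add0r [a H1 * _]mulrC.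
by move/esym/eqP; rewrite scaler_eq0 (negPf X0) orbF => /eqP.
Qed.

(** A vector of weight 0 brackets h to 0, so it normalizes h and lies in it. *)
Lemma weight_vector_cartan x : weight_vector (0 : h') x <-> x \in h.
Proof.
split=> [[x0]|xh]; last split=> H.
  have [_ _ norm] := hh_cartan D; apply: norm => y yh.
  have := x0 (vsproj h y); rewrite vsprojK // => E.
  by rewrite brC E zero_lfunE scale0r oppr0 mem0v.
by rewrite -(vsprojK xh) cartan_br zero_lfunE scale0r.
Qed.

(* Induct on the number of weights: applying ad H - c(H) kills the component
   of weight c. *)
Lemma weight_vector_indep (s : seq h') (F : h' -> g) : uniq s ->
  (forall a, a \in s -> weight_vector a (F a)) -> \sum_(a <- s) F a = 0 ->
  forall a, a \in s -> F a = 0.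
Proof.
elim: s F => [|c s IH] F //= /andP[cs us] Fs; rewrite big_cons => sum0.
have Fa0 a : a \in s -> F a = 0.
  move=> sa; have ac : a - c != 0 by rewrite subr_eq0; apply: contraNneq cs => <-.
  have /lfunPn [H] := ac; rewrite zero_lfunE => Hac.
  have : (a H - c H) *: F a = 0.
    apply: (IH (fun a => (a H - c H) *: F a)) => // [a' sa'|].
      by apply: weight_vectorZ; apply: Fs; rewrite inE sa' orbT.
    have := congr1 (br (vsval H)) sum0; rewrite br0r brDr br_sumr.
    rewrite (weight_vectorE H (Fs c (mem_head _ _))).
    have := congr1 (fun u => c H *: u) sum0; rewrite scaler0 scalerDr scaler_sumr.
    move=> E1 E2; apply: etrans (_ : _ = 0 - 0) _; last by rewrite subrr.
    rewrite -[X in X - _]E2 -[X in _ - X]E1 opprD addrACA subrr add0r.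
    rewrite -sumrB; apply: eq_big_seq => a' sa'.
    have := Fs a'; rewrite inE sa' orbT => /(_ isT) Fa'.
    by rewrite scalerBl (weight_vectorE H Fa').
  by move: Hac; rewrite add_lfunE opp_lfunE => Hac /eqP;
    rewrite scaler_eq0 (negPf Hac) => /eqP.
move=> a; rewrite inE => /predU1P[->|/Fa0 //].
by move: sum0; rewrite big_seq big1 ?addr0.
Qed.

Lemma killing_root a c x y : weight_vector a x -> weight_vector c y ->
  a + c != 0 -> killing x y = 0.
Proof.
move=> [xa] [yc]; apply: contraNeq => k0.
apply/eqP/lfunP => H; rewrite zero_lfunE add_lfunE; apply: (mulIf k0).
rewrite mul0r mulrDl -killingZl -xa -killingZr -yc brC killingNl killing_br.
by rewrite addNr.
Qed.

(** This takes the place of the root space decomposition: the eigenspace of ad H is stable under the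
    commuting family ad h and so contains a common eigenvector, whose weight is 0 or a root. *)
Lemma cartan_eigenvalue H v z : v != 0 -> br (vsval H) v = z *: v ->
  exists c, [/\ c = 0 \/ c \in roots D, z = c H & exists2 u, weight_vector c u & u != 0].
Proof.
move=> v0 Hv.
pose U := lker (ad (vsval H) - z *: \1%VF).
have memU y : (y \in U) = (br (vsval H) y == z *: y).
  by rewrite memv_ker add_lfunE opp_lfunE scale_lfunE id_lfunE subr_eq0 adE.
pose fs := [seq ad (vsval H2) | H2 <- vbasis {:subvs_of h}].
have adC H1 H2 y : br (vsval H1) (br (vsval H2) y) = br (vsval H2) (br (vsval H1) y).
  by rewrite br_derivation cartan_br br0l add0r.
have [|||u [uU u0] ufs] := @ad_cartan_eigen _ g fs U.
- by move=> U0; move: v0; rewrite -memv0 -U0 memU Hv eqxx.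
- move=> _ u /mapP[H2 _ ->]; rewrite !memU !adE => /eqP Hu.
  by rewrite adC Hu brZr.
- by move=> _ _ u /mapP[H2 _ ->] /mapP[H3 _ ->]; rewrite !adE adC.
have eig H2 : exists k, br (vsval H2) u = k *: u.
  rewrite (coord_vbasis (memvf H2)) linear_sum.
  elim/big_ind: _ => [|y1 y2 [k1 E1] [k2 E2]|i _].
  - by exists 0; rewrite br0l scale0r.
  - by exists (k1 + k2); rewrite brDl E1 E2 scalerDl.
  have ifs : ad (vsval (vbasis {:subvs_of h})`_i) \in fs.
    by apply/mapP; exists (vbasis {:subvs_of h})`_i; rewrite // mem_nth ?size_tuple.
  have [k E] := ufs _ ifs.
  by exists (coord (vbasis {:subvs_of h}) i H2 * k); rewrite linearZ brZl -adE E scalerA.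
(* As u is nonzero, the eigenvalue of H2 on u is unique; the chosen value is therefore linear in H2
   and is the weight of u. *)
pose cf (H2 : subvs_of h) : R[i]^o := xget 0 [set k | br (vsval H2) u = k *: u]%classic.
have cfP H2 : br (vsval H2) u = cf H2 *: u.
  by rewrite /cf; case: xgetP => [k _ ->//|no]; have [k /no] := eig H2.
have cf_uniq H2 k : br (vsval H2) u = k *: u -> cf H2 = k.
  rewrite cfP => /eqP; rewrite -subr_eq0 -scalerBl scaler_eq0 (negPf u0) orbF.
  by rewrite subr_eq0 => /eqP.
have cf_lin : linear cf.
  move=> k H1 H2; apply: cf_uniq.
  by rewrite linearP br_linear_l !cfP scalerA -scalerDl.
pose cl := HB.pack cf (GRing.isLinear.Build _ _ _ _ cf cf_lin) : {linear subvs_of h -> R[i]^o}.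
pose c : h' := linfun cl.
have cE H2 : c H2 = cf H2 by rewrite /c lfunE.
have uc : weight_vector c u by split=> H2; rewrite cE cfP.
exists c; split.
- by have [->|c0] := eqVneq c 0; [left|right; exact: mem_roots c0 uc u0].
- by rewrite cE; apply/esym/cf_uniq; move: uU; rewrite memU => /eqP.
by exists u.
Qed.

End KillingCartan.

#[local] Opaque sharp ip.

Lemma mulrn_inj (K : numFieldType) (V : lmodType K) (v : V) :
  v != 0 -> injective (fun j => v *+ j).
Proof.
move=> v0 i j /eqP; rewrite -[v *+ i]scaler_nat -[v *+ j]scaler_nat -subr_eq0 -scalerBl scaler_eq0.
by rewrite (negPf v0) orbF subr_eq0 eqr_nat => /eqP.
Qed.

(** * Strings of weights through sl2 *)

Section RootStrings.
Local Notation h := (hh D).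
Local Notation h' := (hdual (hh D)).
Implicit Types (a c w : h') (H : subvs_of h) (x y v : g).

Lemma hdual_mulrnE a n H : (a *+ n) H = n%:R * (a H : R[i]).
Proof.
elim: n => [|n IH]; first by rewrite mulr0n zero_lfunE mul0r.
by rewrite mulrS add_lfunE IH -natr1 mulrDl mul1r addrC.
Qed.

(** On a line H2 + t H1 each a in s is a nonzero polynomial in t; the product of these polynomials
    is nonzero at some natural number. *)
Lemma generic_point (s : seq h') : (forall a, a \in s -> a != 0) ->
  exists H, forall a, a \in s -> a H != 0.
Proof.
elim: s => [|b s IH] s0; first by exists 0.
have [|H1 sH1] := IH; first by move=> a sa; apply: s0; rewrite inE sa orbT.
have /lfunPn[H2] := s0 b (mem_head _ _); rewrite zero_lfunE => bH2.
pose p := \prod_(a <- b :: s) ((a H2 : R[i])%:P + (a H1 : R[i]) *: 'X).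
have p0 : p != 0.
  rewrite prodf_seq_neq0; apply/allP => a sa /=.
  have : (a H2 != 0) || (a H1 != 0).
    by move: sa; rewrite inE => /predU1P[->|/sH1 ->]; rewrite ?bH2 ?orbT.
  apply: contraTneq => p0; have := congr1 (fun q => q.[1]) p0.
  have := congr1 (fun q => q.[0]) p0.
  rewrite /= !hornerD !hornerZ !hornerC !hornerX ?horner0 mulr0 addr0 mulr1 => ->.
  by rewrite add0r => ->; rewrite eqxx.
have [n pn] : exists n : nat, ~~ root p n%:R.
  apply: contraPP (@max_poly_roots _ p [seq n%:R | n <- iota 0 (size p)] p0) => no.
  rewrite size_map size_iota ltnn => /(_ _ _)/notF; apply.
    apply/allP => _ /mapP[n _ ->]; apply: contra_notT no => pn; by exists n.
  by rewrite map_inj_uniq ?iota_uniq //; apply: mulrIn; rewrite oner_eq0.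
exists (H2 + n%:R *: H1) => a sa; apply: contra pn => /eqP aH.
rewrite /root horner_prod prodf_seq_eq0; apply/hasP; exists a => //=.
by rewrite hornerD hornerC hornerZ hornerX mulrC -aH linearD linearZ.
Qed.

(** If - a were not a root, a generic H would make f = ad H + a(H) invertible, because - a(H) would
    differ from all values c(H) with c = 0 or c a root. But the Killing form vanishes between X_a
    and the image of f, while [X B (- a)], defined for any argument, pairs to 1 with X_a. *)
Lemma opp_root a : a \in roots D -> - a \in roots D.
Proof.
move=> aD; apply: contraT => naD.
have [|H Hs] := @generic_point [seq c + a | c <- 0 :: roots D].
  move=> _ /mapP[c + ->]; rewrite inE => /predU1P[->|cD].
    by rewrite add0r (root_neq0 aD).
  by apply: contraNneq naD => /eqP; rewrite addr_eq0 => /eqP <-.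
pose f := ad (vsval H) + a H *: \1%VF.
have f0 : lker f == 0%VS.
  rewrite -subv0; apply/subvP => v; rewrite memv_ker memv0; apply: contraLR => v0.
  apply/negP; rewrite add_lfunE scale_lfunE id_lfunE adE addr_eq0 -scaleNr => /eqP Hv.
  have [c [cD cH _]] := cartan_eigenvalue v0 Hv.
  have : (c + a) H != 0.
    by apply: Hs; apply/mapP; exists c; rewrite // inE; case: cD => ->; rewrite ?eqxx ?orbT.
  by rewrite add_lfunE -cH addNr eqxx.
have Xf := lker0_lfunVK f0 (X B (- a)).
have := X_killing B aD; rewrite -Xf add_lfunE scale_lfunE id_lfunE adE.
rewrite killingDr killingZr -killing_br brC killingNl.
rewrite (weight_vectorE _ (X_weight aD)).
by rewrite killingZl addNr => /esym/eqP; rewrite oner_eq0.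
Qed.

Lemma XN_weight a : a \in roots D -> weight_vector (- a) (X B (- a)).
Proof. by move=> aD; apply: X_weight; exact: opp_root. Qed.

Lemma string_finite w a : a != 0 -> exists j, w + a *+ j \notin 0 :: roots D.
Proof.
move=> a0; apply: contrapT => no.
have inj : injective (fun j => w + a *+ j).
  by move=> i j /addrI; exact: mulrn_inj a0 i j.
have := @uniq_leq_size _ [seq w + a *+ j | j <- iota 0 (size (roots D)).+2] (0 :: roots D).
rewrite (map_inj_uniq inj) iota_uniq size_map size_iota
  [size (0 :: _)]/= ltnn => /(_ isT) sub.
suff: false by []; apply: sub.
by move=> _ /mapP[j _ ->]; apply: contra_notT no => ?; exists j.
Qed.

Lemma iter_weight a w x y j : weight_vector w x -> weight_vector a y ->
  weight_vector (w + a *+ j) (iter j (br y) x).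
Proof.
move=> xw ya; elim: j => [|j IH]; first by rewrite /= mulr0n addr0.
by rewrite iterS mulrS addrCA; exact: weight_vector_br ya IH.
Qed.

Lemma weight_nz w x : weight_vector w x -> x != 0 -> w \in 0 :: roots D.
Proof.
by move=> xw x0; rewrite inE; have [//|w0] := eqVneq w 0; exact: mem_roots xw x0.
Qed.

Lemma top_exists a w x y : a != 0 -> weight_vector w x -> x != 0 ->
  weight_vector a y ->
  exists q, iter q (br y) x != 0 /\ iter q.+1 (br y) x = 0.
Proof.
move=> a0 xw x0 ya.
have ex : exists j, iter j (br y) x == 0.
  have [j wj] := string_finite w a0; exists j; apply: contraNT wj => yj.
  by apply: weight_nz yj; exact: iter_weight.
case: (ex_minnP ex) => -[|q] /eqP q0 qmin; first by case/negP: x0; apply/eqP; exact: q0.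
by exists q; split=> //; apply/negP => /qmin; rewrite ltnn.
Qed.

(** With y_j the jth descendant of x, ad X_a sends y_(j+1) to (j+1)(w(H_a) - j a(H_a)/2) y_j. At the
    last nonzero y_m the factor must vanish. *)
Lemma sl2_string a w x : a \in roots D -> weight_vector w x -> x != 0 ->
  br (X B a) x = 0 ->
  exists m, [/\ 2 * w (Hc B a) = m%:R * a (Hc B a),
    forall j, (j <= m)%N -> iter j (br (X B (- a))) x != 0
    & iter m.+1 (br (X B (- a))) x = 0].
Proof.
move=> aD xw x0 Xx.
pose y j := iter j (br (X B (- a))) x.
have yw j : weight_vector (w - a *+ j) (y j).
  by rewrite -mulNrn; exact: iter_weight xw (XN_weight aD).
have Xy j : br (X B a) (y j.+1) = (j.+1%:R * (w (Hc B a) - j%:R / 2 * a (Hc B a))) *: y j.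
  elim: j => [|j IH]; rewrite [y _.+1]iterS -/(y _) br_derivation (X_opp B aD).
    by rewrite (weight_vectorE _ (yw 0)) Xx br0r addr0 subr0 !mul0r subr0 mul1r.
  rewrite (weight_vectorE _ (yw j.+1)) IH brZr -iterS -/(y _) -scalerDl; congr (_ *: _).
  rewrite add_lfunE opp_lfunE hdual_mulrnE.
  by rewrite -[j.+2]addn1 -[j.+1]addn1 !natrD; field.
have aN0 : - a != 0 by rewrite oppr_eq0 root_neq0.
have [m [m1 m2]] := top_exists aN0 xw x0 (XN_weight aD).
exists m; split=> // [|j jm].
- have := Xy m; rewrite [y _]m2 br0r => /esym/eqP.
  rewrite scaler_eq0 (negPf m1) orbF mulf_eq0 pnatr_eq0 /= subr_eq0 => /eqP ->.
  by field.
apply: contraNneq m1 => yj; rewrite -(subnK jm) iterD yj.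
by elim: (m - j)%N => //= k /eqP ->; rewrite br0r.
Qed.

(** Raising q times by X_a reaches the top of the string, from which [sl2_string] descends; the
    index j therefore counts down from the top. *)
Lemma root_string a w x : a \in roots D -> weight_vector w x -> x != 0 ->
  exists q m, [/\ 2 * w (Hc B a) = (m%:R - 2 * q%:R) * a (Hc B a),
    forall j, (j <= m)%N -> w + a *+ q - a *+ j \in 0 :: roots D
    & br (X B a) x = 0 -> q = 0%N].
Proof.
move=> aD xw x0; have Xa := X_weight aD.
have [q [q1 q2]] := top_exists (root_neq0 aD) xw x0 Xa.
have qw := iter_weight q xw Xa.
have [m [m1 m2 _]] := sl2_string aD qw q1 q2.
exists q, m; split=> [|j jm|Xx].
- move: m1; rewrite add_lfunE hdual_mulrnE mulrDr => /(canRL (addrK _)) ->.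
  by ring.
- apply: weight_nz (m2 j jm); rewrite -mulNrn; exact: iter_weight qw (XN_weight aD).
case: q q1 {q2 qw m1 m2} => // q; rewrite iterSr Xx.
suff -> : iter q (br (X B a)) 0 = 0 by rewrite eqxx.
by elim: q => //= q ->; rewrite br0r.
Qed.

Lemma X_neq0 a : a \in roots D -> X B a != 0.
Proof.
move=> aD.
by apply: contraTneq (oner_neq0 R[i]) => X0; rewrite -(X_killing B aD) X0 killing0l eqxx.
Qed.

(** If a(H_a) = 0, the string formula gives c(H_a) = 0 for every root c, so H_a = 0 and a = 0. *)
Lemma Hc_neq0 a : a \in roots D -> a (Hc B a) != 0.
Proof.
move=> aD; apply: contraNneq (root_neq0 aD) => aH0.
suff H0 : Hc B a = 0.
  by apply/eqP/lfunP => H; rewrite -killing_Hc // H0 linear0 killing0l zero_lfunE.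
apply: (@roots_sep _ _ D) => c cD.
have [q [m [+ _ _]]] := root_string aD (X_weight cD) (X_neq0 cD).
by rewrite aH0 mulr0 => /eqP; rewrite mulf_eq0 pnatr_eq0 /= => /eqP.
Qed.

(** Let y be x minus the stated multiple of X_a. Then [X_(-a), y] lies in h and is orthogonal to h,
    so it is 0, and y heads a string for the root - a. The length m of this string would have to be
    -2 unless y = 0. *)
Lemma root_space_line a x : a \in roots D -> weight_vector a x ->
  x = killing x (X B (- a)) *: X B a.
Proof.
move=> aD xa; have naD := opp_root aD.
pose y := x - killing x (X B (- a)) *: X B a.
have ya : weight_vector a y.
  by rewrite /y -scaleNr; apply: weight_vectorD xa (weight_vectorZ _ (X_weight aD)).
have ky : killing y (X B (- a)) = 0.
  by rewrite killingDl killingNl killingZl X_killing // mulr1 subrr.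
have Xy : br (X B (- a)) y = 0.
  have := weight_vector_br (X_weight naD) ya; rewrite addNr => /weight_vector_cartan Hin.
  rewrite -(vsprojK Hin).
  suff -> : vsproj h (br (X B (- a)) y) = 0 by rewrite linear0.
  apply: killing_nondeg => H.
  rewrite vsprojK // killing_br brC killingNr.
  by rewrite (weight_vectorE _ ya) killingZr killingC ky mulr0 oppr0.
apply/eqP; rewrite -subr_eq0 -/y; apply: contraT => y0.
have [m [+ _ _]] := sl2_string naD ya y0 Xy.
rewrite -sharp_root // -scaleN1r sharpZ sharp_root // !scaleN1r opp_lfunE.
rewrite !linearN opprK => /eqP.
rewrite mulrN eq_sym -addr_eq0 -mulrDl mulf_eq0 (negPf (Hc_neq0 aD)) orbF.
by rewrite -natrD pnatr_eq0 addn_eq0 andbF.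
Qed.

End RootStrings.

Lemma mxtrace_eigenvalues (C : closedFieldType) n (M : 'M[C]_n) :
  exists r : seq C, \tr M = \sum_(z <- r) z /\ forall z, (z \in r) = eigenvalue M z.
Proof.
have [r Mr] := closed_field_poly_normal (char_poly M).
move: Mr; rewrite (monicP (char_poly_monic M)) scale1r => Mr.
have sz : size r = n.
  by apply/eqP; rewrite -eqSS -(size_char_poly M) Mr size_prod_XsubC.
exists r; split=> [|z]; last by rewrite eigenvalue_root_char Mr root_prod_XsubC.
have [n0|n_gt0] := posnP n.
  rewrite /mxtrace big1 => [|i]; last by have := ltn_ord i; rewrite {2}n0.
  by move: sz; rewrite n0 => /size0nil ->; rewrite big_nil.
apply: oppr_inj; rewrite -(char_poly_trace M n_gt0) Mr -sz.
by rewrite coefPn_prod_XsubC // sz -lt0n.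
Qed.

(** * Positivity of the form on real weights *)

Section PositiveForm.
Local Notation h := (hh D).
Local Notation h' := (hdual (hh D)).
Implicit Types (a c w : h') (H : subvs_of h) (x y v : g).

#[local] Transparent killing.
(** The Killing form at H is the trace of (ad H)^2. If w^2 is an eigenvalue of (ad H)^2, then w or
    -w is one of ad H, hence a value of a root or 0. The trace is thus a sum of squares. *)
Lemma killing_eigenvalues H : exists r : seq R[i],
  [/\ killing (vsval H) (vsval H) = \sum_(z <- r) z,
   forall z, z \in r -> exists c, (c = 0 \/ c \in roots D) /\ z = (c H : R[i]) ^+ 2
   & forall c, c \in roots D -> (c H : R[i]) ^+ 2 \in r].
Proof.
pose b := vbasis {:g}.
pose M := mxof b b (ad (vsval H) \o ad (vsval H))%VF.
have [r [trM rM]] := mxtrace_eigenvalues M.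
have eigM z v : v != 0 -> br (vsval H) (br (vsval H) v) = z *: v -> z \in r.
  move=> v0 Hv; rewrite rM; apply/eigenvalueP; exists (rVof b v); last first.
    by rewrite (@rVof_eq0 _ _ b) ?vbasisP.
  by rewrite -(@rVof_app _ _ _ b b) ?vbasisP // comp_lfunE !adE Hv linearZ.
exists r; split=> [|z|c cD].
- by rewrite -trM; exact: ltraceE.
- rewrite rM => /eigenvalueP[rv rvz rv0].
  pose v := vecof b rv.
  have v0 : v != 0 by rewrite (@vecof_eq0 _ _ b) ?vbasisP.
  have Hv : br (vsval H) (br (vsval H) v) = z *: v.
    rewrite -!adE -comp_lfunE /v (@hom_vecof _ _ _ b b) ?vbasisP //.
    by rewrite rvz linearZ.
  pose w := sqrtC z; have zw : z = w ^+ 2 by rewrite sqrtCK.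
  have [u0|u0] := eqVneq (br (vsval H) v - w *: v) 0.
    move/eqP: u0; rewrite subr_eq0 => /eqP u0.
    have [c [cD wc _]] := cartan_eigenvalue v0 u0.
    by exists c; rewrite zw wc.
  have [|c [cD wc _]] := @cartan_eigenvalue H _ (- w) u0; last first.
    by exists c; rewrite zw -sqrrN wc.
  by rewrite brDr brNr brZr Hv zw scalerBr !scaleNr opprK scalerA -expr2 addrC.
apply: (eigM _ (X B c)); first exact: X_neq0.
by rewrite !(brZr, weight_vectorE H (X_weight cD)) scalerA expr2.
Qed.
#[local] Opaque killing.

Lemma cartan_integer a c : a \in roots D -> c \in roots D ->
  exists n : int, 2 * ip c a = n%:~R * ip a a.
Proof.
move=> aD cD.
have [q [m [E _ _]]] := root_string aD (X_weight cD) (X_neq0 cD).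
exists (m%:Z - 2 * q%:Z); rewrite !ipE sharp_root // E; congr (_ * _).
by rewrite rmorphB rmorphM /= -!pmulrn.
Qed.

(** At [sharp a] the squares are (n/2)^2 |a|^4 with n an integer, so |a|^2 = S |a|^4 with S >= 0,
    and |a|^2 = 1/S. *)
Lemma ip_root_gt0 a : a \in roots D -> 0 < ip a a.
Proof.
move=> aD; have a0 : ip a a != 0 by rewrite ipE sharp_root // Hc_neq0.
have [r [kr rc _]] := killing_eigenvalues (sharp a).
have [S S0 rS] : exists2 S : R[i], 0 <= S & \sum_(z <- r) z = S * ip a a ^+ 2.
  elim: r rc {kr} => [|z r IH] rc; first by exists 0; rewrite ?big_nil ?mul0r.
  have [|S S0 rS] := IH; first by move=> y yr; apply: rc; rewrite inE yr orbT.
  have [c [cD zc]] := rc z (mem_head _ _).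
  have [n En] : exists n : int, 2 * ip c a = n%:~R * ip a a.
    case: cD => [->|/(cartan_integer aD)//].
    by exists 0; rewrite ip0l mul0r mulr0.
  exists ((n%:~R / 2) ^+ 2 + S).
    by rewrite addr_ge0 // real_exprn_even_ge0 // rpredM ?rpredV ?realz ?realn.
  rewrite big_cons rS mulrDl; congr (_ + _).
  rewrite zc -ipE -exprMn mulrAC -En; congr (_ ^+ _).
  by field.
move: kr; rewrite sharpE -ipE rS => E.
have Sa : S * ip a a = 1.
  by apply: (mulIf a0); rewrite mul1r -mulrA -expr2 -E.
have -> : ip a a = S^-1.
  have S0' : S != 0 by apply: contra_eq_neq Sa => ->; rewrite mul0r eq_sym oner_neq0.
  by apply: (mulfI S0'); rewrite Sa divff.
rewrite lt_def invr_ge0 S0 andbT invr_eq0.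
by apply: contra_eq_neq Sa => ->; rewrite mul0r eq_sym oner_neq0.
Qed.

Lemma ip_root_real a c : a \in roots D -> c \in roots D -> ip a c \is Num.real.
Proof.
move=> aD cD; have [n E] := cartan_integer cD aD.
have -> : ip a c = n%:~R * ip c c / 2 by rewrite -E; field.
by rewrite rpredM ?rpredV ?realn // rpredM ?realz // gtr0_real // ip_root_gt0.
Qed.

(* The weights on which the form is real; by [ip_gt0] it is positive
   definite there. *)
Definition real_weight w := forall c, c \in roots D -> ip w c \is Num.real.

Lemma real_weight_root a : a \in roots D -> real_weight a.
Proof. by move=> aD c; exact: ip_root_real. Qed.

Lemma real_weightD a w : real_weight a -> real_weight w -> real_weight (a + w).
Proof. by move=> ra rw c cD; rewrite ipDl rpredD ?ra ?rw. Qed.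

Lemma real_weightZ k w : k \is Num.real -> real_weight w -> real_weight (k *: w).
Proof. by move=> rk rw c cD; rewrite ipZl rpredM ?rw. Qed.

Lemma real_weightN w : real_weight w -> real_weight (- w).
Proof. by move=> rw c cD; rewrite ipNl rpredN ?rw. Qed.

(** |w|^2 is a sum of squares of real numbers, among them the values of all roots at [sharp w]; if
    it is 0, these all vanish. *)
Lemma ip_ge0 w : real_weight w -> 0 <= ip w w /\ (ip w w = 0 -> w = 0).
Proof.
move=> rw; have [r [kr rc cr]] := killing_eigenvalues (sharp w).
have r0 z : z \in r -> 0 <= z.
  move=> /rc[c [cD ->]]; rewrite real_exprn_even_ge0 // -ipE ipC.
  by case: cD => [->|/rw //]; rewrite ipC ip0l.
move: kr; rewrite sharpE -ipE => kr; split=> [|w0].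
  by rewrite kr big_seq sumr_ge0.
apply/lfunP => H; rewrite -sharpE zero_lfunE.
suff -> : sharp w = 0 by rewrite linear0 killing0l.
apply: (@roots_sep _ _ D) => c /cr cwr.
move/esym: kr; rewrite w0 big_seq => /eqP; rewrite psumr_eq0 // => /allP/(_ _ cwr).
by rewrite cwr /= sqrf_eq0 => /eqP.
Qed.

Lemma ip_gt0 w : real_weight w -> w != 0 -> 0 < ip w w.
Proof.
move=> rw w0; have [ge0 eq0] := ip_ge0 rw; rewrite lt_def ge0 andbT.
by apply: contraNneq w0 => /eq0 ->.
Qed.

End PositiveForm.

(** * Lengths, sums and reflections of roots *)

Section RootCombinatorics.
Local Notation h := (hh D).
Local Notation h' := (hdual (hh D)).
Implicit Types (a c w : h') (H : subvs_of h) (x y v : g).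

(** On roots this is the form itself; taking the real part moves inequalities into the ordered field
    R. *)
Definition rip a c : R := complex.Re (ip a c).

Lemma ripC a c : rip a c = rip c a. Proof. by rewrite /rip ipC. Qed.
Lemma ripDl a c w : rip (a + c) w = rip a w + rip c w.
Proof. by rewrite /rip ipDl raddfD. Qed.
Lemma ripDr a c w : rip w (a + c) = rip w a + rip w c.
Proof. by rewrite !(ripC w) ripDl. Qed.
Lemma ripNl a w : rip (- a) w = - rip a w.
Proof. by rewrite /rip ipNl raddfN. Qed.
Lemma ripNr a w : rip w (- a) = - rip w a.
Proof. by rewrite !(ripC w) ripNl. Qed.
Lemma ripMnl a w n : rip (a *+ n) w = n%:R * rip a w.
Proof.
elim: n => [|n IH]; first by rewrite mulr0n /rip ip0l mul0r.
by rewrite mulrS ripDl IH -natr1 mulrDl mul1r addrC.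
Qed.
Lemma ripMnr a w n : rip w (a *+ n) = n%:R * rip w a.
Proof. by rewrite !(ripC w) ripMnl. Qed.
Lemma rip0l w : rip (0 : h') w = 0.
Proof. by rewrite /rip ip0l. Qed.

Lemma rip_line a c n :
  rip (a + c *+ n) (a + c *+ n) = rip a a + 2 * n%:R * rip a c + n%:R ^+ 2 * rip c c.
Proof. by rewrite ripDl !ripDr !ripMnl !ripMnr (ripC c a); ring. Qed.

Lemma rip_sq a c : rip (a + c) (a + c) = rip a a + 2 * rip a c + rip c c.
Proof. by rewrite ripDl !ripDr (ripC c a); ring. Qed.

Lemma ripE a c : a \in roots D -> c \in roots D -> ip a c = (rip a c)%:C.
Proof. by move=> aD cD; rewrite /rip RRe_real // ip_root_real. Qed.

Lemma rip_gt0 a : a \in roots D -> 0 < rip a a.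
Proof. by move=> aD; have := ip_root_gt0 aD; rewrite ripE // ltcR. Qed.

Lemma rip_wt_gt0 w : real_weight w -> w != 0 -> 0 < rip w w.
Proof.
move=> rw w0; have := ip_gt0 rw w0.
by rewrite -[ip w w]RRe_real ?gtr0_real ?ip_gt0 // ltcR.
Qed.

Lemma rip_int a c : a \in roots D -> c \in roots D ->
  exists n : int, 2 * rip c a = n%:~R * rip a a.
Proof.
move=> aD cD; have [n En] := cartan_integer aD cD; exists n.
apply: complexI; rewrite !rmorphM /= rmorph_int -!ripE // -En.
by rewrite rmorph_nat.
Qed.

Lemma root_bound a c (L : R) : a \in roots D -> c \in roots D -> a != c ->
  rip a a <= L -> rip c c <= L -> 2 * rip a c <= L.
Proof.
wlog le_ac : a c / rip a a <= rip c c.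
  move=> W aD cD ac aL cL; have [le|/ltW le] := leP (rip a a) (rip c c).
    exact: W.
  by rewrite ripC; apply: W => //; rewrite eq_sym.
move=> aD cD ac aL cL.
have [n En] := rip_int cD aD; rewrite En.
have c0 := rip_gt0 cD.
have [n2|n1] := lerP 2 n; last first.
  have n1' : (n%:~R : R) <= 1 by rewrite -[1]/(1%:~R) ler_int; lia.
  by nra.
have n2' : (2 : R) <= n%:~R by rewrite -[2]/(2%:~R) ler_int.
have rac : real_weight (a - c).
  apply: (real_weightD (real_weight_root aD)).
  exact: real_weightN (real_weight_root cD).
have := rip_wt_gt0 rac; rewrite subr_eq0 ac => /(_ isT).
rewrite !ripDl !ripDr !ripNl !ripNr (ripC c a) => pos.
by nra.
Qed.

Lemma rip_string a c : a \in roots D -> c \in roots D ->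
  exists q m, [/\ 2 * rip c a = (m%:R - 2 * q%:R) * rip a a,
    forall j, (j <= m)%N -> c + a *+ q - a *+ j \in 0 :: roots D
    & br (X B a) (X B c) = 0 -> q = 0%N].
Proof.
move=> aD cD.
have [q [m [E str q0]]] := root_string aD (X_weight cD) (X_neq0 cD).
exists q, m; split=> //; apply: complexI; rewrite !rmorphM rmorphB rmorphM /= -!ripE //.
by rewrite !rmorph_nat !ipE sharp_root.
Qed.

(** Otherwise X_a kills X_c, so c is the top of its a-string and 2<c, a> is a nonnegative multiple
    of |a|^2. *)
Lemma add_root a c : a \in roots D -> c \in roots D -> rip c a < 0 ->
  c + a \in 0 :: roots D.
Proof.
move=> aD cD ca; apply: contraT => Nca; have a0 := rip_gt0 aD.
have Xca : br (X B a) (X B c) = 0.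
  apply/eqP; apply: contraNT Nca => X0; rewrite addrC.
  exact: weight_nz (weight_vector_br (X_weight aD) (X_weight cD)) X0.
have [q [m [E _ /(_ Xca) q0]]] := rip_string aD cD.
have : 0 <= 2 * rip c a by rewrite E q0 mulr0 subr0 mulr_ge0 // ltW.
by rewrite pmulr_rge0 // leNgt ca.
Qed.

Lemma sub_root a c : a \in roots D -> c \in roots D -> 0 < rip c a ->
  c - a \in 0 :: roots D.
Proof.
move=> aD cD ca; apply: add_root => //; first exact: opp_root.
by rewrite ripNr oppr_lt0.
Qed.

(** The reflection of c in a lies on the a-string of c, and it is not 0 because it is as long as
    c. *)
Lemma reflect_root a c n : a \in roots D -> c \in roots D ->
  2 * rip c a = n%:R * rip a a -> c - a *+ n \in roots D.
Proof.
move=> aD cD En; have a0 := rip_gt0 aD; have c0 := rip_gt0 cD.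
have [q [m [E str _]]] := rip_string aD cD.
have qm : (n + 2 * q = m)%N.
  apply/eqP; rewrite -(eqr_nat R) natrD natrM; apply/eqP.
  apply: (mulIf (lt0r_neq0 a0)); rewrite mulrDl -En E.
  by rewrite -mulrDl; congr (_ * _); ring.
have := str (n + q)%N; rewrite mulrnDr opprD addrACA subrr addr0 => /(_ _).
have -> : (n + q <= m)%N by lia.
move=> /(_ isT); rewrite inE => /predU1P[r0|//].
have : rip (c - a *+ n) (c - a *+ n) = rip c c.
  rewrite !ripDl !ripDr !ripNl !ripNr !ripMnl !ripMnr (ripC a c).
  by apply/eqP; rewrite -subr_eq0; apply/eqP; move: En; nra.
by rewrite r0 rip0l => c00; move: c0; rewrite -c00 ltxx.
Qed.

(** An a-string whose top is orthogonal to a has length 0. *)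
Lemma br_opp_orth a c : a \in roots D -> c \in roots D -> rip c a = 0 ->
  br (X B a) (X B c) = 0 -> br (X B (- a)) (X B c) = 0.
Proof.
move=> aD cD ca Xca; have a0 := rip_gt0 aD.
have [m [E _ top]] := sl2_string aD (X_weight cD) (X_neq0 cD) Xca.
suff m0 : m = 0%N by move: top; rewrite m0.
have : 2 * ip c a = m%:R * ip a a by rewrite !ipE sharp_root.
rewrite !ripE // ca rmorph0 mulr0 => /esym/eqP; rewrite mulf_eq0 pnatr_eq0.
case/orP=> [/eqP //|/eqP/complexI a00].
by move: a0; rewrite a00 ltxx.
Qed.

Lemma largest_string a c : a != 0 -> c \in roots D ->
  exists p, largest (fun j => c + a *+ j \in roots D) p.
Proof.
move=> a0 cD.
pose f r := xget 0%N [set j | r = c + a *+ j]%classic.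
have fE j : f (c + a *+ j) = j.
  rewrite /f; case: xgetP => [k _ /addrI E|no]; first exact/esym/(mulrn_inj a0).
  by have := no j erefl.
pose P j := c + a *+ j \in roots D.
have exP : exists j, P j by exists 0%N; rewrite /P mulr0n addr0.
have maxP j : P j -> (j <= \max_(r <- roots D) f r)%N.
  by move=> Pj; rewrite -{1}(fE j); exact: leq_bigmax_seq.
by case: (ex_maxnP exP maxP) => p Pp pmax; exists p.
Qed.

(** In the product formula q >= 1 because a + c is a root, so the right-hand side is nonzero. *)
Lemma N_neq0 a c : a \in roots D -> c \in roots D -> a + c \in roots D ->
  N B a c != 0.
Proof.
move=> aD cD acD.
have [p pP] := @largest_string (- a) c (root_neq0 (opp_root aD)) cD.
have [q qP] := @largest_string a c (root_neq0 aD) cD.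
have pP' : largest (fun j => c - a *+ j \in roots D) p.
  by case: pP => P1 P2; split=> [|j]; rewrite -mulNrn //; exact: P2.
have := N_opp B aD cD acD pP' qP.
have q1 : (0 < q)%N.
  by case: qP => _ /(_ 1%N); apply; rewrite mulr1n addrC.
move=> E; apply: contra_eq_neq E => ->; rewrite mul0r eq_sym oppr_eq0.
apply: mulf_neq0; last by rewrite gt_eqF // ip_root_gt0.
apply: mulf_neq0; last by rewrite invr_eq0 pnatr_eq0.
by rewrite pnatr_eq0; case: q q1 {qP}.
Qed.

End RootCombinatorics.

(** * The grading and the highest weight of g(1) *)

Lemma daddv_pi0 (K : fieldType) (V : vectType K) (U W : {vspace V}) v :
  (U :&: W)%VS = 0%VS -> v \in W -> daddv_pi U W v = 0.
Proof.
move=> UW vW; have := daddv_pi_add UW (subvP (addvSr U W) v vW).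
rewrite (daddv_pi_id (U := W)) // => [/eqP|]; last by rewrite capvC.
by rewrite -subr_eq0 addrK => /eqP.
Qed.

Section SumsOfSubspaces.
Variables (K : fieldType) (V : vectType K) (I : eqType).
Implicit Types (s : seq I) (P : pred I) (U : I -> {vspace V}).

Lemma sumv_seq_sup s P U i : i \in s -> P i -> (U i <= \sum_(j <- s | P j) U j)%VS.
Proof.
elim: s => // j s IH; rewrite inE => /predU1P[->|si] Pi; rewrite big_cons.
  by rewrite Pi addvSl.
by case: ifP => _; [apply: subv_trans (IH si Pi) (addvSr _ _)|exact: IH].
Qed.

Lemma sumv_seq_sub s P U W : (forall i, i \in s -> P i -> (U i <= W)%VS) ->
  (\sum_(j <- s | P j) U j <= W)%VS.
Proof.
elim: s => [|j s IH] sW; first by rewrite big_nil sub0v.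
have sub : (\sum_(i <- s | P i) U i <= W)%VS.
  by apply: IH => i si; apply: sW; rewrite inE si orbT.
by rewrite big_cons; case: ifP => // Pj; rewrite subv_add sub sW ?mem_head.
Qed.

Lemma memv_seq_sumP s P U v : uniq s -> v \in (\sum_(i <- s | P i) U i)%VS ->
  exists F : I -> V, [/\ forall i, i \in s -> F i \in U i, forall i, ~~ P i -> F i = 0
    & v = \sum_(i <- s) F i].
Proof.
elim: s v => [|j s IH] v /=.
  rewrite !big_nil memv0 => _ /eqP ->; exists (fun=> 0).
  by split=> [i|//|]; rewrite ?mem0v ?big_nil.
move=> /andP[js us]; rewrite big_cons.
have ext (F : I -> V) u : u \in U j -> (~~ P j -> u = 0) ->
    (forall i, i \in s -> F i \in U i) -> (forall i, ~~ P i -> F i = 0) ->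
    exists G : I -> V, [/\ forall i, i \in j :: s -> G i \in U i,
      forall i, ~~ P i -> G i = 0 & u + \sum_(i <- s) F i = \sum_(i <- j :: s) G i].
  move=> uU uP FU FP; exists (fun i => if i == j then u else F i); split=> [i|i Pi|].
  - by rewrite inE; case: eqP => [->|_ /= /FU].
  - by case: eqP => [E|_]; [apply: uP; rewrite -E|exact: FP].
  rewrite big_cons eqxx; congr (_ + _); apply: eq_big_seq => i si.
  by case: eqP => // E; rewrite -E si in js.
case: ifP => Pj.
  case/memv_addP=> u uU [w /(IH _ us)[F [FU FP ->]] ->].
  by apply: ext => //; rewrite Pj.
case/(IH _ us)=> F [FU FP ->].
by have := ext F 0 (mem0v _) (fun=> erefl) FU FP; rewrite add0r.
Qed.
End SumsOfSubspaces.

Section Levels.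
Local Notation h := (hh D).
Local Notation h' := (hdual (hh D)).
Implicit Types (a c w : h') (H : subvs_of h) (x y v : g) (q i j : 'I_(rk D)).

Definition level q a : R[i] := coord (base D) q a.

Lemma levelD q a c : level q (a + c) = level q a + level q c.
Proof. exact: linearD. Qed.
Lemma levelN q a : level q (- a) = - level q a.
Proof. exact: linearN. Qed.
Lemma level0 q : level q 0 = 0.
Proof. exact: linear0. Qed.
Lemma levelZ q k a : level q (k *: a) = k * level q a.
Proof. exact: linearZ. Qed.
Lemma levelMn q a n : level q (a *+ n) = n%:R * level q a.
Proof. by rewrite /level linearMn mulr_natl. Qed.

Lemma level_base q i : level q (base D)`_i = (i == q)%:R.
Proof. by rewrite /level coord_free ?(basis_free (base_basis D)). Qed.

Lemma base_root i : (base D)`_i \in roots D.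
Proof. by rewrite base_roots // mem_nth // size_tuple. Qed.

Lemma level_sum a : a = \sum_(i < rk D) level i a *: (base D)`_i.
Proof. exact: hdual_sum_base. Qed.

Lemma root_levels a : a \in roots D -> exists k : 'I_(rk D) -> nat,
  (forall i, level i a = (k i)%:R) \/ (forall i, level i a = - (k i)%:R).
Proof.
have lev (k : 'I_(rk D) -> nat) i : level i (\sum_(j < rk D) (base D)`_j *+ k j) = (k i)%:R.
  rewrite /level linear_sum (bigD1 i) //= big1 => [|j ji].
    by rewrite addr0 -/(level i _) levelMn level_base eqxx mulr1.
  by rewrite -/(level i _) levelMn level_base (negPf ji) mulr0.
move=> /base_sign[k [->|->]]; exists k; [left|right] => i; first exact: lev.
by rewrite levelN lev.
Qed.

Lemma level_int q a : a \in roots D -> exists n : int, level q a = n%:~R.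
Proof.
move=> /root_levels[k [->|->]]; first by exists (k q)%:Z; rewrite -pmulrn.
by exists (- (k q)%:Z); rewrite rmorphN /= -pmulrn.
Qed.

Lemma positive_level q a : a \in roots D -> 0 < level q a -> positive a.
Proof.
move=> aD q0; apply/forallP => i; have [k [E|E]] := root_levels aD.
  by rewrite -/(level i a) E ler0n.
by move: q0; rewrite E oppr_gt0 ltrn0.
Qed.

Lemma positive_or_neg a : a \in roots D -> positive a \/ positive (- a).
Proof.
move=> /root_levels[k [E|E]]; [left|right]; apply/forallP => i.
  by rewrite -/(level i a) E ler0n.
by rewrite -/(level i _) levelN E opprK ler0n.
Qed.

Lemma mem_simple_span q a : (a \in <<simple_except q>>%VS) = (level q a == 0).
Proof.
apply/idP/eqP => [|aq0].
  have sub : (<<simple_except q>> <= lker (linfun (coord (base D) q : h' -> R[i]^o)))%VS.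
    apply/span_subvP => _ /mapP[j + ->]; rewrite mem_filter => /andP[jq _].
    by rewrite memv_ker lfunE /= -/(level q _) level_base (negPf jq).
  by move=> /(subvP sub); rewrite memv_ker lfunE => /eqP.
rewrite (level_sum a); apply: memv_suml => j _.
have [->|jq] := eqVneq j q; first by rewrite aq0 scale0r mem0v.
apply: memvZ; apply: memv_span; apply/mapP; exists j => //.
by rewrite mem_filter jq mem_enum.
Qed.

(** The weight 0 is included to cover h. Independence of weights makes such spaces disjoint for
    exclusive conditions, as the projections along nbar and q require. *)
Definition wt_space (P : pred h') : {vspace g} :=
  (\sum_(a <- 0%R :: roots D | P a) root_space a)%VS.

Lemma uniq_weights : uniq (0 :: roots D).
Proof.
by rewrite /= roots_uniq andbT; apply/negP => /root_neq0; rewrite eqxx.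
Qed.

Lemma mem_wt_space (P : pred h') x : x \in wt_space P ->
  exists F : h' -> g, [/\ forall a, a \in 0 :: roots D -> weight_vector a (F a),
    forall a, ~~ P a -> F a = 0 & x = \sum_(a <- 0 :: roots D) F a].
Proof.
move=> /(memv_seq_sumP uniq_weights)[F [FU FP ->]]; exists F; split=> // a aW.
exact/weight_vectorP/FU.
Qed.

Lemma root_space_wt_space (P : pred h') a : a \in 0 :: roots D -> P a ->
  (root_space a <= wt_space P)%VS.
Proof. exact: sumv_seq_sup. Qed.

Lemma wt_space_disjoint (P Q : pred h') : (forall a, P a -> ~~ Q a) ->
  (wt_space P :&: wt_space Q)%VS = 0%VS.
Proof.
move=> PQ; apply/eqP; rewrite -subv0; apply/subvP => x; rewrite memv_cap memv0.
case/andP=> /mem_wt_space[F [FU FP xF]] /mem_wt_space[G [GU GQ xG]].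
have E a : a \in 0 :: roots D -> F a - G a = 0.
  apply: (weight_vector_indep (F := fun c => F c - G c) uniq_weights) => [c cW|].
    rewrite -scaleN1r; apply: weight_vectorD (FU c cW) _.
    exact: weight_vectorZ (GU c cW).
  by rewrite sumrB -xF -xG subrr.
rewrite xF big_seq big1 // => a aW; have [Pa|/FP //] := boolP (P a).
by have /eqP := E a aW; rewrite GQ ?PQ // subr0 => /eqP.
Qed.

Lemma cartan_wt_space : (h <= wt_space (pred1 0%R))%VS.
Proof.
apply/subvP => x /weight_vector_cartan/weight_vectorP.
by apply/subvP; apply: root_space_wt_space; rewrite //= ?inE eqxx.
Qed.

Lemma roots_wt_space (P Q : pred h') : {in roots D, forall a, P a -> Q a} ->
  (\sum_(a <- roots D | P a) root_space a <= wt_space Q)%VS.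
Proof.
move=> PQ; apply: sumv_seq_sub => a aD Pa; apply: root_space_wt_space (PQ a aD Pa).
by rewrite inE aD orbT.
Qed.

Lemma wt_spaceS (P Q : pred h') : (forall a, P a -> Q a) ->
  (wt_space P <= wt_space Q)%VS.
Proof.
by move=> PQ; apply: sumv_seq_sub => a aW Pa; apply: root_space_wt_space (PQ a Pa).
Qed.

Lemma parabolic_wt_space q : (parabolic q <= wt_space (fun a => 0 <= level q a)%R)%VS.
Proof.
rewrite subv_add subv_add; apply/andP; split; first (apply/andP; split).
- by apply: subv_trans cartan_wt_space (wt_spaceS _) => a /eqP ->; rewrite level0.
- by apply: roots_wt_space => a _; rewrite mem_simple_span => /eqP ->.
by apply: roots_wt_space => a _ /andP[/forallP/(_ q)].
Qed.

Lemma nbar_wt_space q : (nbar q <= wt_space (fun a => level q a < 0)%R)%VS.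
Proof.
rewrite subv_add; apply/andP; split; rewrite /grading /= add0v;
  by apply: roots_wt_space => a _ /eqP; rewrite /level => ->; rewrite rmorphN /= oppr_lt0 ltr0n.
Qed.

Lemma parabolic_nbar q : (parabolic q :&: nbar q)%VS = 0%VS.
Proof.
apply/eqP; rewrite -subv0 -(@wt_space_disjoint (fun a => 0 <= level q a)%R
  (fun a => level q a < 0)%R) ?capvS ?parabolic_wt_space ?nbar_wt_space //.
by move=> a a0; rewrite -real_leNgt ?real0 ?ger0_real.
Qed.

Lemma nbar_parabolic q : (nbar q :&: parabolic q)%VS = 0%VS.
Proof. by rewrite capvC parabolic_nbar. Qed.

Lemma cartan_roots : (h :&: (\sum_(a <- roots D) root_space a))%VS = 0%VS.
Proof.
apply/eqP; rewrite -subv0 -[X in (_ <= X)%VS](@wt_space_disjoint (pred1 0%R) (predC1 0%R)).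
  apply: capvS; first exact: cartan_wt_space.
  by apply: (roots_wt_space (P := xpredT)) => a /root_neq0.
by move=> a; rewrite /= negbK.
Qed.

(** Otherwise x would lie both in its own weight space and in a sum of other ones. *)
Lemma mem_grading q (k : int) a x : k != 0 -> x \in grading q k ->
  weight_vector a x -> x != 0 -> a \in roots D /\ level q a = k%:~R.
Proof.
move=> k0 + xa x0; rewrite /grading (negPf k0) add0v => xg.
pose P c := (c != 0) && (level q c == k%:~R).
have xP : x \in wt_space P.
  apply: subvP xg; apply: roots_wt_space => c cD; rewrite /P => ->.
  by rewrite root_neq0.
suff : P a.
  by move=> /andP[a0 /eqP ak]; split=> //; exact: mem_roots a0 xa x0.
have aW := weight_nz xa x0.
apply: contraT => Pa; have xa' : x \in wt_space (pred1 a).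
  by apply: (subvP (root_space_wt_space aW _)); [rewrite /= eqxx|apply/weight_vectorP].
move: x0; rewrite -memv0 -(@wt_space_disjoint P (pred1 a)) ?memv_cap ?xP ?xa' //.
by move=> c Pc; apply: contraNneq Pa => <-.
Qed.

Lemma root_grading q (k : int) a : a \in roots D -> level q a = k%:~R ->
  (root_space a <= grading q k)%VS.
Proof.
move=> aD ak; apply: subv_trans (addvSr _ _).
by apply: sumv_seq_sup => //; apply/eqP.
Qed.

Lemma mem_rootsV_grading q (k : int) a : k != 0 ->
  (a \in rootsV D (grading q k)) = (a \in roots D) && (level q a == k%:~R).
Proof.
move=> k0; rewrite mem_filter andbC; apply: andb_id2l => aD.
apply/idP/eqP => [sub|]; last exact: root_grading.
have Xa : X B a \in grading q k.
  by apply: (subvP sub); exact/weight_vectorP/X_weight.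
by have [] := mem_grading k0 Xa (X_weight aD) (X_neq0 aD).
Qed.

Lemma X_nbar q a : a \in roots D -> level q a = - 1 \/ level q a = - 2 ->
  X B a \in nbar q.
Proof.
move=> aD alev; have /weight_vectorP Xa := X_weight aD.
case: alev => alev; [apply: (subvP (addvSl _ _))|apply: (subvP (addvSr _ _))];
  by apply: (subvP (root_grading aD _)) Xa; rewrite alev rmorphN.
Qed.

Lemma X_levi q a : a \in roots D -> level q a = 0 -> X B a \in levi q.
Proof.
move=> aD a0; have /weight_vectorP Xa := X_weight aD.
apply: (subvP (addvSr _ _)); apply: subvP Xa; apply: sumv_seq_sup => //.
by rewrite mem_simple_span a0.
Qed.

Lemma X_nilrad q a : a \in roots D -> 0 < level q a -> X B a \in nilrad q.
Proof.
move=> aD a0; have /weight_vectorP Xa := X_weight aD.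
apply: subvP Xa; apply: sumv_seq_sup => //.
by rewrite (positive_level aD a0) mem_simple_span gt_eqF.
Qed.

Lemma proj_q_id q x : x \in parabolic q -> proj_q q x = x.
Proof. exact: daddv_pi_id (parabolic_nbar q). Qed.

Lemma proj_nbar_id q x : x \in nbar q -> proj_nbar q x = x.
Proof. exact: daddv_pi_id (nbar_parabolic q). Qed.

Lemma proj_nbar0 q x : x \in parabolic q -> proj_nbar q x = 0.
Proof.
exact: daddv_pi0 (nbar_parabolic q).
Qed.

Lemma proj_q0 q x : x \in nbar q -> proj_q q x = 0.
Proof.
exact: daddv_pi0 (parabolic_nbar q).
Qed.

Lemma proj_h_cartan H : proj_h D (vsval H) = H.
Proof.
by rewrite /proj_h daddv_pi_id ?cartan_roots ?subvsP // vsvalK.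
Qed.

Lemma proj_h_root a x : a \in roots D -> weight_vector a x -> proj_h D x = 0.
Proof.
move=> aD /weight_vectorP xa.
have xs : x \in (\sum_(c <- roots D) root_space c)%VS by apply: subvP xa; exact: sumv_seq_sup.
by rewrite /proj_h (daddv_pi0 cartan_roots xs) linear0.
Qed.

End Levels.

(** * The length of the highest weight of g(1) *)

Section HighestWeight.
Local Notation h := (hh D).
Local Notation h' := (hdual (hh D)).
Local Notation "''b_' i" := ((base D)`_i) (at level 8, i at level 2).
Implicit Types (a c w : h') (H : subvs_of h) (x y v : g) (i j : 'I_(rk D)).

Lemma positive_expand a : a \in roots D -> positive a ->
  exists k : 'I_(rk D) -> nat, a = \sum_(i < rk D) 'b_i *+ k i /\ forall i, level i a = (k i)%:R.
Proof.
move=> aD /forallP pos.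
have [k [E|E]] := root_levels aD.
  exists k; split=> //; rewrite {1}(level_sum a); apply: eq_bigr => i _.
  by rewrite E scaler_nat.
have k0 i : k i = 0%N.
  have := pos i; rewrite -/(level i a) E oppr_ge0 => k0.
  by apply/eqP; rewrite -(pnatr_eq0 R[i]) eq_le k0 ler0n.
have := root_neq0 aD; rewrite (level_sum a) big1 ?eqxx // => i _.
by rewrite E k0 oppr0 scale0r.
Qed.

(** A positive product would make the difference of two simple roots a root, with coefficients of
    both signs. *)
Lemma rip_base_le0 i j : i != j -> rip 'b_i 'b_j <= 0.
Proof.
move=> ij; rewrite leNgt; apply/negP => pos.
have := sub_root (base_root j) (base_root i) pos.
have li : level i ('b_i - 'b_j) = 1 by rewrite levelD levelN !level_base eqxx eq_sym (negPf ij) subr0.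
have lj : level j ('b_i - 'b_j) = - 1.
  by rewrite levelD levelN !level_base eqxx (negPf ij) sub0r.
rewrite inE => /predU1P[r0|rD].
  by move: li; rewrite r0 level0 => /esym/eqP; rewrite oner_eq0.
have [/forallP/(_ j)|/forallP/(_ i)] := positive_or_neg rD.
  by rewrite -/(level j _) lj oppr_ge0 ler10.
by rewrite -/(level i _) levelN li oppr_ge0 ler10.
Qed.

Lemma base_positive j : positive 'b_j.
Proof. by apply/forallP => i; rewrite -/(level i _) level_base ler0n. Qed.

Lemma rip_suml (I : Type) (r : seq I) (P : pred I) (F : I -> h') w :
  rip (\sum_(i <- r | P i) F i) w = \sum_(i <- r | P i) rip (F i) w.
Proof.
by apply: (big_morph (fun x : h' => rip x w)) => [u v|]; rewrite ?ripDl ?rip0l.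
Qed.

Variable q : 'I_(rk D).

(** The reflection in a simple root of l. As n has the sign of <a, b_j>, it lowers the height of a
    when this product is positive and raises it when negative. *)
Lemma reflect_base a j : a \in roots D -> level q a = 1 -> j != q -> rip a 'b_j != 0 ->
  exists n : int, [/\ 0 < n%:~R * rip a 'b_j, a - n%:~R *: 'b_j \in roots D,
    level q (a - n%:~R *: 'b_j) = 1
    & rip (a - n%:~R *: 'b_j) (a - n%:~R *: 'b_j) = rip a a].
Proof.
move=> aD a1 jq aj0; have bD := base_root j; have b0 := rip_gt0 bD.
have [n En] := rip_int bD aD; exists n.
have scE (m : nat) w : rip (m%:R *: 'b_j) w = m%:R * rip 'b_j w.
  by rewrite scaler_nat ripMnl.
have EL : level q (a - n%:~R *: 'b_j) = 1.
  by rewrite levelD levelN levelZ level_base (negPf jq) mulr0 subr0.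
have pos : 0 < n%:~R * rip a 'b_j.
  have -> : n%:~R * rip a 'b_j = 2 * rip a 'b_j ^+ 2 / rip 'b_j 'b_j.
    by apply: (mulIf (lt0r_neq0 b0)); rewrite mulfVK ?lt0r_neq0 // mulrAC -En; ring.
  by rewrite divr_gt0 // mulr_gt0 // exprn_even_gt0.
have key : a - n%:~R *: 'b_j \in roots D /\ rip (n%:~R *: 'b_j) =1 (fun w => n%:~R * rip 'b_j w).
  case: n En {EL pos} => n En.
    rewrite -pmulrn scaler_nat; split; first by apply: reflect_root => //; rewrite En -pmulrn.
    by move=> w; rewrite ripMnl.
  (* [reflect_root] takes a natural multiple, so a negative n is treated with the root - b_j. *)
  rewrite NegzE rmorphN /= scaleNr opprK -pmulrn scaler_nat; split.
    have := reflect_root (n := n.+1) (opp_root bD) aD.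
    rewrite mulNrn opprK; apply; rewrite ripNl !ripNr opprK mulrN En NegzE rmorphN /=.
    by rewrite mulNr opprK -pmulrn.
  by move=> w; rewrite ripNl ripMnl mulNr.
split; rewrite ?key.1 //.
have k2 := key.2; rewrite ripDl !ripDr !ripNl !ripNr (ripC a) !k2.
rewrite (ripC 'b_j (_ *: _)) k2 (ripC 'b_j a); move: En; set p := rip a _.
by move=> En; nra.
Qed.

Definition height a : R[i] := \sum_(i < rk D) level i a.

Lemma level1_expand a : a \in roots D -> level q a = 1 ->
  exists k : 'I_(rk D) -> nat, [/\ a = \sum_(i < rk D) 'b_i *+ k i, k q = 1%N
    & height a = (\sum_(i < rk D) k i)%N%:R].
Proof.
move=> aD a1; have a0 : 0 < level q a by rewrite a1 ltr01.
have [k [ak kE]] := positive_expand aD (positive_level aD a0).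
exists k; split=> //; last by rewrite natr_sum; apply: eq_bigr => i _; rewrite kE.
by apply/eqP; rewrite -(eqr_nat R[i]) -kE a1.
Qed.

Lemma heightB a j (n : R[i]) : height (a - n *: 'b_j) = height a - n.
Proof.
rewrite /height -[n in RHS]mulr1 -[1 in RHS](_ : \sum_i level i 'b_j = 1).
  by rewrite mulr_sumr -sumrB; apply: eq_bigr => i _; rewrite levelD levelN levelZ.
by rewrite (bigD1 j) //= big1 ?level_base ?eqxx ?addr0 // => i ij;
  rewrite level_base eq_sym (negPf ij).
Qed.

(** Induction on the height. If <a, b_j> > 0 for some simple root b_j of l, reflecting lowers the
    height and keeps the length. Otherwise a = alpha_q + sum k_i b_i gives <a, a> <= <alpha_q, a> <=
    <alpha_q, alpha_q>. *)
Lemma norm_le_simple a : a \in roots D -> level q a = 1 -> rip a a <= rip 'b_q 'b_q.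
Proof.
move=> aD a1; have [k [_ _ ht]] := level1_expand aD a1.
move: (\sum_i k i)%N ht => n {k}; have [m] := ubnP n.
elim: m n a aD a1 => // m IH n a aD a1 nm ht.
have [[j [jq aj]]|no] := pselect (exists j, j != q /\ 0 < rip a 'b_j).
  have [z [+ cD c1 <-]] := reflect_base aD a1 jq (lt0r_neq0 aj).
  rewrite (pmulr_lgt0 _ aj) ltr0z => z0.
  have [k [_ _ cht]] := level1_expand cD c1.
  apply: (IH _ _ cD c1 _ cht); rewrite -ltnS; apply: leq_trans nm; rewrite ltnS.
  by rewrite -(ltr_nat R[i]) -cht heightB ht ltrBlDr ltrDl ltr0z.
have [k [ak kq _]] := level1_expand aD a1.
have ajle j : j != q -> rip a 'b_j <= 0.
  by move=> jq; rewrite leNgt; apply/negP => aj; apply: no; exists j.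
have E w : rip a w = rip 'b_q w + \sum_(i < rk D | i != q) (k i)%:R * rip 'b_i w.
  rewrite {1}ak rip_suml (bigD1 q) //= kq; congr (_ + _).
  by apply: eq_bigr => i _; rewrite ripMnl.
have le0 w : (forall j, j != q -> rip 'b_j w <= 0) -> rip a w <= rip 'b_q w.
  move=> wle; rewrite E gerDl sumr_le0 // => i iq.
  by rewrite mulr_ge0_le0 ?ler0n // wle.
apply: le_trans (le0 a _) _ => [j jq|]; first by rewrite ripC ajle.
by rewrite ripC; apply: le0 => j jq; rewrite rip_base_le0.
Qed.

(** Take a root of maximal height among those of level 1 and the length of alpha_q; if it were not
    l-dominant, a reflection would raise it. *)
Lemma dominant_conj : exists a, [/\ a \in roots D, level q a = 1,
  rip a a = rip 'b_q 'b_q & forall j, j != q -> 0 <= rip a 'b_j].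
Proof.
pose ht a := xget 0%N [set n : nat | height a = n%:R]%classic.
pose P a := [&& level q a == 1 & rip a a == rip 'b_q 'b_q].
pose Q n := has (fun a => P a && (ht a == n)) (roots D).
have exQ : exists n, Q n.
  exists (ht 'b_q); apply/hasP; exists 'b_q; first exact: base_root.
  by rewrite /P level_base !eqxx.
have maxQ n : Q n -> (n <= \max_(r <- roots D) ht r)%N.
  by case/hasP=> a aD /andP[_ /eqP <-]; exact: leq_bigmax_seq.
case: (ex_maxnP exQ maxQ) => n /hasP[a aD /andP[/andP[/eqP a1 /eqP aa] /eqP an]] nmax.
exists a; split=> // j jq; rewrite leNgt; apply/negP => aj.
have htE c : c \in roots D -> level q c = 1 -> height c = (ht c)%:R.
  move=> cD c1; rewrite /ht; case: xgetP => [m _ //|no].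
  by have [k [_ _ /no]] := level1_expand cD c1.
have [z [+ cD c1 cc]] := reflect_base aD a1 jq (ltr0_neq0 aj).
rewrite (nmulr_lgt0 _ aj) ltrz0 => z0.
have := nmax (ht (a - z%:~R *: 'b_j)); rewrite leqNgt => /(_ _)/negP; apply.
  by apply/hasP; exists (a - z%:~R *: 'b_j); rewrite // /P c1 cc aa !eqxx.
by rewrite -an -(ltr_nat R[i]) -!htE // heightB ltrBrDr gtrDl ltrz0.
Qed.

Variables lam : h'.
Hypothesis lam_fund : fundamental_weight q lam.

Lemma ip_fund_base j : ip lam 'b_j = (j == q)%:R * (ip 'b_q 'b_q / 2).
Proof.
have b0 := lt0r_neq0 (ip_root_gt0 (base_root j)).
have := lam_fund j; move=> /(canRL (mulfVK b0)) E.
have -> : ip lam 'b_j = 2 * ip lam 'b_j / 2 by rewrite mulrC mulKf ?pnatr_eq0.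
by rewrite E; case: eqP => [->|_]; rewrite ?mulrA // !mul0r.
Qed.

(** Source of the factor |alpha_q|^2 / 2 in the coefficient of s. *)
Lemma ip_fund c : ip lam c = level q c * (ip 'b_q 'b_q / 2).
Proof.
rewrite {1}(level_sum c) ipC ip_suml (bigD1 q) //= big1 => [|j jq].
  by rewrite addr0 ipZl ipC ip_fund_base eqxx mul1r.
by rewrite ipZl ipC ip_fund_base (negPf jq) mul0r mulr0.
Qed.

Lemma simple_gt0 : 0 < ip 'b_q 'b_q / 2.
Proof. by rewrite divr_gt0 ?ip_root_gt0 ?base_root. Qed.

Lemma real_weight_fund : real_weight lam.
Proof.
move=> c cD; have [n ->] : exists n : int, ip lam c = n%:~R * (ip 'b_q 'b_q / 2).
  by have [n En] := level_int q cD; exists n; rewrite ip_fund En.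
by rewrite rpredM ?realz // gtr0_real // simple_gt0.
Qed.

Lemma ip_fund_gt0 : 0 < ip lam lam.
Proof.
apply: ip_gt0; first exact: real_weight_fund.
apply: contraTneq simple_gt0 => l0.
have := ip_fund_base q; rewrite l0 ip0l eqxx mul1r => <-.
by rewrite ltxx.
Qed.

(** Replacing the levels of w by their real parts does not change its products with the roots, hence
    does not change w. *)
Lemma level_real w j : real_weight w -> level j w \is Num.real.
Proof.
move=> rw; pose w' := \sum_(i < rk D) (complex.Re (level i w))%:C *: 'b_i.
suff -> : w = w'.
  rewrite /w' /level linear_sum (bigD1 j) //= big1 => [|i ij].
    rewrite addr0 -/(level j _) levelZ level_base eqxx mulr1.
    by rewrite complex_real.
  by rewrite -/(level j _) levelZ level_base (negPf ij) mulr0.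
have E c : c \in roots D -> ip w c = ip w' c.
  move=> cD; rewrite -[LHS]RRe_real ?rw // /w' {1}(level_sum w) !ip_suml raddf_sum.
  rewrite rmorph_sum; apply: eq_bigr => i _; rewrite !ipZl ripE ?base_root //.
  by rewrite -rmorphM; congr (_%:C); case: (level i w) => x y /=; rewrite mulr0 subr0.
apply/eqP; rewrite -subr_eq0; apply/eqP/lfunP => H; rewrite -sharpE zero_lfunE.
suff -> : sharp (w - w') = 0 by rewrite linear0 killing0l.
by apply: (@roots_sep _ _ D) => c cD; rewrite -ipE ipC ipDl ipNl E // subrr.
Qed.

(* The simple roots of l form an obtuse basis, so l-dominant weights are
   nonnegative combinations of them. *)
Lemma dual_cone w : real_weight w -> level q w = 0 ->
  (forall j, j != q -> 0 <= ip w 'b_j) -> forall j, 0 <= level j w.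
Proof.
move=> rw wq wdom.
pose neg i := level i w < 0.
have posE i : ~~ neg i = (0 <= level i w).
  by rewrite /neg -real_leNgt ?real0 ?level_real.
have negq i : neg i -> i != q by apply: contraTneq => ->; rewrite /neg wq ltxx.
(* [wn] is the negative part of w: dominance gives <wn, w> >= 0 and obtuseness gives <w + wn, wn> <=
   0, so <wn, wn> <= 0. *)
pose wn := \sum_(i < rk D | neg i) (- level i w) *: 'b_i.
have rwn : real_weight wn.
  rewrite /wn; elim/big_ind: _ => [c cD||i _]; first by rewrite ip0l real0.
  - by move=> a c ra rc; exact: real_weightD.
  - by apply: real_weightZ (real_weight_root (base_root i)); rewrite rpredN level_real.
have ge1 : 0 <= ip wn w.
  rewrite /wn ip_suml sumr_ge0 // => i ni; rewrite ipZl ipC.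
  by rewrite mulr_ge0 ?wdom ?negq // oppr_ge0 ltW.
have le2 : ip (w + wn) wn <= 0.
  have -> : w + wn = \sum_(i < rk D | ~~ neg i) level i w *: 'b_i.
    rewrite {1}(level_sum w) (bigID neg) /= /wn addrAC -big_split /=.
    by rewrite big1 ?add0r // => i _; rewrite scaleNr subrr.
  rewrite ip_suml sumr_le0 // => i ni; rewrite ipZl ipC /wn ip_suml.
  rewrite mulr_ge0_le0 -?posE // sumr_le0 // => j nj; rewrite ipZl.
  rewrite mulr_ge0_le0 ?oppr_ge0 ?(ltW nj) // ripE ?base_root // lecR.
  by apply: rip_base_le0; apply: contraNneq ni => <-.
have wn0 : wn = 0.
  have [ge0 eq0] := ip_ge0 rwn; apply: eq0; apply/eqP; rewrite eq_le ge0 andbT.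
  by apply: le_trans le2; rewrite ipDl lerDr ipC.
move=> j; rewrite -posE; apply/negP => nj.
have := congr1 (level j) wn0; rewrite level0 /wn /level linear_sum (bigD1 j) //=.
rewrite big1 => [|i /andP[_ ij]]; last first.
  by rewrite -/(level j _) levelZ level_base (negPf ij) mulr0.
rewrite -/(level j _) levelZ level_base eqxx mulr1 addr0 => /eqP.
by rewrite oppr_eq0 lt_eqF.
Qed.

(** Subtracting the same multiple of lam from a and c leaves l-dominant weights orthogonal to lam.
    By [dual_cone] their product is nonnegative, and the multiple of lam adds a positive square. *)
Lemma level1_dominant_gt0 a c : a \in roots D -> c \in roots D ->
  level q a = 1 -> level q c = 1 ->
  (forall j, j != q -> 0 <= rip a 'b_j) -> (forall j, j != q -> 0 <= rip c 'b_j) ->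
  0 < rip a c.
Proof.
move=> aD cD a1 c1 adom cdom.
(* Chosen so that t lam has level 1 at q. *)
pose t := ip 'b_q 'b_q / 2 / ip lam lam.
have t0 : 0 < t by rewrite divr_gt0 ?simple_gt0 ?ip_fund_gt0.
pose proj w := w - t *: lam.
have qlam : t * level q lam = 1.
  rewrite /t mulrAC mulrC -[X in _ * X]mulrC -ip_fund mulVf //.
  by rewrite lt0r_neq0 // ip_fund_gt0.
have projP w : w \in roots D -> level q w = 1 -> (forall j, j != q -> 0 <= rip w 'b_j) ->
    [/\ ip lam (proj w) = 0, forall j, j != q -> 0 <= ip (proj w) 'b_j
      & forall j, 0 <= level j (proj w)].
  move=> wD w1 wdom.
  have wj j : j != q -> 0 <= ip (proj w) 'b_j.
    move=> jq; rewrite /proj ipDl ipNl ipZl ip_fund_base (negPf jq) mul0r mulr0 subr0.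
    by rewrite ripE ?base_root // lecR wdom.
  have wq : level q (proj w) = 0.
    by rewrite /proj levelD levelN levelZ w1 qlam subrr.
  split=> //; first by rewrite ip_fund wq mul0r.
  apply: dual_cone => //; apply: real_weightD (real_weight_root wD) _.
  by apply: real_weightN; apply: real_weightZ real_weight_fund; rewrite gtr0_real.
have [al adom' alev] := projP a aD a1 adom.
have [cl cdom' clev] := projP c cD c1 cdom.
suff : 0 < ip a c by rewrite ripE // ltcR.
have -> : ip a c = ip (proj a) (proj c) + t ^+ 2 * ip lam lam.
  have E pa pc : ip lam pa = 0 -> ip lam pc = 0 ->
      ip (pa + t *: lam) (pc + t *: lam) = ip pa pc + t ^+ 2 * ip lam lam.
    move=> la lc; rewrite ipDl (ipDr _ _ pa) (ipDr _ _ (t *: lam)) !(ipZl t).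
    by rewrite lc (ipZr t _ pa) (ipC pa lam) la (ipZr t _ lam) !mulr0 addr0 add0r expr2 mulrA.
  by rewrite -E ?al ?cl // /proj !subrK.
rewrite ltr_wpDl //; last by rewrite mulr_gt0 ?exprn_gt0 ?ip_fund_gt0.
rewrite {1}(level_sum (proj a)) ip_suml sumr_ge0 // => j _; rewrite ipZl ipC.
have [->|jq] := eqVneq j q; last by rewrite mulr_ge0 // cdom'.
suff -> : level q (proj a) = 0 by rewrite mul0r.
by rewrite /proj levelD levelN levelZ a1 qlam subrr.
Qed.

Variable mu : h'.
Hypothesis mu_hw : highest_weight q (@br _ g) (grading q 1) mu.

Lemma mu_root : mu \in roots D /\ level q mu = 1.
Proof.
have [v [vg v0 vw _]] := mu_hw; have vmu : weight_vector mu v by split.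
by have := mem_grading (oner_neq0 int) vg vmu v0; rewrite mulr1z.
Qed.

(** The highest weight vector is a multiple of X_mu, and [X_a, X_mu] would be nonzero if a + mu were
    a root. *)
Lemma mu_max a : a \in roots D -> level q a = 0 -> positive a -> a + mu \notin roots D.
Proof.
move=> aD a0 apos; apply/negP => amD.
have [v [vg v0 vw vhw]] := mu_hw; have [muD mu1] := mu_root.
have Xav : br (X B a) v = 0.
  apply: (vhw a) => //; last exact/weight_vectorP/X_weight.
  rewrite mem_filter aD andbT; apply: subv_trans (addvSr _ _).
  by apply: sumv_seq_sup => //; rewrite mem_simple_span a0.
have vmu : weight_vector mu v by split.
have vX := root_space_line muD vmu.
move: Xav; rewrite vX brZr N_br // => /eqP; rewrite !scaler_eq0.
rewrite (negPf (N_neq0 aD muD amD)) (negPf (X_neq0 amD)) !orbF => /eqP k0.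
by move: v0; rewrite vX k0 scale0r eqxx.
Qed.

Lemma mu_dominant j : j != q -> 0 <= rip mu 'b_j.
Proof.
move=> jq; rewrite leNgt; apply/negP => lt0; have [muD mu1] := mu_root.
have bj0 : level q 'b_j = 0 by rewrite level_base (negPf jq).
have := add_root (base_root j) muD lt0; rewrite inE => /predU1P[E|].
  by have := congr1 (level q) E; rewrite levelD mu1 bj0 addr0 level0 => /eqP; rewrite oner_eq0.
by rewrite addrC; apply/negP/mu_max; rewrite ?base_root ?base_positive.
Qed.

(** Let a be the dominant root of [dominant_conj]. Since <a, mu> > 0, a - mu is 0 or a root of l,
    and not a positive one by [mu_max]. If it is negative, mu - a is a nonnegative combination of
    simple roots of l, so |mu|^2 - |a|^2 = <mu - a, mu + a> >= 0. The reverse inequality is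
    [norm_le_simple]. *)
Lemma mu_norm : rip mu mu = rip 'b_q 'b_q.
Proof.
have [muD mu1] := mu_root.
apply/eqP; rewrite eq_le norm_le_simple //=.
have [a [aD a1 <- adom]] := dominant_conj.
have pos := level1_dominant_gt0 aD muD a1 mu1 adom mu_dominant.
have := sub_root muD aD pos; rewrite inE => /predU1P[/eqP|bD].
  by rewrite subr_eq0 => /eqP ->.
have b0 : level q (a - mu) = 0 by rewrite levelD levelN a1 mu1 subrr.
have [bpos|bpos] := positive_or_neg bD.
  by have := mu_max bD b0 bpos; rewrite subrK aD.
have mbD := opp_root bD.
have [k [bk kE]] := positive_expand mbD bpos.
have kq : k q = 0%N by apply/eqP; rewrite -(pnatr_eq0 R[i]) -kE levelN b0 oppr0.
have : 0 <= rip (- (a - mu)) (mu + a).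
  rewrite bk rip_suml sumr_ge0 // => i _; rewrite ripMnl.
  have [->|iq] := eqVneq i q; first by rewrite kq mul0r.
  by rewrite mulr_ge0 ?ler0n // ripDr !(ripC 'b_i) addr_ge0 ?mu_dominant ?adom.
rewrite opprB ripDl !ripDr !ripNl (ripC a mu).
by move=> H; lra.
Qed.

End HighestWeight.

(** * The quadratic form of the lowest weight vector *)

Section QuadraticForm.
Local Notation h := (hh D).
Local Notation h' := (hdual (hh D)).
Implicit Types (a c d w : h') (H : subvs_of h) (x y v z : g).
Variables (q : 'I_(rk D)) (mu eps : h').
Hypotheses (muD : mu \in roots D) (mu1 : level q mu = 1).
Hypotheses (epsD : eps \in roots D) (eps1 : level q eps = 1).
Hypothesis sumND : mu + eps \notin roots D.

Local Notation Z := (rootsV D (zn q)).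
Local Notation L1 := (rootsV D (grading q 1)).
Local Notation nu := (mu + eps).

Lemma mem_Z d : (d \in Z) = (d \in roots D) && (level q d == 2).
Proof. exact: (@mem_rootsV_grading q 2). Qed.

Lemma mem_L1 d : (d \in L1) = (d \in roots D) && (level q d == 1).
Proof. by rewrite (@mem_rootsV_grading q 1) // mulr1z. Qed.

(** A trace on z(nbar), since the X_d and the X_(-d) are dual bases for the Killing form. *)
Definition trace4 x y : R[i] :=
  \sum_(d <- Z) killing (X B d)
    (br (X B (- eps)) (br (X B (- mu)) (br x (br y (X B (- d)))))).

(** Only equal indices of [omega_bar] and [omega] pair nontrivially; passing ad X_(-mu) ad X_(-eps)
    across the Killing form reverses its order. *)
Lemma tau2_tilde_Ylow x : tau2_tilde B q (Ylow B q mu eps) x = 2^-1 * trace4 x x.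
Proof.
rewrite /tau2_tilde /tau2 tens_pairZr; congr (_ * _).
rewrite /Ylow tens_map_sum /omega tens_map_sum tens_pair_suml.
rewrite /trace4 big_seq [RHS]big_seq; apply: eq_bigr => d dZ.
have := dZ; rewrite mem_Z => /andP[dD _]; rewrite tens_pair_sumr (bigD1_seq d) ?filter_uniq ?roots_uniq //=.
  rewrite !tens_mapE !id_lfunE !comp_lfunE !adE tens_pair_tens [X in _ * X]killingC X_killing // mulr1.
  rewrite killing_br2 big_seq_cond big1 ?addr0 // => e /andP[].
  rewrite mem_Z => /andP[eD _] ed.
  rewrite !tens_mapE !id_lfunE tens_pair_tens.
  rewrite [X in _ * X](killing_root (XN_weight dD) (X_weight eD)) ?mulr0 //.
  by rewrite addrC subr_eq0.
Qed.

Lemma trace4Dl x y z : trace4 (x + y) z = trace4 x z + trace4 y z.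
Proof. by rewrite -big_split; apply: eq_bigr => d _; rewrite !(brDl, brDr, killingDr). Qed.

Lemma trace4Dr x y z : trace4 z (x + y) = trace4 z x + trace4 z y.
Proof. by rewrite -big_split; apply: eq_bigr => d _; rewrite !(brDl, brDr, killingDr). Qed.

Lemma trace4Zl k x z : trace4 (k *: x) z = k * trace4 x z.
Proof. by rewrite mulr_sumr; apply: eq_bigr => d _; rewrite !(brZl, brZr, killingZr). Qed.

Lemma trace4Zr k x z : trace4 z (k *: x) = k * trace4 z x.
Proof. by rewrite mulr_sumr; apply: eq_bigr => d _; rewrite !(brZl, brZr, killingZr). Qed.

Definition pol a c : R[i] := polar (tau2_tilde B q (Ylow B q mu eps)) (X B a) (X B c).

Lemma polE a c : pol a c = 4^-1 * (trace4 (X B a) (X B c) + trace4 (X B c) (X B a)).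
Proof.
rewrite /pol /polar !tau2_tilde_Ylow !(trace4Dl, trace4Dr); set p := trace4 _ _.
by field.
Qed.

Lemma polC a c : pol a c = pol c a.
Proof. by rewrite !polE addrC. Qed.

Lemma sum_neq0 : nu != 0.
Proof.
apply: contraTneq (@oner_neq0 R[i]) => /(congr1 (level q)).
rewrite levelD mu1 eps1 level0 => /eqP; rewrite -[1 + 1]/(2%:R) pnatr_eq0 //.
Qed.

Lemma trace4_weight0 a c : a \in roots D -> c \in roots D -> a + c != nu ->
  trace4 (X B a) (X B c) = 0.
Proof.
move=> aD cD ac; rewrite /trace4 big_seq big1 // => d; rewrite mem_Z => /andP[dD _].
have w1 := weight_vector_br (X_weight cD) (XN_weight dD).
have w2 := weight_vector_br (X_weight aD) w1.
have w3 := weight_vector_br (XN_weight muD) w2.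
have w4 := weight_vector_br (XN_weight epsD) w3.
apply: killing_root (X_weight dD) w4 _.
apply: contra ac => /eqP E; rewrite -subr_eq0 -E; apply/eqP.
by rewrite [RHS]addrC !addrA subrK -[RHS]addrA [RHS]addrC opprD [- mu - eps]addrC.
Qed.

Lemma pol_weight0 a c : a \in roots D -> c \in roots D -> a + c != nu -> pol a c = 0.
Proof.
move=> aD cD ac; rewrite polE !trace4_weight0 ?addr0 ?mulr0 //.
by rewrite addrC.
Qed.

Lemma N_anti a c : a \in roots D -> c \in roots D -> a + c \in roots D ->
  N B a c = - N B c a.
Proof.
move=> aD cD acD; have caD : c + a \in roots D by rewrite addrC.
have := brC (X B a) (X B c); rewrite !N_br // -scaleNr (addrC c) => /eqP.
by rewrite -subr_eq0 -scalerBl scaler_eq0 (negPf (X_neq0 acD)) orbF subr_eq0 => /eqP.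
Qed.

Lemma nonroot_br a c : a \in roots D -> c \in roots D -> a + c != 0 ->
  a + c \notin roots D -> br (X B a) (X B c) = 0.
Proof.
move=> aD cD ac0 acD.
exact: weight_vector_eq0 ac0 acD (weight_vector_br (X_weight aD) (X_weight cD)).
Qed.

(** ad X_mu and ad X_eps commute because mu + eps is neither a root nor 0. *)
Lemma trace4_comm : trace4 (X B eps) (X B mu) = trace4 (X B mu) (X B eps).
Proof.
apply: eq_bigr => d _; congr (killing _ (br _ (br _ _))).
by rewrite br_derivation [br (X B eps) (X B mu)]brC nonroot_br ?sum_neq0 // oppr0 br0l add0r.
Qed.

Lemma br_scale2 a c d : a \in roots D -> c \in roots D -> d \in roots D ->
  c - d != 0 -> a + (c - d) \in roots D ->
  br (X B a) (br (X B c) (X B (- d))) = (N B a (c - d) * N B c (- d)) *: X B (a + (c - d)).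
Proof.
move=> aD cD dD cd0 acd; have ndD := opp_root dD.
have [cdD|cdD] := boolP (c - d \in roots D).
  by rewrite (N_br B cD ndD) // brZr N_br // scalerA mulrC.
by rewrite nonroot_br // (N_0 B cD ndD cdD (elimN eqP cd0)) br0r mulr0 scale0r.
Qed.

(** For each d, X_(-d) is raised to a multiple of X_(mu+eps-d), and X_d is lowered to a multiple of
    its opposite; each chain supplies two of the four N's. *)
Lemma trace4_Cconst : trace4 (X B mu) (X B eps) = Cconst B q mu eps.
Proof.
rewrite /trace4 /Cconst /rootsV_at [RHS]big_filter [RHS]big_mkcond /=.
apply: eq_big_seq => d.
rewrite mem_Z => /andP[dD /eqP d2]; have ndD := opp_root dD.
have ed0 : eps - d != 0.
  apply: contraTneq (@oner_neq0 R[i]) => /(congr1 (level q)).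
  rewrite levelD levelN eps1 d2 level0 => /eqP.
  by rewrite subr_eq0 -[1]/(1%:R) eqr_nat.
have [nD|nD] := ifP; last first.
  rewrite (@weight_vector_eq0 _ _ D (nu - d) (br (X B mu) _)) ?br0r ?killing0r ?nD //.
    by rewrite subr_eq0; apply: contraNneq sumND => ->.
  rewrite -addrA; apply: weight_vector_br (X_weight muD) _.
  exact: weight_vector_br (X_weight epsD) (X_weight ndD).
rewrite -addrA in nD.
rewrite -killing_br2 br_scale2 //.
have E : br (X B (- mu)) (br (X B (- eps)) (X B d))
    = (N B (- mu) (d - eps) * N B (- eps) d) *: X B (- (mu + (eps - d))).
  rewrite -[in X B d](opprK d) br_scale2 ?opp_root //.
  - by rewrite opprK [- eps + d]addrC -opprB -opprD.
  - by rewrite -opprD oppr_eq0.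
  by rewrite -opprD -opprD opp_root.
rewrite E killingZl killingZr killingC X_killing // mulr1.
by ring.
Qed.

Lemma pol_mu_eps : pol mu eps = Cconst B q mu eps / 2.
Proof. by rewrite polE trace4_comm trace4_Cconst; field. Qed.

Lemma expand_Zbar w y : weight_vector w y -> level q w = - 2 ->
  y = \sum_(d <- Z) killing (X B d) y *: X B (- d).
Proof.
move=> wy w2; have [->|y0] := eqVneq y 0.
  by rewrite big1 // => d _; rewrite killing0r scale0r.
have w0 : w != 0.
  apply: contraTneq (@oner_neq0 R[i]) => w0; move: w2; rewrite w0 level0 => /eqP.
  by rewrite eq_sym oppr_eq0 pnatr_eq0.
have wD := mem_roots w0 wy y0; have nwD := opp_root wD.
have nwZ : - w \in Z by rewrite mem_Z nwD levelN w2 opprK eqxx.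
rewrite (bigD1_seq (- w)) ?filter_uniq ?roots_uniq //= opprK killingC.
rewrite -root_space_line // big_seq_cond big1 ?addr0 // => d /andP[].
rewrite mem_Z => /andP[dD _] dw; rewrite (killing_root (X_weight dD) wy) ?scale0r //.
by rewrite addr_eq0.
Qed.

Lemma expand_Z w y : weight_vector w y -> level q w = 2 ->
  y = \sum_(d <- Z) killing y (X B (- d)) *: X B d.
Proof.
move=> wy w2; have [->|y0] := eqVneq y 0.
  by rewrite big1 // => d _; rewrite killing0l scale0r.
have w0 : w != 0.
  apply: contraTneq (@oner_neq0 R[i]) => w0; move: w2; rewrite w0 level0 => /eqP.
  by rewrite eq_sym pnatr_eq0.
have wD := mem_roots w0 wy y0.
have wZ : w \in Z by rewrite mem_Z wD w2 eqxx.
rewrite (bigD1_seq w) ?filter_uniq ?roots_uniq //=.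
rewrite -root_space_line // big_seq_cond big1 ?addr0 // => d /andP[].
rewrite mem_Z => /andP[dD _] dw; rewrite (killing_root wy (XN_weight dD)) ?scale0r //.
by rewrite subr_eq0 eq_sym.
Qed.

(* Both sides are the trace of F composed with ad X_b on the span of the
   X_{- d}, d in Z, which ad X_b preserves. *)
Lemma trace_comm b (F : 'End(g)) : b \in roots D -> level q b = 0 ->
  \sum_(d <- Z) killing (X B d) (br (X B b) (F (X B (- d))))
  = \sum_(d <- Z) killing (X B d) (F (br (X B b) (X B (- d)))).
Proof.
move=> bD b0.
have E1 d : d \in Z -> killing (X B d) (br (X B b) (F (X B (- d)))) =
    \sum_(e <- Z) killing (X B d) (br (X B b) (X B (- e))) * killing (X B e) (F (X B (- d))).
  rewrite mem_Z => /andP[dD /eqP d2].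
  rewrite -killing_br brC killingNl (expand_Z (weight_vector_br (X_weight bD) (X_weight dD))).
    rewrite killing_suml -sumrN; apply: eq_bigr => e _; rewrite killingZl -mulNr -killingNl -brC.
    by rewrite killing_br.
  by rewrite levelD b0 d2 add0r.
have E2 d : d \in Z -> killing (X B d) (F (br (X B b) (X B (- d)))) =
    \sum_(e <- Z) killing (X B e) (br (X B b) (X B (- d))) * killing (X B d) (F (X B (- e))).
  rewrite mem_Z => /andP[dD /eqP d2].
  rewrite {1}(expand_Zbar (weight_vector_br (X_weight bD) (XN_weight dD))).
    by rewrite linear_sum killing_sumr; apply: eq_bigr => e _; rewrite linearZ killingZr.
  by rewrite levelD levelN b0 d2 add0r.
rewrite (eq_big_seq _ E1) (eq_big_seq _ E2) exchange_big.
by apply: eq_bigr => d _; apply: eq_bigr => e _.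
Qed.

Section Invariance.
Variables (b : h').
Hypotheses (bD : b \in roots D) (b0 : level q b = 0).
Hypothesis b_mu : br (X B b) (X B (- mu)) = 0.
Hypothesis b_eps : forall d, d \in Z ->
  br (X B (- mu)) (br (br (X B b) (X B (- eps))) (X B d)) = 0.

(** The trace of the commutator of ad X_b with the fourfold product is 0. Of its four Leibniz terms,
    the one at X_(-mu) vanishes by [b_mu]. The one at X_(-eps) vanishes after passing to the
    adjoint, by [b_eps], which is weaker than [X_b, X_(-eps)] = 0. *)
Lemma trace4_invariant x y :
  trace4 (br (X B b) x) y + trace4 x (br (X B b) y) = 0.
Proof.
pose F := (ad (X B (- eps)) \o (ad (X B (- mu)) \o (ad x \o ad y)))%VF.
have FE v : F v = br (X B (- eps)) (br (X B (- mu)) (br x (br y v))).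
  by rewrite !comp_lfunE !adE.
move/eqP: (trace_comm F bD b0); rewrite -subr_eq0 -sumrB => /eqP <-.
rewrite -big_split /=; apply: eq_big_seq => d dZ.
set v := X B (- d); set z := X B b; set e := X B (- eps); set m := X B (- mu).
have -> : br z (F v) = br (br z e) (br m (br x (br y v)))
    + (br e (br m (br (br z x) (br y v))) + br e (br m (br x (br (br z y) v))) + F (br z v)).
  rewrite !FE (br_derivation z e) (br_derivation z m) b_mu br0l add0r.
  by rewrite (br_derivation z x) (br_derivation z y) !brDr !addrA.
by rewrite !killingDr -(killing_br2 m (br z e)) [br m (br (br z e) _)](b_eps dZ) killing0l add0r addrK.
Qed.

End Invariance.

Definition bracket_sum : g := \sum_(a <- L1) \sum_(c <- L1)
  pol a c *: br (X B (- c)) (br (X B (- a)) (X B mu)).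

Local Notation at_nu := (rootsV_at nu (grading q 1)).

Lemma mem_at_nu a :
  (a \in at_nu) = [&& a \in roots D, level q a == 1 & nu - a \in roots D].
Proof. by rewrite mem_filter mem_L1 andbC -andbA. Qed.

Lemma level_nuB a : level q a = 1 -> level q (nu - a) = 1.
Proof. by move=> a1; rewrite !levelD levelN mu1 eps1 a1 addrK. Qed.

Lemma at_nuC a : a \in at_nu -> nu - a \in at_nu.
Proof.
rewrite !mem_at_nu => /and3P[aD /eqP a1 cD].
by rewrite cD level_nuB // subKr aD eqxx.
Qed.

(** The weight condition forces c = mu + eps - a, so the sum runs over the set whose size enters
    s_2. *)
Lemma bracket_sum_at : bracket_sum = \sum_(a <- at_nu)
  pol a (nu - a) *: br (X B (- (nu - a))) (br (X B (- a)) (X B mu)).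
Proof.
rewrite /bracket_sum /rootsV_at [RHS]big_filter [RHS]big_mkcond /=.
apply: eq_big_seq => a; rewrite mem_L1 => /andP[aD /eqP a1].
have [cD|cD] := ifP.
  have cL : nu - a \in L1 by rewrite mem_L1 cD level_nuB // eqxx.
  rewrite (bigD1_seq (nu - a)) ?filter_uniq ?roots_uniq //= big_seq_cond big1 ?addr0 // => c.
  rewrite mem_L1 => /andP[/andP[eD _] ec]; rewrite pol_weight0 ?scale0r //.
  by apply: contraNneq ec => <-; rewrite [X in _ == X]addrC addKr.
rewrite big_seq big1 // => c; rewrite mem_L1 => /andP[eD _].
rewrite pol_weight0 ?scale0r //; apply: contraFneq cD => <-.
by rewrite addrC addKr.
Qed.

Lemma br_opp_self a : a \in roots D -> br (X B (- a)) (X B a) = - vsval (Hc B a).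
Proof. by move=> aD; rewrite brC X_opp. Qed.

Lemma br_Hc a c : a \in roots D -> c \in roots D ->
  br (X B (- c)) (br (X B (- a)) (X B a)) = - ip a c *: X B (- c).
Proof.
move=> aD cD; rewrite br_opp_self // brNr brC opprK (weight_vectorE _ (XN_weight cD)).
by rewrite opp_lfunE ipC ipE sharp_root.
Qed.

Hypothesis mu_norm_max : forall a, a \in roots D -> level q a = 1 -> rip a a <= rip mu mu.

Lemma at_nu_bound a c : a \in at_nu -> c \in roots D -> level q c = 1 ->
  a != c -> 2 * rip a c <= rip mu mu.
Proof.
rewrite mem_at_nu => /and3P[aD /eqP a1 _] cD c1 ac.
by apply: root_bound => //; exact: mu_norm_max.
Qed.

(** Only a = mu occurs: another a would give 2<a, mu> <= |mu|^2 and 2<2mu - a, mu> <= |mu|^2, whose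
    sum is 4|mu|^2 <= 2|mu|^2. *)
Lemma bracket_sum_type2 : eps = mu ->
  bracket_sum = - (ip mu mu / 2 * Cconst B q mu mu) *: X B (- mu).
Proof.
move=> em; have L0 := rip_gt0 muD; rewrite bracket_sum_at.
have muA : mu \in at_nu by rewrite mem_at_nu muD mu1 eqxx addrC addKr epsD.
rewrite (bigD1_seq mu) ?filter_uniq ?roots_uniq //= big_seq_cond big1 => [|a /andP[aA amu]].
  rewrite addr0 [nu - mu]addrC addKr pol_mu_eps em br_Hc // scalerA; congr (_ *: _).
  by field.
exfalso; have cA := at_nuC aA; have := aA; rewrite mem_at_nu => /and3P[aD _ _].
have cmu : nu - a != mu by rewrite subr_eq em (inj_eq (addrI _)) eq_sym.
have := at_nu_bound aA muD mu1 amu; have := at_nu_bound cA muD mu1 cmu.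
by rewrite ripDl ripDl ripNl em => H1 H2; clear em; lra.
Qed.

(** * Type 1a: mu and eps long and distinct *)

Section LongRoots.
Hypotheses (mu_long : long mu) (eps_long : long eps) (eps_mu : eps != mu).
Local Notation L := (rip mu mu).

Lemma long_le c : c \in roots D -> rip c c <= L.
Proof. by move=> cD; have := mu_long cD; rewrite !ripE // lecR. Qed.

Lemma long_norm_eps : rip eps eps = L.
Proof.
apply/eqP; rewrite eq_le long_le //=.
by have := eps_long muD; rewrite !ripE // lecR.
Qed.

Lemma long_bound a c : a \in roots D -> c \in roots D -> a != c -> 2 * rip a c <= L.
Proof. by move=> aD cD ac; apply: root_bound => //; exact: long_le. Qed.

Lemma level_neq a c : level q a != level q c -> a != c.
Proof. by apply: contraNneq => ->. Qed.

(** The Cartan integer of two distinct roots of maximal length is at most 1, and it is not negative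
    because mu + eps is not a root. *)
Lemma rip_mu_eps : rip mu eps = 0 \/ 2 * rip mu eps = L.
Proof.
have L0 := rip_gt0 muD; have [n En] := rip_int muD epsD; rewrite ripC in En.
have n1 : n <= 1.
  have := long_bound muD epsD; rewrite eq_sym => /(_ eps_mu).
  by rewrite En -[X in _ <= X]mul1r ler_pM2r // -[1]/(1%:~R) ler_int.
have n0 : 0 <= n.
  rewrite leNgt; apply/negP => n0.
  have lt0 : rip mu eps < 0.
    have : 2 * rip mu eps < 0 by rewrite En pmulr_llt0 // ltrz0.
    by rewrite pmulr_rlt0.
  have := add_root epsD muD lt0; rewrite inE (negPf sumND) orbF.
  by rewrite (negPf sum_neq0).
have [n_0|n_1] : n = 0 \/ n = 1 by lia.
  by left; move: En; rewrite n_0 mul0r => /eqP; rewrite mulf_eq0 pnatr_eq0 => /eqP.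
by right; rewrite En n_1 mul1r.
Qed.

(** Here |mu + eps|^2 = 3L. If mu + eps = d + e with roots d, e of levels 2 and 0, then each of mu,
    eps has product at most L/2 with each of d, e, so |mu + eps|^2 <= 2L. *)
Lemma long_no_Z : 2 * rip mu eps = L -> forall d, d \in Z -> nu - d \notin roots D.
Proof.
move=> E d; rewrite mem_Z => /andP[dD /eqP d2]; apply/negP => eD.
have L0 := rip_gt0 muD; have Le := long_norm_eps.
have lev12 : 1 != 2 :> R[i] by rewrite -[1]/(1%:R) eqr_nat.
have lev10 : 1 != 0 :> R[i] by rewrite oner_neq0.
have e0 : level q (nu - d) = 0 by rewrite !levelD levelN mu1 eps1 d2 subrr.
have H1 := long_bound muD dD (level_neq _); have H2 := long_bound epsD dD (level_neq _).
have H3 := long_bound muD eD (level_neq _); have H4 := long_bound epsD eD (level_neq _).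
rewrite mu1 d2 in H1; rewrite eps1 d2 in H2.
rewrite mu1 e0 in H3; rewrite eps1 e0 in H4.
move: (H1 lev12) (H2 lev12) (H3 lev10) (H4 lev10).
rewrite !ripDr !ripNr (ripC eps mu) => {}H1 {}H2 {}H3 {}H4.
by lra.
Qed.

Lemma trace4_eq0 : (forall d, d \in Z -> nu - d \notin roots D) ->
  forall x y, trace4 x y = 0.
Proof.
move=> noZ x y; rewrite /trace4 big_seq big1 // => d dZ.
have := dZ; rewrite mem_Z => /andP[dD _].
rewrite -killing_br2; have w1 := weight_vector_br (XN_weight epsD) (X_weight dD).
have w2 := weight_vector_br (XN_weight muD) w1.
rewrite (weight_vector_eq0 _ _ w2) ?killing0l //.
  rewrite addrA -opprD addrC subr_eq0; apply: contraNneq sumND => <-.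
  exact: dD.
rewrite addrA -opprD addrC; apply: contra (noZ d dZ) => /opp_root.
by rewrite opprB.
Qed.

Section OrthogonalCase.
Hypothesis orth : rip mu eps = 0.
(** b is a root of l ([orth_facts]) with a = mu - b and c = eps + b. So ad X_(-b) carries X_mu
    towards X_a and X_c towards X_eps, linking the coefficient at (a, c) to the one at (mu, eps). *)
Variables a b c : h'.
Hypotheses (aA : a \in at_nu) (a_mu : a != mu) (a_eps : a != eps).
Hypotheses (acE : a + c == nu) (abE : a + b == mu).

Lemma orth_c : c = nu - a. Proof. by rewrite -(eqP acE) [RHS]addrC addKr. Qed.
Lemma orth_b : b = mu - a. Proof. by rewrite -(eqP abE) [RHS]addrC addKr. Qed.
Lemma orth_ceb : c = eps + b.
Proof. by rewrite orth_c orth_b addrA [eps + mu]addrC. Qed.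

Lemma orth_levels : [/\ a \in roots D, c \in roots D, level q a = 1, level q c = 1
  & level q b = 0].
Proof.
have := aA; rewrite mem_at_nu => /and3P[aD /eqP a1 cD].
rewrite orth_c cD level_nuB // orth_b; split=> //.
by rewrite levelD levelN mu1 a1 subrr.
Qed.

(** Each product is at most L/2, while <a, mu> + <c, mu> = L and <a, eps> + <c, eps> = L; so all
    four equal L/2. *)
Lemma orth_rip : [/\ 2 * rip a mu = L, 2 * rip a eps = L, 2 * rip c mu = L & 2 * rip c eps = L].
Proof.
have [aD cD a1 c1 _] := orth_levels.
have c_mu : c != mu.
  by apply: contraNneq a_eps => ce; rewrite -(inj_eq (addIr c)) (eqP acE) ce addrC.
have c_eps : c != eps.
  by apply: contraNneq a_mu => ce; rewrite -(inj_eq (addIr c)) (eqP acE) ce.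
have := long_bound aD muD a_mu; have := long_bound aD epsD a_eps.
have := long_bound cD muD c_mu; have := long_bound cD epsD c_eps.
have Em : rip a mu + rip c mu = L by rewrite -ripDl (eqP acE) ripDl ripC orth addr0.
have Ee : rip a eps + rip c eps = L by rewrite -ripDl (eqP acE) ripDl orth add0r long_norm_eps.
move: Em Ee; move: (rip a mu) (rip c mu) (rip a eps) (rip c eps) => x y z t.
clear a1 c1 mu1 eps1 orth.
by move=> Em Ee H1 H2 H3 H4; split; lra.
Qed.

Lemma orth_facts : [/\ b \in roots D, rip c c = rip a a, rip b b = rip a a
  & 2 * rip c b = 2 * rip a a - L].
Proof.
have [aD cD _ _ _] := orth_levels; have [E1 E2 E3 E4] := orth_rip.
have L0 := rip_gt0 muD.
have bD : b \in roots D.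
  have pos : 0 < rip mu a by rewrite ripC -(pmulr_rgt0 _ (ltr0Sn R 1)) E1.
  have := sub_root aD muD pos.
  by rewrite inE subr_eq0 eq_sym (negPf a_mu) /= -orth_b.
have Ec w : rip c w = rip mu w + rip eps w - rip a w.
  by rewrite orth_c ripDl ripDl ripNl.
have Eb w : rip w b = rip mu w - rip a w.
  by rewrite orth_b ripC ripDl ripNl.
have Ecc : rip c c = rip c mu + rip c eps - rip a c by rewrite Ec (ripC mu) (ripC eps).
have Eca : rip a c = rip a mu + rip a eps - rip a a.
  by rewrite ripC Ec (ripC mu) (ripC eps).
have Ebb : rip b b = L - rip a mu - (rip a mu - rip a a).
  by rewrite !Eb (ripC mu a).
have Ecb : rip c b = rip c mu - rip a c by rewrite Eb ripC.
split=> //.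
- rewrite Ecc Eca; move: E1 E2 E3 E4; move: (rip a mu) (rip c mu) (rip a eps) (rip c eps) (rip a a).
  clear Ec Eb Ecc Eca Ebb Ecb orth mu1 eps1 => x y z t u *.
  by lra.
- rewrite Ebb; move: E1; move: (rip a mu) (rip a a).
  clear Ec Eb Ecc Eca Ebb Ecb E2 E3 E4 orth mu1 eps1 => x u *.
  by lra.
rewrite Ecb Eca; move: E1 E2 E3; move: (rip a mu) (rip c mu) (rip a eps) (rip a a).
clear Ec Eb Ecc Eca Ebb Ecb E4 orth mu1 eps1 => x y z u *.
by lra.
Qed.

(** The brackets pass through X_b to X_(-eps). The cyclic rule for -a + mu - b = 0 rewrites the
    inner constant as the N that multiplies [pol a c] in [orth_pol]; the two antisymmetry signs
    cancel. *)
Lemma orth_bracket : br (X B (- c)) (br (X B (- a)) (X B mu))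
  = (N B (- b) mu * N B b (- c)) *: X B (- eps).
Proof.
have [aD cD a1 c1 _] := orth_levels; have [bD _ _ _] := orth_facts.
have nb := opp_root bD; have na := opp_root aD; have nc := opp_root cD.
have ab : - a + mu = b by rewrite -(eqP abE) addKr.
have cb : - c + b = - eps by rewrite orth_ceb opprD addrNK.
have abD : - a + mu \in roots D by rewrite ab.
have cbD : - c + b \in roots D by rewrite cb opp_root.
rewrite N_br // brZr ab N_br // scalerA cb; congr (_ *: _).
rewrite (@N_anti (- c) b) // mulrN -mulNr; congr (_ * _).
have sum0 : - a + mu + - b = 0 by rewrite ab subrr.
have [-> _] := N_cyclic B na muD nb sum0.
have mbD : mu + - b \in roots D by rewrite -(eqP abE) addrK.
by rewrite (N_anti muD nb mbD) opprK.
Qed.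

(** b + mu would be a root with squared length |b|^2 + 2L > L. *)
Lemma orth_b_mu : br (X B (- b)) (X B (- mu)) = 0.
Proof.
have [aD cD a1 c1 b0] := orth_levels; have [E1 _ _ _] := orth_rip.
have [bD _ Nb _] := orth_facts.
have lev : level q (- b - mu) = - 1 by rewrite levelD !levelN b0 mu1 oppr0 add0r.
apply: nonroot_br; rewrite ?opp_root //.
  apply: contraTneq (@oner_neq0 R[i]) => s0; move: lev; rewrite s0 level0 => /eqP.
  by rewrite eq_sym oppr_eq0 => /eqP ->; rewrite eqxx.
rewrite -opprD; apply/negP => /opp_root; rewrite opprK => /long_le.
have bp := rip_gt0 bD; have L0 := rip_gt0 muD.
have Eb : rip b mu = L - rip a mu by rewrite orth_b ripDl ripNl.
rewrite rip_sq Eb leNgt => /negP; apply; rewrite -subr_gt0.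
have -> : rip b b + 2 * (L - rip a mu) + L - L = rip b b + (2 * L - 2 * rip a mu) by ring.
by rewrite E1 addr_gt0 // mulr_natl mulr2n addrK.
Qed.

(** Here |mu + c|^2 = 2L + |c|^2. So d = mu + c is too long for a root; and if mu + c - d were a
    root, the four bounds on products of mu, c with d, mu + c - d would give |mu + c|^2 <= 2L. *)
Lemma orth_Z d : d \in Z -> br (X B (- mu)) (br (X B (- c)) (X B d)) = 0.
Proof.
rewrite mem_Z => /andP[dD /eqP d2].
have [aD cD a1 c1 _] := orth_levels; have [_ _ E3 _] := orth_rip.
have cp := rip_gt0 cD; have L0 := rip_gt0 muD.
have cm2 : rip (mu + c) (mu + c) = 2 * L + rip c c.
  by rewrite rip_sq (ripC mu c) E3 mulr_natl mulr2n.
have w2 := weight_vector_br (XN_weight muD) (weight_vector_br (XN_weight cD) (X_weight dD)).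
rewrite addrA -opprD addrC in w2.
have lev12 : 1 != 2 :> R[i] by rewrite -[1]/(1%:R) eqr_nat.
have lev10 : 1 != 0 :> R[i] by rewrite oner_neq0.
have e0 : level q (d - (mu + c)) = 0.
  by rewrite levelD levelN [level q (mu + c)]levelD mu1 c1 d2 subrr.
have md : 2 * rip mu d <= L by apply: long_bound; rewrite // level_neq // mu1 d2.
have cd : 2 * rip c d <= L by apply: long_bound; rewrite // level_neq // c1 d2.
have big : L < rip (mu + c) (mu + c).
  by rewrite cm2 mulr_natl mulr2n -addrA ltrDl addr_gt0.
apply/eqP; apply: contraT => z0; have := weight_nz w2 z0; rewrite inE.
case/predU1P=> [/eqP|eD].
  rewrite subr_eq0 => /eqP dE; have := long_le dD.
  by rewrite dE leNgt big.
have neD := opp_root eD; rewrite opprB in neD.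
have ne0 : level q (mu + c - d) = 0.
  by rewrite -opprB levelN e0 oppr0.
have me : 2 * rip mu (mu + c - d) <= L by apply: long_bound; rewrite // level_neq // mu1 ne0.
have ce : 2 * rip c (mu + c - d) <= L by apply: long_bound; rewrite // level_neq // c1 ne0.
have : 2 * rip (mu + c) (mu + c) <= 4 * L.
  have -> : 2 * rip (mu + c) (mu + c) = 2 * rip mu d + 2 * rip c d
      + (2 * rip mu (mu + c - d) + 2 * rip c (mu + c - d)).
    have -> : rip (mu + c) (mu + c) = rip (mu + c) (mu + c - d) + rip (mu + c) d.
      by rewrite -ripDr subrK.
    by rewrite !(ripDl mu c); ring.
  have -> : 4 * L = L + L + (L + L) by ring.
  by rewrite !lerD.
rewrite cm2 leNgt => /negP[]; rewrite mulrDr mulrA -natrM ltrDl.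
by rewrite mulr_gt0.
Qed.

(** Invariance under X_(-b), applied to (X_mu, X_c) and to (X_c, X_mu) and averaged. *)
Lemma orth_pol : pol a c * N B (- b) mu + N B (- b) c * pol mu eps = 0.
Proof.
have [aD cD a1 c1 b0] := orth_levels; have [bD _ _ _] := orth_facts.
have nb := opp_root bD.
have bm : - b + mu = a by rewrite -(eqP abE) addrC addrK.
have bc : - b + c = eps by rewrite orth_ceb addrC addrK.
have b_e : - b - eps = - c by rewrite orth_ceb opprD addrC.
have bmD : - b + mu \in roots D by rewrite bm.
have bcD : - b + c \in roots D by rewrite bc.
have beD : - b + - eps \in roots D by rewrite b_e opp_root.
have lb : level q (- b) = 0 by rewrite levelN b0 oppr0.
have zz d : d \in Z ->
    br (X B (- mu)) (br (br (X B (- b)) (X B (- eps))) (X B d)) = 0.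
  move=> dZ; rewrite (N_br B nb (opp_root epsD) beD) b_e brZl brZr.
  by rewrite orth_Z // scaler0.
have inv := trace4_invariant nb lb orth_b_mu zz.
have := inv (X B mu) (X B c); have := inv (X B c) (X B mu).
rewrite !N_br // bm bc !(trace4Zl, trace4Zr) => I1 I2.
rewrite !polE mulrDr mulrDl mulrDr mulrDr.
apply: etrans (_ : 4^-1 * 0 + 4^-1 * 0 = 0); last by rewrite mulr0 addr0.
by rewrite -{1}I2 -I1; ring.
Qed.

(** One has 2<a, c> = 2L - 2|a|^2. If a = c, this is 2|a|^2 = L. If not, a and c have equal length,
    so 2<a, c> <= |a|^2 and L <= 3|a|^2 / 2; as L is an integer multiple of |a|^2, they are
    equal. *)
Lemma orth_cases : rip a a = L \/ (a = c /\ 2 * rip a a = L).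
Proof.
have [aD cD _ _ _] := orth_levels; have [E1 E2 _ _] := orth_rip.
have [bD N1 _ _] := orth_facts; have ap := rip_gt0 aD.
have ac_e : 2 * rip a c = 2 * L - 2 * rip a a.
  rewrite orth_c ripDr ripDr ripNr mulrBr mulrDr E1 E2; congr (_ - _).
  by rewrite mulr_natl mulr2n.
have [ac|ac] := eqVneq a c.
  right; split=> //; move: ac_e; rewrite -ac => /eqP; rewrite eq_sym subr_eq.
  by rewrite -mulrDr (inj_eq (mulfI _)) ?pnatr_eq0 // mulr_natl mulr2n => /eqP ->.
left; have := root_bound aD cD ac (lexx _); rewrite N1 => /(_ (lexx _)).
have [n En] := rip_int aD muD; rewrite (ripC mu) E1 in En.
rewrite ac_e => le; suff n1 : n = 1 by rewrite En n1 mul1r.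
have n_gt : (0 : R) < n%:~R by rewrite -(pmulr_lgt0 _ ap) -En rip_gt0.
have n_lt : (n%:~R : R) < 2.
  rewrite -(ltr_pM2r ap) -En; move: le ap; move: (rip a a) L.
  clear ac_e En E1 E2 N1 orth mu1 eps1 n_gt => x y le ap.
  by lra.
rewrite ltr0z in n_gt; rewrite -[2]/(2%:~R) ltr_int in n_lt.
by move: n_gt n_lt; clear; lia.
Qed.

(** The product formula for the b-string through -c. Always q = 1; either p = 0 and |b|^2 = L, or a
    = c, p = 1 and |b|^2 = L/2. In both cases q(1 + p)|b|^2 = L. *)
Lemma orth_strings : N B b (- c) * N B (- b) c = - (ip mu mu / 2).
Proof.
have [aD cD a1 c1 b0] := orth_levels.
have [bD N1 N2 N3] := orth_facts.
have nc := opp_root cD; have L0 := rip_gt0 muD; have ap := rip_gt0 aD.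
have cb : b + - c = - eps by rewrite orth_ceb opprD addrCA subrr addr0.
have cbD : b + - c \in roots D by rewrite cb opp_root.
have cases := orth_cases.
(* The left side bounds twice the squared length of -c + jb and -c - jb from below; for j >= 2 it
   exceeds 2L, so these are too long to be roots. *)
have far (j : nat) w : (w == - c + b *+ j) || (w == - c - b *+ j) -> w \in roots D ->
    2 * rip a a - 2 * j%:R * `|2 * rip a a - L| + 2 * j%:R ^+ 2 * rip a a <= 2 * L.
  move=> wE wD; have := long_le wD; rewrite -(ler_pM2l (ltr0Sn R 1)) => /(le_trans _); apply.
  case/orP: wE => /eqP ->; last rewrite -mulNrn; rewrite rip_line.
    rewrite ripNl ripNr ripNl opprK N1 N2.
    have -> : 2 * (rip a a + 2 * j%:R * - rip c b + j%:R ^+ 2 * rip a a)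
      = 2 * rip a a - 2 * j%:R * (2 * rip c b) + 2 * j%:R ^+ 2 * rip a a by ring.
    rewrite N3 lerD2r lerD2l lerN2 ler_wpM2l ?mulr_ge0 ?ler0n //; exact: ler_norm.
  rewrite !(ripNl, ripNr) !opprK N1 N2.
  have -> : 2 * (rip a a + 2 * j%:R * rip c b + j%:R ^+ 2 * rip a a)
      = 2 * rip a a - 2 * j%:R * - (2 * rip c b) + 2 * j%:R ^+ 2 * rip a a by ring.
  rewrite N3 lerD2r lerD2l lerN2 ler_wpM2l ?mulr_ge0 ?ler0n // -normrN; exact: ler_norm.
have far2 (j : nat) : (2 <= j)%N ->
    2 * L < 2 * rip a a - 2 * j%:R * `|2 * rip a a - L| + 2 * j%:R ^+ 2 * rip a a.
  move=> j2; have {j2} : (2 : R) <= j%:R by rewrite ler_nat.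
  case: cases => [->|[_ <-]]; move: (j%:R : R).
    have -> : 2 * L - L = L by ring.
    rewrite gtr0_norm //; move: L L0.
    clear far N1 N2 N3 ap orth mu1 eps1 a1 c1 b0 => x x0 t t2.
    have t1 : 0 < t * (t - 1) by rewrite mulr_gt0 //; lra.
    by have := mulr_gt0 t1 x0; lra.
  rewrite subrr normr0; move: (rip a a) ap.
  clear far N1 N2 N3 orth mu1 eps1 a1 c1 b0 L0 => x x0 t t2.
  have t1 : 0 < (t - 1) * (t + 1) by rewrite mulr_gt0 //; lra.
  by have := mulr_gt0 t1 x0; lra.
have lq : largest (fun j => - c + b *+ j \in roots D) 1.
  split=> [|j jD]; first by rewrite mulr1n addrC.
  rewrite leqNgt; apply/negP => /far2; rewrite ltNge => /negP; apply.
  by apply: (far j) jD; rewrite eqxx.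
have [p [lp Ep]] : exists p, largest (fun j => - c - b *+ j \in roots D) p /\
    (1 * (1 + p))%N%:R * rip a a = L.
  case: (cases) => [E|[ac E]].
    exists 0%N; split; last by rewrite mul1r.
    split=> [|[//|j] jD]; first by rewrite mulr0n subr0.
    exfalso; move: (jD) => /long_le; rewrite -mulNrn rip_line.
    rewrite !(ripNl, ripNr) !opprK N1 N2 leNgt => /negP; apply.
    rewrite E -addrA ltrDl; apply: addr_gt0.
      by rewrite -mulrA mulrCA N3 E mulr_gt0 ?ltr0Sn // mulr_natl mulr2n addrK.
    by rewrite mulr_gt0 ?exprn_gt0 ?ltr0Sn.
  exists 1%N; split; last by [].
  split=> [|j jD].
    by rewrite mulr1n -ac -opprD (eqP abE) opp_root.
  rewrite leqNgt; apply/negP => /far2; rewrite ltNge => /negP; apply.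
  by apply: (far j) jD; rewrite eqxx orbT.
have := N_opp B bD nc cbD lp lq; rewrite opprK => ->.
congr (- _); rewrite mulrAC; congr (_ / _).
rewrite (ripE bD bD) (ripE muD muD) N2 -Ep rmorphM /=; congr (_ * _).
by rewrite rmorph_nat.
Qed.

(** [orth_pol] trades [pol a c] for C/2 at the price of the product of N's in [orth_strings]:
    (L/2)(C/2) = LC/4, whatever a is. *)
Lemma orth_term : pol a c *: br (X B (- c)) (br (X B (- a)) (X B mu))
  = (ip mu mu / 4 * Cconst B q mu eps) *: X B (- eps).
Proof.
rewrite orth_bracket scalerA; congr (_ *: _).
have := orth_pol => /eqP; rewrite addr_eq0 => /eqP E.
rewrite mulrA E mulrC mulrN mulrA orth_strings pol_mu_eps.
by field.
Qed.

End OrthogonalCase.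

(** The term a = mu is a multiple of <mu, eps> = 0, and at a = eps already [X_(-eps), X_mu] = 0. The
    others give (size - 2) LC/4 = (LC/2)(size/2 - 1). If mu and eps are not orthogonal, both sides
    are 0. *)
Lemma bracket_sum_type1 : bracket_sum
  = (ip mu mu / 2 * Cconst B q mu eps * ((size at_nu)%:R / 2 - 1)) *: X B (- eps).
Proof.
have pol0 : (forall x y, trace4 x y = 0) -> bracket_sum
    = (ip mu mu / 2 * Cconst B q mu eps * ((size at_nu)%:R / 2 - 1)) *: X B (- eps).
  move=> t0; rewrite -trace4_Cconst t0 mulr0 mul0r scale0r /bracket_sum.
  by rewrite big1 // => a _; rewrite big1 // => c _; rewrite polE !t0 addr0 mulr0 scale0r.
case: rip_mu_eps => [orth|E]; last by apply/pol0/trace4_eq0/long_no_Z.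
rewrite bracket_sum_at.
have muA : mu \in at_nu by rewrite mem_at_nu muD mu1 eqxx addrC addKr epsD.
have epsA : eps \in at_nu by rewrite mem_at_nu epsD eps1 eqxx addrK muD.
have uA : uniq at_nu by rewrite !filter_uniq ?roots_uniq.
pose s := [seq a <- at_nu | predC (pred2 mu eps) a].
have perm_s : perm_eq at_nu (mu :: eps :: s).
  have us : uniq s by rewrite filter_uniq.
  apply: uniq_perm => //=.
    by rewrite us inE negb_or eq_sym eps_mu /s (mem_filter _ mu) (mem_filter _ eps) /= !eqxx ?orbT.
  move=> a; rewrite !inE /s (mem_filter _ _ at_nu) /=.
  have [->|_] := eqVneq a mu; first by rewrite muA.
  by have [->|_] := eqVneq a eps; first by rewrite epsA.
have oE : ip mu eps = 0 by rewrite ripE // orth rmorph0.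
have T1 : pol mu (nu - mu) *: br (X B (- (nu - mu))) (br (X B (- mu)) (X B mu)) = 0.
  have -> : nu - mu = eps by rewrite addrC addKr.
  by rewrite br_Hc // oE oppr0 scale0r scaler0.
have T2 : pol eps (nu - eps) *: br (X B (- (nu - eps))) (br (X B (- eps)) (X B mu)) = 0.
  have sD' : eps + mu \notin roots D by rewrite addrC.
  have s0' : eps + mu != 0 by rewrite addrC sum_neq0.
  by rewrite (br_opp_orth epsD muD orth (nonroot_br epsD muD s0' sD')) br0r scaler0.
have bigE (F : h' -> g) : \sum_(d <- at_nu) F d = F mu + (F eps + \sum_(d <- s) F d).
  by rewrite (perm_big _ perm_s) !big_cons.
have T3 : \sum_(d <- s) pol d (nu - d) *: br (X B (- (nu - d))) (br (X B (- d)) (X B mu))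
    = \sum_(d <- s) (ip mu mu / 4 * Cconst B q mu eps) *: X B (- eps).
  apply: eq_big_seq => d; rewrite /s (mem_filter _ d) /= negb_or => /andP[/andP[dm de] dA].
  have E1 : d + (nu - d) == nu by rewrite addrC subrK.
  have E2 : d + (mu - d) == mu by rewrite addrC subrK.
  exact: (@orth_term orth d (mu - d) (nu - d) dA dm de E1 E2).
rewrite bigE; apply: etrans (congr2 +%R T1 (congr2 +%R T2 T3)) _.
rewrite !add0r big_const_seq count_predT iter_addr_0 -scaler_nat scalerA.
congr (_ *: _); have -> : size at_nu = (size s + 2)%N by rewrite (perm_size perm_s) addn2.
by rewrite natrD; field.
Qed.


End LongRoots.
End QuadraticForm.

(** * The group Nbar_0 and its line sections *)

Section NilradicalGroup.
Local Notation h := (hh D).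
Local Notation h' := (hdual (hh D)).
Implicit Types (a c w : h') (H : subvs_of h) (x y v z : g).
Variables (q : 'I_(rk D)).

Lemma nbar_ind (P : g -> Prop) : P 0 -> (forall x y, P x -> P y -> P (x + y)) ->
  (forall a k, a \in roots D -> level q a = - 1 \/ level q a = - 2 -> P (k *: X B a)) ->
  forall x, x \in nbar q -> P x.
Proof.
move=> P0 PD PX.
have grad (m : int) : m = - 1 \/ m = - 2 -> forall x, x \in grading q m -> P x.
  move=> m12 x xg.
  have {xg} : x \in (\sum_(c <- roots D | coord (base D) q c == m%:~R) root_space c)%VS.
    by move: xg; rewrite /grading; case: m12 => ->; rewrite /= add0v.
  move=> /(memv_seq_sumP (roots_uniq D))[F [FU FP ->]].
  rewrite big_seq; elim/big_ind: _ => // c cD.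
  have [/eqP lc|/FP ->] := boolP (coord (base D) q c == m%:~R); last exact: P0.
  rewrite (root_space_line cD ((weight_vectorP _ _).2 (FU c cD))); apply: PX => //.
  by rewrite /level lc; case: m12 => ->; rewrite rmorphN; [left|right].
move=> x /memv_addP[x1 x1g [x2 x2g ->]].
by apply: PD; [apply: grad x1g; left|apply: grad x2g; right].
Qed.

Lemma g_proper : (0 < dim g)%N.
Proof.
rewrite -dimvf lt0n dimv_eq0; apply: contraNneq (X_neq0 (base_root q)) => V0.
by rewrite -memv0 -V0 memvf.
Qed.

Section TwoStep.
Hypothesis n_two_step : brV (nilrad q) (brV (nilrad q) (nilrad q)) = 0%VS.

(** A double bracket of root vectors is nonzero exactly when the partial sums are roots, a condition
    stable under negation; so nbar inherits the vanishing from n. *)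
Lemma nbar_triple x y z : x \in nbar q -> y \in nbar q -> z \in nbar q ->
  br x (br y z) = 0.
Proof.
have neg (r : R[i]) : r = - 1 \/ r = - 2 -> r < 0.
  by case=> ->; rewrite oppr_lt0 ?ltr01 ?ltr0n.
move=> xN; move: y z; elim/nbar_ind: x / xN => [y z _ _|x1 x2 IH1 IH2 y z yN zN|a k aD la y z yN].
- by rewrite br0l.
- by rewrite brDl IH1 // IH2 // addr0.
move: z; elim/nbar_ind: y / yN => [z _|y1 y2 IH1 IH2 z zN|c l cD lc z zN].
- by rewrite br0l br0r.
- by rewrite brDl brDr IH1 // IH2 // addr0.
elim/nbar_ind: z / zN => [|z1 z2 IH1 IH2|d m dD ld].
- by rewrite !br0r.
- by rewrite !brDr IH1 IH2 addr0.
rewrite !(brZl, brZr); set v := br (X B a) _.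
suff -> : v = 0 by rewrite !scaler0.
rewrite /v; have [la' lc' ld'] := And3 (neg _ la) (neg _ lc) (neg _ ld).
have levD e f : level q e < 0 -> level q f < 0 -> level q (e + f) < 0.
  by move=> le lf; rewrite levelD -oppr_gt0 opprD addr_gt0 ?oppr_gt0.
have lev_neq0 e : level q e < 0 -> e != 0.
  by apply: contraTneq => ->; rewrite level0 ltxx.
have cd0 := lev_neq0 _ (levD _ _ lc' ld').
have [cdD|cdD] := boolP (c + d \in roots D); last by rewrite (nonroot_br cD dD cd0 cdD) br0r.
rewrite (N_br B cD dD cdD) brZr.
have acd0 := lev_neq0 _ (levD _ _ la' (levD _ _ lc' ld')).
have [acdD|acdD] := boolP (a + (c + d) \in roots D); last first.
  by rewrite (nonroot_br aD cdD acd0 acdD) scaler0.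
exfalso.
have nX e : e \in roots D -> level q e < 0 -> X B (- e) \in nilrad q.
  by move=> eD le; apply: X_nilrad; rewrite ?opp_root // levelN oppr_gt0.
have := mem_brV (nX a aD la') (mem_brV (nX c cD lc') (nX d dD ld')).
have ncdD : - c + - d \in roots D by rewrite -opprD opp_root.
have nacdD : - a + (- c + - d) \in roots D by rewrite -opprD -opprD opp_root.
have [naD ncD ndD] := And3 (opp_root aD) (opp_root cD) (opp_root dD).
rewrite n_two_step memv0 (N_br B ncD ndD ncdD) brZr (N_br B naD ncdD nacdD).
by rewrite !scaler_eq0 (negPf (N_neq0 ncD ndD ncdD)) (negPf (N_neq0 naD ncdD nacdD))
  (negPf (X_neq0 nacdD)).
Qed.

End TwoStep.

Variable lam : h'.
Hypothesis lam_fund : fundamental_weight q lam.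

Definition grading_elt : subvs_of h := (2 / ip (base D)`_q (base D)`_q) *: sharp lam.

Lemma grading_eltE a : a grading_elt = level q a.
Proof.
rewrite /grading_elt linearZ /= -ipE ipC (ip_fund lam_fund).
have b0 := lt0r_neq0 (ip_root_gt0 (base_root q)).
rewrite -[_ *: _]/(2 / ip (base D)`_q (base D)`_q * _).
by move: (ip _ _) b0 (level q a) => t t0 l; field.
Qed.

Lemma br_grading_elt a k : a \in roots D ->
  br (vsval grading_elt) (k *: X B a) = level q a *: (k *: X B a).
Proof.
by move=> aD; rewrite (weight_vectorE _ (weight_vectorZ _ (X_weight aD))) grading_eltE.
Qed.

Lemma nbar_graded x : x \in nbar q -> exists x1 x2, [/\ x = x1 + x2,
  br (vsval grading_elt) x1 = - x1 & br (vsval grading_elt) x2 = - (x2 *+ 2)].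
Proof.
move=> xN; elim/nbar_ind: x / xN => [|x y [x1 [x2 [-> E1 E2]]] [y1 [y2 [-> F1 F2]]]|a k aD [la|la]].
- by exists 0, 0; rewrite br0r addr0 mul0rn oppr0.
- exists (x1 + y1), (x2 + y2); rewrite addrACA !brDr E1 E2 F1 F2; split=> //.
    by rewrite opprD.
  by rewrite mulrnDl [RHS]opprD.
- by exists (k *: X B a), 0; rewrite br0r addr0 mul0rn oppr0 br_grading_elt // la scaleN1r.
by exists 0, (k *: X B a); rewrite br0r add0r oppr0 br_grading_elt // la scaleNr scaler_nat.
Qed.

Definition ad_end_fun (e F : 'End(g)) : 'End(g) := ((e \o F) - (F \o e))%VF.

Lemma ad_end_linear e : linear (ad_end_fun e).
Proof.
move=> k F G; rewrite /ad_end_fun comp_lfunDr comp_lfunDl -comp_lfunZr -comp_lfunZl.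
by rewrite scalerBr opprD addrACA.
Qed.

(* Every product of m factors from x1, x2 is an eigenvector of the commutation
   with the grading element, for an eigenvalue - m' with m <= m'; such
   eigenvalues are finitely many. *)
Lemma ad_nbar_nilpotent x : x \in nbar q -> nil_index (ad x).
Proof.
move=> /nbar_graded[x1 [x2 [-> E1 E2]]].
pose e := ad (vsval grading_elt).
pose f := HB.pack (ad_end_fun e)
  (GRing.isLinear.Build _ _ _ _ (ad_end_fun e) (ad_end_linear e)) : {linear 'End(g) -> 'End(g)}.
have fE F : linfun f F = ((e \o F) - (F \o e))%VF by rewrite lfunE.
have [M finM] := eigen_nat_finite (linfun f).
pose T m (F : 'End(g)) := ((e \o F) - (F \o e) = - (F *+ m))%VF.
have T1 : T 1%N (ad x1) by rewrite /T -ad_br E1 adN mulr1n.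
have T2 : T 2%N (ad x2) by rewrite /T -ad_br E2 adN -[x2 *+ 2]scaler_nat adZ scaler_nat.
have TM m n F G : T m F -> T n G -> T (m + n)%N (F \o G)%VF.
  move=> TF TG; rewrite /T comp_lfunA -[(e \o F)%VF](subrK (F \o e)%VF) TF.
  rewrite comp_lfunDl -comp_lfunA -[(e \o G)%VF](subrK (G \o e)%VF) TG comp_lfunDr.
  rewrite comp_lfunA addrA addrK comp_lfunNl comp_lfunNr.
  rewrite -[F *+ m]scaler_nat -[G *+ n]scaler_nat -comp_lfunZl -comp_lfunZr.
  by rewrite !scaler_nat -opprD -mulrnDr.
pose Q k (F : 'End(g)) := exists s : seq 'End(g), F = \sum_(G <- s) G /\
  forall G, G \in s -> exists2 m, (k <= m)%N & T m G.
have Qpow k : Q k (endo_pow (ad (x1 + x2)) k).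
  elim: k => [|k [s [Fs sT]]].
    exists [:: \1%VF]; rewrite big_seq1; split=> // G; rewrite inE => /eqP ->.
    by exists 0%N; rewrite // /T comp_lfun1l comp_lfun1r subrr mulr0n oppr0.
  exists ([seq (ad x1 \o G)%VF | G <- s] ++ [seq (ad x2 \o G)%VF | G <- s]); split.
    have -> : endo_pow (ad (x1 + x2)) k.+1 = (ad (x1 + x2) \o endo_pow (ad (x1 + x2)) k)%VF by [].
    rewrite big_cat !big_map Fs adD comp_lfunDl.
    have dist (u : 'End(g)) : (u \o \sum_(G <- s) G = \sum_(G <- s) (u \o G))%VF.
      apply: (big_morph (fun G => (u \o G)%VF)) => [G1 G2|]; first exact: comp_lfunDr.
      exact: comp_lfun0r.
    by rewrite !dist.
  move=> G; rewrite mem_cat => /orP[] /mapP[G' /sT[m km TG] ->].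
    by exists (1 + m)%N; [rewrite add1n|exact: TM].
  by exists (2 + m)%N; [rewrite ltnW|exact: TM].
have QM F : Q M F -> F = 0.
  case=> s [-> sT]; rewrite big_seq big1 // => G /sT[m Mm TG].
  by apply: (finM m) => //; rewrite fE TG scaleNr scaler_nat.
move=> k dk; apply: (nilpotent_dim (QM _ (Qpow M))).
exact: ltnW.
Qed.

Hypothesis n_two_step : brV (nilrad q) (brV (nilrad q) (nilrad q)) = 0%VS.
Hypothesis nbar_br : forall x y, x \in nbar q -> y \in nbar q -> br x y \in nbar q.

(** The half bracket commutes with x and y by [nbar_triple], which is the hypothesis of
    [nilexp_mul]. *)
Lemma nilexp_nbar x y : x \in nbar q -> y \in nbar q ->
  (nilexp (ad x) \o nilexp (ad y))%VF = nilexp (ad (x + (y + 2^-1 *: br x y))).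
Proof.
move=> xN yN; have bN := nbar_br xN yN.
have zN : 2^-1 *: br x y \in nbar q by rewrite memvZ.
have xyN : x + y \in nbar q by rewrite memvD.
have comm u : u \in nbar q -> (ad u \o ad (2^-1 *: br x y) = ad (2^-1 *: br x y) \o ad u)%VF.
  move=> uN; apply/eqP; rewrite -subr_eq0 -ad_br brZr nbar_triple //.
  by rewrite scaler0 ad0.
rewrite addrA !adD; apply: (nilexp_mul g_proper).
- rewrite -ad_br -adD; congr ad; rewrite -scalerDl.
  by rewrite -[LHS]scale1r; congr (_ *: _); field.
- exact: comm.
- exact: comm.
- exact: ad_nbar_nilpotent.
- exact: ad_nbar_nilpotent.
- exact: ad_nbar_nilpotent.
- by rewrite -adD; exact: ad_nbar_nilpotent.
by rewrite -!adD; apply: ad_nbar_nilpotent; rewrite memvD.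
Qed.

Lemma nilexp_nbarN x : x \in nbar q -> (nilexp (ad x) \o nilexp (ad (- x)))%VF = \1%VF.
Proof.
move=> xN; rewrite nilexp_nbar ?memvN // brNr br_alternating oppr0 scaler0 addr0.
by rewrite subrr ad0 nilexp0.
Qed.

Lemma nilexp_nbar_inv x : x \in nbar q -> ((nilexp (ad x))^-1)%VF = nilexp (ad (- x)).
Proof.
move=> xN; have nxN : - x \in nbar q by rewrite memvN.
have E1 := nilexp_nbarN xN; have E2 := nilexp_nbarN nxN; rewrite opprK in E2.
have k0 : lker (nilexp (ad x)) == 0%VS.
  apply/lker0P => u v Euv; rewrite -[u]id_lfunE -[v]id_lfunE -E2 !comp_lfunE.
  by rewrite Euv.
rewrite -[LHS]comp_lfun1r -E1 comp_lfunA lker0_compVf // comp_lfun1l //.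
Qed.

End NilradicalGroup.

(** * Real and imaginary parts along the real forms *)

Section RealForm.
Variable q : 'I_(rk D).
Variables (g0 : set g) (g0_real : real_form fullv g0).
Hypothesis nbar_real : real_form (nbar q) (g0 `&` [set x | x \in nbar q])%classic.
Implicit Types (x y Y Z A : g).

Definition nbar0 x : Prop := g0 x /\ x \in nbar q.

Lemma nbar0_0 : nbar0 0.
Proof. by case: nbar_real. Qed.

Lemma nbar0_comb (r : R) x y : nbar0 x -> nbar0 y -> nbar0 (r%:C *: x + y).
Proof. by case: nbar_real => _ _ + _ _; apply. Qed.

Lemma nbar0Z (r : R) x : nbar0 x -> nbar0 (r%:C *: x).
Proof. by move=> x0; have := nbar0_comb r x0 nbar0_0; rewrite addr0. Qed.

Lemma nbar0D x y : nbar0 x -> nbar0 y -> nbar0 (x + y).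
Proof. by move=> x0 y0; have := nbar0_comb 1 x0 y0; rewrite scale1r. Qed.

Lemma nbar0_br x y : nbar0 x -> nbar0 y -> nbar0 (br x y).
Proof. by case: nbar_real => _ _ _ + _; apply. Qed.

Lemma nbar0_half_br x y : nbar0 x -> nbar0 y -> nbar0 (2^-1 *: br x y).
Proof.
move=> x0 y0; have -> : (2^-1 : R[i]) = (2^-1 : R)%:C by rewrite fmorphV rmorph_nat.
by apply: nbar0Z; exact: nbar0_br.
Qed.

Lemma nbar0_sum (I : Type) (r : seq I) (F : I -> g) : (forall i, nbar0 (F i)) ->
  nbar0 (\sum_(i <- r) F i).
Proof. by move=> F0; elim/big_ind: _ => //; [exact: nbar0_0|exact: nbar0D]. Qed.

Lemma g0_uniq A A' C C' : g0 A -> g0 A' -> g0 C -> g0 C' ->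
  A + 'i *: C = A' + 'i *: C' -> A = A' /\ C = C'.
Proof.
move=> gA gA' gC gC' E; case: g0_real => _ _ _ _ /(_ (A + 'i *: C) (memvf _)).
case=> p [_ uniq].
have E1 := uniq (A, C) (And3 gA gC erefl); have E2 := uniq (A', C') (And3 gA' gC' E).
by move: E1; rewrite E2 => -[-> ->].
Qed.

(** [re_part] and [im_part] are choices; uniqueness of the decomposition over the real form of g
    determines them. *)
Lemma part_uniq A C : g0 A -> g0 C ->
  re_part g0 (A + 'i *: C) = A /\ im_part g0 (A + 'i *: C) = C.
Proof.
move=> gA gC; split; apply: xget_unique.
- by split=> //; exists C.
- by move=> A' [gA' [C' gC' E]]; have [] := g0_uniq gA' gA gC' gC (esym E).
- by split=> //; exists A.
- by move=> C' [gC' [A' gA' E]]; have [] := g0_uniq gA' gA gC' gC (esym E).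
Qed.

Lemma nbar_parts Y : Y \in nbar q ->
  [/\ nbar0 (re_part g0 Y), nbar0 (im_part g0 Y) & Y = re_part g0 Y + 'i *: im_part g0 Y].
Proof.
move=> YN; case: nbar_real => _ _ _ _ /(_ Y YN)[[A C] [[/= A0 C0 E] _]].
by have [rE iE] := part_uniq A0.1 C0.1; rewrite E rE iE.
Qed.

(** The real form of nbar is closed under brackets, and its complex span is nbar. *)
Lemma nbar_br x y : x \in nbar q -> y \in nbar q -> br x y \in nbar q.
Proof.
move=> /nbar_parts[rx ix ->] /nbar_parts[ry iy ->].
have mem u v : nbar0 u -> nbar0 v -> br u v \in nbar q.
  by move=> u0 v0; case: (nbar0_br u0 v0).
by rewrite !(brDl, brDr, brZl, brZr) !(memvD, memvZ, mem).
Qed.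

Lemma parts_comb (a : R[i]) Y Z : Y \in nbar q -> Z \in nbar q ->
  re_part g0 (a *: Y + Z) = (complex.Re a)%:C *: re_part g0 Y
    + ((- complex.Im a)%:C *: im_part g0 Y + re_part g0 Z) /\
  im_part g0 (a *: Y + Z) = (complex.Re a)%:C *: im_part g0 Y
    + ((complex.Im a)%:C *: re_part g0 Y + im_part g0 Z).
Proof.
move=> /nbar_parts[rY iY EY] /nbar_parts[rZ iZ EZ].
rewrite {1 4}EY {1 3}EZ; move: (re_part g0 Y) (im_part g0 Y) (re_part g0 Z) (im_part g0 Z) rY iY rZ iZ {EY EZ}.
move=> A C A' C' A0 C0 A'0 C'0.
have -> : a *: (A + 'i *: C) + (A' + 'i *: C') =
    ((complex.Re a)%:C *: A + ((- complex.Im a)%:C *: C + A'))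
    + 'i *: ((complex.Re a)%:C *: C + ((complex.Im a)%:C *: A + C')).
  rewrite {1}[a]complexE rmorphN /=.
  move: (complex.Re a)%:C (complex.Im a)%:C => r j.
  have ii : 'i * 'i = - 1 :> R[i] by rewrite -expr2 sqr_i.
  have -> : (r + 'i * j) *: (A + 'i *: C) =
      (r *: A + - j *: C) + 'i *: (r *: C + j *: A).
    rewrite scalerDl !scalerDr !scalerA [RHS]addrACA [r * _]mulrC; congr (_ + _).
    by rewrite mulrAC ii mulN1r addrC.
  by rewrite addrACA -scalerDr -!addrA.
apply: part_uniq.
  exact: (nbar0_comb _ A0 (nbar0_comb _ C0 A'0)).1.
exact: (nbar0_comb _ C0 (nbar0_comb _ A0 C'0)).1.
Qed.

End RealForm.

(** * Right derivatives of sections on Nbar_0 *)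

Section SectionCalculus.
Variables (q : 'I_(rk D)) (lam : hdual (hh D)) (lam_fund : fundamental_weight q lam).
Hypothesis n_two_step : brV (nilrad q) (brV (nilrad q) (nilrad q)) = 0%VS.
Variables (g0 : set g) (g0_real : real_form fullv g0).
Hypothesis nbar_real : real_form (nbar q) (g0 `&` [set x | x \in nbar q])%classic.
Implicit Types (x y A X Y Z : g) (n : 'End(g)) (f h k : line_section g).
Local Notation S := (nbar0 q g0).

Definition Nbar0 n : Prop := exists2 x, S x & n = nilexp (ad x).

Lemma nilexp_nbar0 X A : S X -> S A ->
  (nilexp (ad X) \o nilexp (ad A))%VF = nilexp (ad (X + (A + 2^-1 *: br X A))).
Proof.
by move=> [_ X0] [_ A0]; apply: (nilexp_nbar lam_fund n_two_step (nbar_br g0_real nbar_real)).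
Qed.

Lemma Nbar0_1 : Nbar0 \1%VF.
Proof. by exists 0; [exact: nbar0_0|rewrite ad0 nilexp0]. Qed.

Lemma Nbar0M n A : Nbar0 n -> S A -> Nbar0 (n \o nilexp (ad A))%VF.
Proof.
move=> [X X0 ->] A0; exists (X + (A + 2^-1 *: br X A)); last exact: nilexp_nbar0.
apply: nbar0D => //; apply: nbar0D => //; exact: nbar0_half_br.
Qed.

Lemma Nbar0M_line n A (t : R) : Nbar0 n -> S A -> Nbar0 (n \o nilexp (ad (t%:C *: A)))%VF.
Proof. by move=> n0 A0; apply: Nbar0M => //; exact: nbar0Z. Qed.

Definition family_section m (e : 'I_m -> g) f (t : 'rV[R]_m) :=
  f (nilexp (ad (\sum_i (t ord0 i)%:C *: e i))).

Definition smooth2 m (F : 'rV[R]_m -> R[i]) :=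
  smooth (fun t => complex.Re (F t)) /\ smooth (fun t => complex.Im (F t)).

Definition cD m (v : 'rV[R]_m) (F : 'rV[R]_m -> R[i]) (x : 'rV[R]_m) : R[i] :=
  'D_v (fun t => complex.Re (F t)) x +i* 'D_v (fun t => complex.Im (F t)) x.

Lemma smooth_family f m (e : 'I_m -> g) : smooth_section q g0 f -> (forall i, S (e i)) ->
  smooth2 (family_section e f).
Proof.
move=> sf Se; have Se' i : e i \in nbar q /\ g0 (e i) by case: (Se i).
by split=> k; case: (sf m e Se' k).
Qed.

Lemma family_sumD m (e : 'I_m -> g) (t : R) (v x : 'rV[R]_m) :
  \sum_i ((t *: v + x) ord0 i)%:C *: e i =
  t%:C *: (\sum_i (v ord0 i)%:C *: e i) + \sum_i (x ord0 i)%:C *: e i.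
Proof.
rewrite scaler_sumr -big_split; apply: eq_bigr => i _ /=.
by rewrite !mxE rmorphD rmorphM scalerDl scalerA.
Qed.

(** By the product formula t |-> exp X exp(tA) is a straight line in exponential coordinates with
    direction A + [X, A]/2, so R(A) f is a directional derivative there. *)
Lemma smooth_dir f m (e : 'I_m -> g) (x v : 'rV[R]_m) X A :
  smooth_section q g0 f -> (forall i, S (e i)) -> S A ->
  X = \sum_i (x ord0 i)%:C *: e i ->
  \sum_i (v ord0 i)%:C *: e i = A + 2^-1 *: br X A ->
  is_cder (fun t : R => f (nilexp (ad X) \o nilexp (ad (t%:C *: A)))%VF)
    (cD v (family_section e f) x).
Proof.
move=> sf Se SA EX EA; have SX : S X.
  by rewrite EX; apply: (nbar0_sum nbar_real) => i; exact: nbar0Z.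
have E (t : R) : f (nilexp (ad X) \o nilexp (ad (t%:C *: A)))%VF = family_section e f (t *: v + x).
  rewrite /family_section family_sumD EA -EX nilexp_nbar0 //; last exact: nbar0Z.
  by rewrite brZr [in RHS]addrC scalerDr !scalerA [2^-1 * _]mulrC.
have [sR sI] := smooth_family sf Se.
split.
  rewrite (_ : (fun t => _) = (fun t : R => complex.Re (family_section e f (t *: v + x)))).
    have := derive_line (s := 0) (@smooth_derivable _ _ _ (0 *: v + x) v sR).
    by rewrite scale0r add0r.
  by apply/funext => t; rewrite E.
rewrite (_ : (fun t => _) = (fun t : R => complex.Im (family_section e f (t *: v + x)))).
  have := derive_line (s := 0) (@smooth_derivable _ _ _ (0 *: v + x) v sI).
  by rewrite scale0r add0r.
by apply/funext => t; rewrite E.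
Qed.

Lemma cD_comb m (F : 'rV[R]_m -> R[i]) (r : R) (v w x : 'rV[R]_m) : smooth2 F ->
  cD (r *: v + w) F x = r%:C * cD v F x + cD w F x.
Proof.
move=> [sR sI]; rewrite /cD !smooth_deriveD // !smooth_deriveZ //.
by apply/eqP; rewrite eq_complex /= !mul0r subr0 addr0 !eqxx.
Qed.

Definition differentiable_on_Nbar h := forall n A, Nbar0 n -> S A ->
  is_cder (fun t : R => h (n \o nilexp (ad (t%:C *: A)))%VF) (Rreal A h n).

Lemma differentiable_intro h : (forall n A, Nbar0 n -> S A -> exists l,
    is_cder (fun t : R => h (n \o nilexp (ad (t%:C *: A)))%VF) l) ->
  differentiable_on_Nbar h.
Proof. by move=> dh n A n0 A0; have [l dl] := dh n A n0 A0; rewrite /Rreal (is_cderE dl). Qed.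

Lemma smooth_differentiable f : smooth_section q g0 f -> differentiable_on_Nbar f.
Proof.
move=> sf; apply: differentiable_intro => n A [X SX ->] SA.
pose e (i : 'I_2) := if i == 0 then X else A + 2^-1 *: br X A.
pose x : 'rV[R]_2 := delta_mx 0 0; pose v : 'rV[R]_2 := delta_mx 0 1.
exists (cD v (family_section e f) x); apply: smooth_dir => //.
- move=> i; rewrite /e; case: ifP => // _.
  by apply: nbar0D => //; exact: nbar0_half_br.
- by rewrite !big_ord_recl big_ord0 !mxE /= !scale1r scale0r !addr0.
by rewrite !big_ord_recl big_ord0 !mxE /= !scale1r scale0r addr0 add0r.
Qed.

(** In the coordinates X, A + [X, A]/2 and A' + [X, A']/2 all three right derivatives become
    directional derivatives of one smooth function. *)
Lemma Rreal_comb f (r : R) A A' n : smooth_section q g0 f -> Nbar0 n -> S A -> S A' ->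
  Rreal (r%:C *: A + A') f n = r%:C * Rreal A f n + Rreal A' f n.
Proof.
move=> sf [X SX ->] SA SA'.
pose e (i : 'I_3) := if i == 0 then X else if i == 1 then A + 2^-1 *: br X A
  else A' + 2^-1 *: br X A'.
have Se i : S (e i).
  rewrite /e; case: ifP => // _; case: ifP => _; apply: nbar0D => //; exact: nbar0_half_br.
pose x : 'rV[R]_3 := delta_mx 0 0.
have EX : X = \sum_i (x ord0 i)%:C *: e i.
  by rewrite !big_ord_recl big_ord0 !mxE /= !scale1r !scale0r !addr0.
pose v : 'rV[R]_3 := delta_mx 0 1; pose w : 'rV[R]_3 := delta_mx 0 2.
have dA C (u : 'rV[R]_3) : S C -> \sum_i (u ord0 i)%:C *: e i = C + 2^-1 *: br X C ->
    Rreal C f (nilexp (ad X)) = cD u (family_section e f) x.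
  by move=> SC Eu; exact: is_cderE (smooth_dir sf Se SC EX Eu).
have Ev : \sum_i (v ord0 i)%:C *: e i = A + 2^-1 *: br X A.
  by rewrite !big_ord_recl big_ord0 !mxE /= !scale1r !scale0r !add0r !addr0.
have Ew : \sum_i (w ord0 i)%:C *: e i = A' + 2^-1 *: br X A'.
  by rewrite !big_ord_recl big_ord0 !mxE /= !scale1r !scale0r !add0r !addr0.
rewrite (dA A v) // (dA A' w) // -cD_comb; last exact: smooth_family.
apply: dA; first exact: nbar0_comb.
rewrite family_sumD Ev Ew brDr brZr.
by rewrite !scalerDr !scalerA [2^-1 * _]mulrC [RHS]addrACA.
Qed.

Lemma smooth2_sum m (I : Type) (r : seq I) (F : I -> 'rV[R]_m -> R[i]) :
  (forall i, smooth2 (F i)) -> smooth2 (fun t => \sum_(i <- r) F i t).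
Proof.
move=> sF; have ReS t : complex.Re (\sum_(i <- r) F i t) = \sum_(i <- r) complex.Re (F i t).
  by apply: (big_morph (@complex.Re R)) => // a b; exact: cReD.
have ImS t : complex.Im (\sum_(i <- r) F i t) = \sum_(i <- r) complex.Im (F i t).
  by apply: (big_morph (@complex.Im R)) => // a b; exact: cImD.
split=> k.
  apply: Ck_eq (smooth_sum r (fun i => (sF i).1) k) => t; exact/esym/ReS.
apply: Ck_eq (smooth_sum r (fun i => (sF i).2) k) => t; exact/esym/ImS.
Qed.

(** At X = sum t_i e_i the direction A + [X, A]/2 varies with t. Enlarging the family by A and all
    [e_i, A]/2 makes R(A) f the derivative along A plus the sum of t_i times those along [e_i, A]/2,
    restricted to the subspace t |-> (t, 0, 0). *)
Lemma smooth_Rreal A f : S A -> smooth_section q g0 f -> smooth_section q g0 (Rreal A f).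
Proof.
move=> SA sf m e0 Se0; have Se i : S (e0 i) by case: (Se0 i).
pose e (i : 'I_(m + (1 + m))) := match fintype.split i with
  | inl j => e0 j
  | inr i' => match fintype.split i' with inl _ => A | inr j => 2^-1 *: br (e0 j) A end end.
have Se' i : S (e i).
  rewrite /e; case: (fintype.split i) => [j|i'] //; case: (fintype.split i') => [//|j].
  exact: nbar0_half_br.
pose F := family_section e f.
have sF : smooth2 F by exact: smooth_family.
pose x (t : 'rV[R]_m) : 'rV[R]_(m + (1 + m)) := row_mx t (row_mx 0 0).
have xlin : linear x.
  by move=> k u v; rewrite /x -[LHS]/(row_mx (k *: u + v) (row_mx 0 0)) !scale_row_mx !add_row_mx !scaler0 !addr0.
have esum (t u : 'rV[R]_m) (r : 'rV[R]_1) :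
    \sum_i ((row_mx t (row_mx r u) : 'rV[R]_(m + (1 + m))) ord0 i)%:C *: e i =
    \sum_i (t ord0 i)%:C *: e0 i + ((r ord0 ord0)%:C *: A
      + \sum_i (u ord0 i)%:C *: (2^-1 *: br (e0 i) A)).
  rewrite big_split_ord big_split_ord big_ord1; congr (_ + (_ + _)).
  - by apply: eq_bigr => i _; rewrite row_mxEl /e (unsplitK (inl _)).
  - by rewrite row_mxEr row_mxEl /e (unsplitK (inr _)) (unsplitK (inl _)).
  by apply: eq_bigr => i _; rewrite !row_mxEr /e (unsplitK (inr _)) (unsplitK (inr _)).
pose v0 : 'rV[R]_(m + (1 + m)) := row_mx 0 (row_mx 1 0).
pose w (i : 'I_m) : 'rV[R]_(m + (1 + m)) := row_mx 0 (row_mx 0 (delta_mx 0 i)).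
have E (t : 'rV[R]_m) : Rreal A f (nilexp (ad (\sum_i (t ord0 i)%:C *: e0 i))) =
    cD v0 F (x t) + \sum_i (t ord0 i)%:C * cD (w i) F (x t).
  have -> : cD v0 F (x t) + \sum_i (t ord0 i)%:C * cD (w i) F (x t) =
      cD (\sum_i t ord0 i *: w i + v0) F (x t).
    rewrite addrC; elim: (index_enum _) => [|i r IH]; first by rewrite !big_nil !add0r.
    by rewrite !big_cons -!addrA cD_comb // IH.
  have -> : \sum_i t ord0 i *: w i + v0 = row_mx 0 (row_mx 1 t).
    have -> : \sum_i t ord0 i *: w i = row_mx 0 (row_mx 0 t).
      rewrite [in RHS](row_sum_delta t); elim: (index_enum _) => [|i r IH].
        by rewrite !big_nil !row_mx0.
      by rewrite !big_cons IH /w !scale_row_mx !add_row_mx !scaler0 !addr0.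
    by rewrite !add_row_mx !add0r addr0.
  apply: (is_cderE (smooth_dir sf Se' SA _ _)).
    by rewrite /x esum mxE scale0r add0r [X in _ = _ + X]big1 ?addr0 // => i _; rewrite mxE scale0r.
  rewrite esum mxE scale1r [X in X + _ = _]big1 => [|i _]; last by rewrite mxE scale0r.
  rewrite add0r br_suml scaler_sumr; congr (_ + _); apply: eq_bigr => i _.
  by rewrite brZl !scalerA mulrC.
have smD (v : 'rV[R]_(m + (1 + m))) : smooth2 (fun t => cD v F (x t)).
  pose L := HB.pack x (GRing.isLinear.Build _ _ _ _ x xlin) : {linear 'rV[R]_m -> 'rV[R]_(m + (1 + m))}.
  have cL : continuous L.
    apply: continuous_rV => j; case: (splitP j) => i ij; last first.
      rewrite (_ : (fun _ => _) = cst 0); first exact: cst_continuous.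
      apply/funext => t /=; rewrite (_ : j = rshift m i); last exact: val_inj.
      rewrite /x row_mxEr; case: (splitP i) => i' ii.
        by rewrite (_ : i = lshift m i') ?row_mxEl ?mxE //; exact: val_inj.
      by rewrite (_ : i = rshift 1 i') ?row_mxEr ?mxE //; exact: val_inj.
    rewrite (_ : (fun _ => _) = (fun t : 'rV[R]_m => t ord0 i)); first exact: coord_continuous.
    apply/funext => t /=; rewrite (_ : j = lshift _ i); last exact: val_inj.
    by rewrite /x row_mxEl.
  by split; [exact: (smooth_linear cL (smooth_derive v sF.1))
            |exact: (smooth_linear cL (smooth_derive v sF.2))].
have smM (i : 'I_m) (G : 'rV[R]_m -> R[i]) : smooth2 G -> smooth2 (fun t => (t ord0 i)%:C * G t).
  move=> [s1 s2]; split=> k.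
    by apply: Ck_eq (smoothM (@smooth_coord R m i) s1 k) => t /=; rewrite cReM /= mul0r subr0.
  by apply: Ck_eq (smoothM (@smooth_coord R m i) s2 k) => t /=; rewrite cImM /= mul0r addr0.
have [s1 s2] := smooth2_sum (index_enum 'I_m) (fun i => smM i _ (smD (w i))).
have [t1 t2] := smD v0.
move=> G k; split.
  by apply: Ck_eq (CkD (t1 k) (s1 k)) => t; rewrite /G E cReD.
by apply: Ck_eq (CkD (t2 k) (s2 k)) => t; rewrite /G E cImD.
Qed.

Lemma Rreal_congr h k n A : (forall n', Nbar0 n' -> h n' = k n') -> Nbar0 n -> S A ->
  Rreal A h n = Rreal A k n.
Proof.
move=> hk n0 A0; rewrite /Rreal.
by congr (derive1 _ 0 +i* derive1 _ 0); apply/funext => t; rewrite hk //; exact: Nbar0M_line.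
Qed.

Lemma RX_congr h k n Y : (forall n', Nbar0 n' -> h n' = k n') -> Nbar0 n -> Y \in nbar q ->
  RX g0 Y h n = RX g0 Y k n.
Proof.
move=> hk n0 /(nbar_parts g0_real nbar_real)[SA SC _].
by rewrite /RX !(Rreal_congr hk).
Qed.

Lemma RrealM h k n A : differentiable_on_Nbar h -> differentiable_on_Nbar k -> Nbar0 n -> S A ->
  is_cder (fun t : R => h (n \o nilexp (ad (t%:C *: A)))%VF * k (n \o nilexp (ad (t%:C *: A)))%VF)
    (Rreal A h n * k n + h n * Rreal A k n).
Proof.
move=> dh dk n0 A0; have := is_cderM (dh n A n0 A0) (dk n A n0 A0).
by rewrite scale0r ad0 nilexp0 comp_lfun1r.
Qed.

Lemma differentiableM h k : differentiable_on_Nbar h -> differentiable_on_Nbar k ->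
  differentiable_on_Nbar (fun n => h n * k n).
Proof.
move=> dh dk; apply: differentiable_intro => n A n0 A0.
by exists (Rreal A h n * k n + h n * Rreal A k n); exact: RrealM.
Qed.

Lemma RXM h k n Y : differentiable_on_Nbar h -> differentiable_on_Nbar k -> Nbar0 n ->
  Y \in nbar q ->
  RX g0 Y (fun n => h n * k n) n = RX g0 Y h n * k n + h n * RX g0 Y k n.
Proof.
move=> dh dk n0 /(nbar_parts g0_real nbar_real)[SA SC _]; rewrite /RX.
have E A : S A -> Rreal A (fun n => h n * k n) n = Rreal A h n * k n + h n * Rreal A k n.
  by move=> A0; exact: is_cderE (RrealM dh dk n0 A0).
have leib (a a' b b' u v j : R[i]) :
  (a * v + u * b) + j * (a' * v + u * b') = (a + j * a') * v + u * (b + j * b') by ring.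
by rewrite (E _ SA) (E _ SC) leib.
Qed.

Lemma RX_sum (I : Type) (r : seq I) (F : I -> line_section g) n Y :
  (forall i, differentiable_on_Nbar (F i)) -> Nbar0 n -> Y \in nbar q ->
  RX g0 Y (fun n => \sum_(i <- r) F i n) n = \sum_(i <- r) RX g0 Y (F i) n.
Proof.
move=> dF n0 /(nbar_parts g0_real nbar_real)[SA SC _]; rewrite /RX.
have E A : S A -> Rreal A (fun n => \sum_(i <- r) F i n) n = \sum_(i <- r) Rreal A (F i) n.
  by move=> A0; apply: is_cderE; apply: is_cder_sum => i; exact: dF.
by rewrite !E // big_split mulr_sumr.
Qed.

Lemma differentiableD h k : differentiable_on_Nbar h -> differentiable_on_Nbar k ->
  differentiable_on_Nbar (fun n => h n + k n).
Proof.
move=> dh dk; apply: differentiable_intro => n A n0 A0.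
by exists (Rreal A h n + Rreal A k n); apply: is_cderD; [exact: dh|exact: dk].
Qed.

Lemma RXD h k n Y : differentiable_on_Nbar h -> differentiable_on_Nbar k -> Nbar0 n ->
  Y \in nbar q -> RX g0 Y (fun n => h n + k n) n = RX g0 Y h n + RX g0 Y k n.
Proof.
move=> dh dk n0 /(nbar_parts g0_real nbar_real)[SA SC _]; rewrite /RX.
have E A : S A -> Rreal A (fun n => h n + k n) n = Rreal A h n + Rreal A k n.
  by move=> A0; apply: is_cderE; apply: is_cderD; [exact: dh|exact: dk].
by rewrite (E _ SA) (E _ SC) mulrDr addrACA.
Qed.

Lemma smooth_sectionD h k : smooth_section q g0 h -> smooth_section q g0 k ->
  smooth_section q g0 (fun n => h n + k n).
Proof.
move=> sh sk m e Se F j; have [h1 h2] := sh m e Se j; have [k1 k2] := sk m e Se j.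
split; [apply: Ck_eq (CkD h1 k1) => t|apply: Ck_eq (CkD h2 k2) => t].
  by rewrite /F cReD.
by rewrite /F cImD.
Qed.

Lemma smooth_sectionZ (c : R[i]) h : smooth_section q g0 h ->
  smooth_section q g0 (fun n => c * h n).
Proof.
move=> sh m e Se F j; have h1 i := (sh m e Se i).1; have h2 i := (sh m e Se i).2.
pose cst_mul (a : R) (G : 'rV[R]_m -> R) (sG : smooth G) := smoothM (smooth_cst m a) sG.
split; [apply: Ck_eq (CkD (cst_mul (complex.Re c) _ h1 j) (cst_mul (- complex.Im c) _ h2 j)) => t
       |apply: Ck_eq (CkD (cst_mul (complex.Re c) _ h2 j) (cst_mul (complex.Im c) _ h1 j)) => t].
  by rewrite /F cReM /= mulNr.
by rewrite /F cImM /=.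
Qed.

Lemma smooth_RX Y f : Y \in nbar q -> smooth_section q g0 f -> smooth_section q g0 (RX g0 Y f).
Proof.
move=> /(nbar_parts g0_real nbar_real)[SA SC _] sf.
by apply: smooth_sectionD; [|apply: smooth_sectionZ]; exact: smooth_Rreal.
Qed.

Lemma RX0 h n : RX g0 0 h n = 0.
Proof.
have g00 : g0 0 by case: g0_real.
have [] := part_uniq g0_real g00 g00; rewrite scaler0 addr0 /RX => -> ->.
suff -> : Rreal 0 h n = 0 by rewrite mulr0 addr0.
apply: (@is_cderE _ (fun t : R => h (n \o nilexp (ad (t%:C *: 0)))%VF)).
rewrite (_ : (fun t => _) = cst (h n)); first exact: is_cder_cst.
by apply/funext => t; rewrite scaler0 ad0 nilexp0 comp_lfun1r.
Qed.

Lemma RX_comb f (a : R[i]) Y Z n : smooth_section q g0 f -> Nbar0 n ->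
  Y \in nbar q -> Z \in nbar q ->
  RX g0 (a *: Y + Z) f n = a * RX g0 Y f n + RX g0 Z f n.
Proof.
move=> sf n0 YN ZN; have [rE iE] := parts_comb g0_real nbar_real a YN ZN.
have [Y1 Y2 _] := nbar_parts g0_real nbar_real YN.
have [Z1 Z2 _] := nbar_parts g0_real nbar_real ZN.
rewrite /RX rE iE !Rreal_comb //; try exact: nbar0_comb.
rewrite {5}[a]complexE rmorphN /=.
have ii : 'i * 'i = - 1 :> R[i] by rewrite -expr2 sqr_i.
set u := Rreal _ _ _; set v := Rreal _ _ _; set w := Rreal _ _ _; set z := Rreal _ _ _.
move: (complex.Re a)%:C (complex.Im a)%:C => r j.
transitivity ((r + 'i * j) * (u + 'i * v) - ('i * 'i + 1) * (j * v) + (w + 'i * z)); first by ring.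
by rewrite ii addNr mul0r subr0.
Qed.

Lemma RXZ f (a : R[i]) Y n : smooth_section q g0 f -> Nbar0 n -> Y \in nbar q ->
  RX g0 (a *: Y) f n = a * RX g0 Y f n.
Proof.
by move=> sf n0 YN; rewrite -[a *: Y]addr0 RX_comb ?mem0v // RX0 addr0.
Qed.

Lemma RX_suml (I : Type) (r : seq I) (P : pred I) (Y : I -> g) f n :
  smooth_section q g0 f -> Nbar0 n -> (forall i, P i -> Y i \in nbar q) ->
  RX g0 (\sum_(i <- r | P i) Y i) f n = \sum_(i <- r | P i) RX g0 (Y i) f n.
Proof.
move=> sf n0 YN; elim: r => [|i r IH]; first by rewrite !big_nil RX0.
rewrite !big_cons; case: ifP => // /YN Yi.
by rewrite -[Y i]scale1r RX_comb ?IH ?memv_suml // mul1r scale1r.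
Qed.

Variable Y0 : g.
Implicit Types l : 'Hom(g, R[i]^o).

Definition orbit_coef l : line_section g := fun n => l ((n^-1)%VF Y0).

Lemma endo_powZ (c : R[i]) (a : 'End(g)) j : endo_pow (c *: a) j = c ^+ j *: endo_pow a j.
Proof.
elim: j => [|j IH]; first by rewrite expr0 scale1r.
rewrite /endo_pow /= -!/(endo_pow _ _) IH -comp_lfunZl -comp_lfunZr scalerA.
by rewrite exprS.
Qed.

(** The inverse of n exp(tA) sends Y0 to exp(-tA) n^-1 Y0, a polynomial in t; only its linear
    coefficient contributes at t = 0. *)
Lemma Rreal_orbit l n A : Nbar0 n -> S A ->
  is_cder (fun t : R => orbit_coef l (n \o nilexp (ad (t%:C *: A)))%VF)
    (- l (br A ((n^-1)%VF Y0))).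
Proof.
move=> [x Sx ->] SA; set u := ((nilexp (ad x))^-1)%VF Y0.
have SN y : S y -> S (- y).
  by move=> Sy; rewrite -scaleN1r -[- 1](rmorphN1 (real_complex R)); exact: nbar0Z.
have inv y : S y -> ((nilexp (ad y))^-1)%VF = nilexp (ad (- y)).
  by case=> _; apply: (nilexp_nbar_inv lam_fund n_two_step (nbar_br g0_real nbar_real)).
have E (t : R) : orbit_coef l (nilexp (ad x) \o nilexp (ad (t%:C *: A)))%VF =
    \sum_(j < (\dim {:g}).+1) (t ^+ j)%:C * ((j`!%:R)^-1 * l (endo_pow (ad (- A)) j u)).
  have SB : S (t%:C *: A) by exact: nbar0Z.
  have Sz : S (t%:C *: A + 2^-1 *: br x (t%:C *: A)).
    by apply: nbar0D => //; exact: nbar0_half_br.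
  (* The inverse is known for single exponentials, so the product is merged into one, inverted, and
     compared with the merged right-hand side. *)
  have -> : orbit_coef l (nilexp (ad x) \o nilexp (ad (t%:C *: A)))%VF =
      l (nilexp (ad (- (t%:C *: A))) u).
    rewrite /orbit_coef nilexp_nbar0 // inv; last exact: nbar0D.
    rewrite /u inv // -[nilexp _ (nilexp _ Y0)]comp_lfunE nilexp_nbar0; try exact: SN.
    congr (l (nilexp (ad _) _)); rewrite brNl brNr opprK [br x _]brC scalerN.
    by rewrite !opprD opprK addrCA.
  have -> : - (t%:C *: A) = t%:C *: - A by rewrite scalerN.
  rewrite adZ sum_lfunE linear_sum; apply: eq_bigr => j _.
  rewrite -/(endo_pow _ _) endo_powZ rmorphXn scale_lfunE scale_lfunE !linearZ /=.
  by rewrite mulrCA.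
rewrite (_ : (fun t => _) = (fun t : R =>
    \sum_(j < (\dim {:g}).+1) (t ^+ j)%:C * ((j`!%:R)^-1 * l (endo_pow (ad (- A)) j u)))).
  have g1 : (1 < (\dim {:g}).+1)%N by rewrite ltnS dimvf (g_proper q).
  have -> : - l (br A u) = \sum_(j < (\dim {:g}).+1)
      ((j : nat) == 1)%N%:R * ((j`!%:R)^-1 * l (endo_pow (ad (- A)) j u)).
    rewrite (bigD1 (Ordinal g1)) //= big1 => [|j j1].
      by rewrite addr0 mul1r invr1 mul1r comp_lfun1r adE brNl linearN.
    by rewrite (negPf (_ : j != 1 :> nat)) ?mul0r.
  by apply: is_cder_sum => j; exact: is_cder_monomial.
exact/funext.
Qed.

Lemma differentiable_orbit l : differentiable_on_Nbar (orbit_coef l).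
Proof.
apply: differentiable_intro => n A n0 A0.
by exists (- l (br A ((n^-1)%VF Y0))); exact: Rreal_orbit.
Qed.

Lemma RX_orbit l n Y : Nbar0 n -> Y \in nbar q ->
  RX g0 Y (orbit_coef l) n = - l (br Y ((n^-1)%VF Y0)).
Proof.
move=> n0 /(nbar_parts g0_real nbar_real)[SA SC {2}->]; rewrite /RX.
have E A : S A -> Rreal A (orbit_coef l) n = - l (br A ((n^-1)%VF Y0)).
  by move=> A0; exact: is_cderE (Rreal_orbit l n0 A0).
by rewrite !E // brDl brZl linearD linearZ opprD mulrN.
Qed.

Lemma lfun_inv1 : ((\1 : 'End(g))^-1)%VF = \1%VF.
Proof.
have S0 := nbar0_0 nbar_real; case: S0 => _ N0.
have := nilexp_nbar_inv lam_fund n_two_step (nbar_br g0_real nbar_real) N0.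
by rewrite oppr0 ad0 nilexp0.
Qed.

Lemma RX2_orbit (I : Type) (r : seq I) (l : I -> 'Hom(g, R[i]^o)) (h : I -> line_section g)
    Y Z : (forall i, smooth_section q g0 (h i)) -> Y \in nbar q -> Z \in nbar q ->
  RX g0 Y (RX g0 Z (fun n => \sum_(i <- r) orbit_coef (l i) n * h i n)) \1%VF =
  \sum_(i <- r) (l i (br Z (br Y Y0)) * h i \1%VF - l i (br Z Y0) * RX g0 Y (h i) \1%VF
    - l i (br Y Y0) * RX g0 Z (h i) \1%VF + l i Y0 * RX g0 Y (RX g0 Z (h i)) \1%VF).
Proof.
move=> sh YN ZN; have dh i := smooth_differentiable (sh i).
have dRh i : differentiable_on_Nbar (RX g0 Z (h i)).
  by apply: smooth_differentiable; exact: smooth_RX.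
pose l' i : 'Hom(g, R[i]^o) := - (l i \o ad Z)%VF.
have l'E i x : l' i x = - l i (br Z x) by rewrite opp_lfunE comp_lfunE adE.
have dO := differentiable_orbit.
have dM i := differentiableM (dO (l i)) (dh i).
have dM' i := differentiableM (dO (l' i)) (dh i).
have dM2 i := differentiableM (dO (l i)) (dRh i).
rewrite (@RX_congr _ (fun n => \sum_(i <- r)
    (orbit_coef (l' i) n * h i n + orbit_coef (l i) n * RX g0 Z (h i) n))) //;
  last exact: Nbar0_1; last first.
  move=> n n0; rewrite RX_sum //; apply: eq_bigr => i _.
  by rewrite RXM // RX_orbit // -l'E.
have dS i := differentiableD (dM' i) (dM2 i).
rewrite (RX_sum r dS Nbar0_1 YN); apply: eq_bigr => i _.
rewrite (RXD (dM' i) (dM2 i) Nbar0_1 YN) (RXM (dO (l' i)) (dh i) Nbar0_1 YN).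
rewrite (RXM (dO (l i)) (dRh i) Nbar0_1 YN) !(RX_orbit _ Nbar0_1 YN).
rewrite /orbit_coef lfun_inv1 id_lfunE !l'E opprK !mulNr.
exact: addrA.
Qed.

End SectionCalculus.

(** * The commutator at the identity *)

Section Commutator.
Local Notation h' := (hdual (hh D)).
Variables (q : 'I_(rk D)) (lam : h') (lam_fund : fundamental_weight q lam).
Hypothesis n_two_step : brV (nilrad q) (brV (nilrad q) (nilrad q)) = 0%VS.
Variables (g0 : set g) (g0_real : real_form fullv g0).
Hypothesis nbar_real : real_form (nbar q) (g0 `&` [set x | x \in nbar q])%classic.
Variable s : R[i].
Local Notation Nbar0 := (Nbar0 q g0).
Local Notation RX := (RX g0).

Let N1 : Nbar0 \1%VF := Nbar0_1 nbar_real.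

Definition lam_coef : 'Hom(g, R[i]^o) :=
  (lam \o linfun (vsproj (hh D)) \o daddv_pi (hh D) (\sum_(a <- roots D) root_space a)
   \o daddv_pi (parabolic q) (nbar q))%VF.

Lemma lam_coefE x : lam_coef x = lam (proj_h D (proj_q q x)).
Proof. by rewrite /lam_coef !comp_lfunE lfunE. Qed.

(** With these forms the derivative along the moving vector (Ad(n^-1) Y)_nbar becomes a sum of orbit
    coefficients times derivatives along a fixed basis. *)
Definition nbar_coef i : 'Hom(g, R[i]^o) :=
  (linfun (coord (vbasis (nbar q)) i : g -> R[i]^o) \o daddv_pi (nbar q) (parabolic q))%VF.

Lemma nbar_coefE i x : nbar_coef i x = coord (vbasis (nbar q)) i (proj_nbar q x).
Proof. by rewrite /nbar_coef comp_lfunE lfunE. Qed.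

Lemma lam_coef_nbar x : x \in nbar q -> lam_coef x = 0.
Proof.
by move=> xN; rewrite lam_coefE proj_q0 // /proj_h !linear0.
Qed.

Lemma RX_nbar_coef f x : smooth_section q g0 f -> forall n, Nbar0 n ->
  \sum_i nbar_coef i x * RX (vbasis (nbar q))`_i f n = RX (proj_nbar q x) f n.
Proof.
move=> sf n n0; have bN i : (vbasis (nbar q))`_i \in nbar q.
  have [i1|i1] := ltnP i (size (vbasis (nbar q))); last by rewrite nth_default ?mem0v.
  exact: vbasis_mem (mem_nth _ i1).
have xN : proj_nbar q x \in nbar q by exact: memv_pi.
rewrite [in RHS](coord_vbasis xN).
have cN i : true -> coord (vbasis (nbar q)) i (proj_nbar q x) *: (vbasis (nbar q))`_i \in nbar q.
  by move=> _; exact: memvZ (bN i).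
rewrite (RX_suml lam_fund n_two_step g0_real nbar_real _ sf n0 cN); apply: eq_bigr => i _.
by rewrite (RXZ lam_fund n_two_step g0_real nbar_real _ sf n0 (bN i)) nbar_coefE.
Qed.

(** The forms [nbar_coef] vanish on q and [lam_coef] vanishes on nbar. So only the mixed terms of
    the Leibniz rule survive in the character part, and only the double bracket in the derivative
    part. *)
Lemma RX2_pi_s Y0 f Y Z : smooth_section q g0 f -> Y \in nbar q -> Z \in nbar q ->
  Y0 \in parabolic q -> br Y Y0 \in parabolic q -> br Z Y0 \in parabolic q ->
  br Z (br Y Y0) \in nbar q -> lam_coef Y0 = 0 ->
  RX Y (RX Z (pi_s q g0 lam s Y0 f)) \1%VF =
  - (s * (lam_coef (br Z Y0) * RX Y f \1%VF + lam_coef (br Y Y0) * RX Z f \1%VF)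
     + RX (br Z (br Y Y0)) f \1%VF).
Proof.
move=> sf YN ZN Y0P YP ZP ZYN lam0.
(* The index [None] carries the character term of [pi_s], the index [Some j] the derivative along
   the jth basis vector of nbar. *)
pose l (i : option 'I_(\dim (nbar q))) : 'Hom(g, R[i]^o) :=
  if i is Some j then - nbar_coef j else s *: lam_coef.
pose h (i : option 'I_(\dim (nbar q))) : line_section g :=
  if i is Some j then RX (vbasis (nbar q))`_j f else f.
pose r := None :: [seq Some j | j <- index_enum 'I_(\dim (nbar q))].
have sumE (F : option 'I_(\dim (nbar q)) -> R[i]) :
  \sum_(i <- r) F i = F None + \sum_j F (Some j) by rewrite big_cons big_map.
have bN (j : 'I_(\dim (nbar q))) : (vbasis (nbar q))`_j \in nbar q.
  by apply/vbasis_mem/mem_nth; rewrite size_tuple.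
have sh i : smooth_section q g0 (h i).
  by case: i => [j|] //; exact: (smooth_RX lam_fund n_two_step g0_real nbar_real (bN j) sf).
have piE n : Nbar0 n ->
    pi_s q g0 lam s Y0 f n = \sum_(i <- r) orbit_coef Y0 (l i) n * h i n.
  move=> n0; rewrite sumE /= /pi_s /orbit_coef -lam_coefE scale_lfunE; congr (_ + _).
  rewrite -(RX_nbar_coef _ sf n0) -sumrN; apply: eq_bigr => j _.
  by rewrite opp_lfunE mulNr.
rewrite (RX_congr lam_fund n_two_step g0_real nbar_real (h := RX Z (pi_s q g0 lam s Y0 f))
  (k := RX Z (fun n => \sum_(i <- r) orbit_coef Y0 (l i) n * h i n)) _ N1 YN); last first.
  move=> n n0; exact: (RX_congr lam_fund n_two_step g0_real nbar_real piE n0 ZN).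
rewrite (RX2_orbit lam_fund n_two_step g0_real nbar_real Y0 r l sh YN ZN) sumE /=.
have lc0 x j : x \in parabolic q -> nbar_coef j x = 0.
  by move=> xP; rewrite nbar_coefE proj_nbar0 // linear0.
rewrite [X in _ + X](_ : _ = - RX (br Z (br Y Y0)) f \1%VF).
  rewrite !scale_lfunE lam0 (lam_coef_nbar ZYN).
  move: (lam_coef _) (lam_coef _) (RX Y f _) (RX Z f _) (RX (br Z _) f _) (RX Y (RX Z f) _) (f _).
  by move=> a b c d e u v; rewrite /GRing.scale /=; ring.
rewrite -[in RHS](proj_nbar_id ZYN) -(RX_nbar_coef _ sf N1) -sumrN; apply: eq_bigr => j _.
have lin (a b c d u v w z : R[i]) : b = 0 -> c = 0 -> d = 0 ->
    a * u - b * v - c * w + d * z = a * u.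
  by move=> -> -> ->; rewrite !mul0r !subr0 addr0.
have lc1 x : x \in parabolic q -> (- nbar_coef j) x = 0.
  by move=> xP; rewrite opp_lfunE (lc0 _ _ xP) oppr0.
rewrite (lin _ _ _ _ _ _ _ _ (lc1 _ ZP) (lc1 _ YP) (lc1 _ Y0P)) opp_lfunE.
exact: (mulNr (nbar_coef j _ : R[i])).
Qed.

End Commutator.

(** * The commutator in terms of the quadratic form *)

Section Assembly.
Local Notation h' := (hdual (hh D)).
Variables (q : 'I_(rk D)) (lam : h') (lam_fund : fundamental_weight q lam).
Hypothesis n_two_step : brV (nilrad q) (brV (nilrad q) (nilrad q)) = 0%VS.
Variables (g0 : set g) (g0_real : real_form fullv g0).
Hypothesis nbar_real : real_form (nbar q) (g0 `&` [set x | x \in nbar q])%classic.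
Variables (s : R[i]) (mu eps : h').
Hypotheses (muD : mu \in roots D) (mu1 : level q mu = 1).
Hypotheses (epsD : eps \in roots D) (eps1 : level q eps = 1).
Hypothesis sumND : mu + eps \notin roots D.
Local Notation RX := (RX g0).
Local Notation L1 := (rootsV D (grading q 1)).
Local Notation lc := (lam_coef q lam).
Local Notation bb := (ip (base D)`_q (base D)`_q).

Let N1 : Nbar0 q g0 \1%VF := Nbar0_1 nbar_real.

Lemma mem_level1 a : (a \in L1) = (a \in roots D) && (level q a == 1).
Proof. by rewrite mem_rootsV_grading // mulr1z. Qed.

Lemma nilrad_parabolic x : x \in nilrad q -> x \in parabolic q.
Proof. by move=> xn; apply: (subvP (addvSr _ _)). Qed.

Lemma levi_parabolic x : x \in levi q -> x \in parabolic q.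
Proof. by move=> xn; apply: (subvP (addvSl _ _)). Qed.

Lemma X_nbar1 a : a \in L1 -> X B (- a) \in nbar q.
Proof.
rewrite mem_level1 => /andP[aD /eqP a1].
by apply: X_nbar; [exact: opp_root|left; rewrite levelN a1].
Qed.

Lemma lam_coef_levi_root a : a \in roots D -> level q a = 0 -> lc (X B a) = 0.
Proof.
move=> aD a0; have aP := levi_parabolic (X_levi aD a0).
by rewrite lam_coefE (proj_q_id aP) (proj_h_root aD (X_weight aD)) linear0.
Qed.

Lemma lam_coef_mu : lc (X B mu) = 0.
Proof.
have muP : X B mu \in parabolic q.
  by apply/nilrad_parabolic/X_nilrad => //; rewrite mu1 ltr01.
by rewrite lam_coefE (proj_q_id muP) (proj_h_root muD (X_weight muD)) linear0.
Qed.

(** For a = mu the bracket is - H_mu, on which lam takes the value - |alpha_q|^2 / 2; for a != mu it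
    is 0 or a multiple of a root vector of l, with no component in h. *)
Lemma br_mu_level1 a : a \in L1 ->
  [/\ br (X B (- a)) (X B mu) \in parabolic q,
      lc (br (X B (- a)) (X B mu)) = if a == mu then - (bb / 2) else 0
    & forall c, c \in L1 -> br (X B (- c)) (br (X B (- a)) (X B mu)) \in nbar q].
Proof.
rewrite mem_level1 => /andP[aD /eqP a1]; have naD := opp_root aD.
have [am|amu] := eqVneq a mu.
  rewrite am; have hP : - vsval (Hc B mu) \in parabolic q.
    by rewrite memvN; apply/levi_parabolic/(subvP (addvSl _ _))/subvsP.
  split; rewrite ?br_opp_self //.
    rewrite lam_coefE (proj_q_id hP) -linearN proj_h_cartan linearN -(sharp_root muD).
    have E : lam (sharp mu) = bb / 2.
      by transitivity (ip lam mu); [exact/esym/ipE|rewrite (ip_fund lam_fund) mu1 mul1r].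
    by congr (- _); exact: E.
  move=> c cL; have := cL; rewrite mem_level1 => /andP[cD _].
  by rewrite -br_opp_self // (br_Hc muD cD) memvZ // X_nbar1.
have [bD|bD] := boolP (- a + mu \in roots D); last first.
  rewrite (nonroot_br naD muD _ bD); last by rewrite addrC subr_eq0 eq_sym.
  by split; rewrite ?mem0v ?linear0 // => c _; rewrite br0r mem0v.
have b0 : level q (- a + mu) = 0 by rewrite levelD levelN a1 mu1 addNr.
rewrite (N_br B naD muD bD); split.
- by rewrite memvZ // (levi_parabolic (X_levi bD b0)).
- by rewrite linearZ /= (lam_coef_levi_root bD b0) scaler0.
move=> c; rewrite mem_level1 => /andP[cD /eqP c1]; have ncD := opp_root cD.
have l1 : level q (- c + (- a + mu)) = - 1 by rewrite levelD levelN c1 b0 addr0.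
rewrite brZr memvZ //; have [cbD|cbD] := boolP (- c + (- a + mu) \in roots D).
  by rewrite (N_br B ncD bD cbD) memvZ // X_nbar //; left.
rewrite (nonroot_br ncD bD _ cbD) ?mem0v //; apply: contraTneq (@oner_neq0 R[i]) => cb0.
by rewrite -oppr_eq0 -l1 cb0 level0 eqxx.
Qed.

Lemma symmetrize_sum (I : Type) (r : seq I) (p : I -> I -> R[i]) (x : I -> g)
    (F : R[i] * seq g -> R[i]) :
  \sum_(cw <- symmetrize [seq (p a c, (x a, x c)) | a <- r, c <- r]) F cw =
  \sum_(a <- r) \sum_(c <- r) (F (p a c / 2, [:: x a; x c]) + F (p a c / 2, [:: x c; x a])).
Proof.
rewrite /symmetrize big_cat !big_map !big_allpairs_dep /= -big_split.
by apply: eq_bigr => a _; rewrite -big_split.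
Qed.

Lemma sum_symm (I : Type) (r : seq I) (p z : I -> I -> R[i]) : (forall a c, p a c = p c a) ->
  \sum_(a <- r) \sum_(c <- r) p a c * z c a = \sum_(a <- r) \sum_(c <- r) p a c * z a c.
Proof.
move=> pC; rewrite exchange_big; apply: eq_bigr => a _; apply: eq_bigr => c _.
by rewrite pC.
Qed.

Lemma sum_half_symm (I : Type) (r : seq I) (p z : I -> I -> R[i]) : (forall a c, p a c = p c a) ->
  \sum_(a <- r) \sum_(c <- r) (p a c / 2 * z a c + p a c / 2 * z c a) =
  \sum_(a <- r) \sum_(c <- r) p a c * z a c.
Proof.
move=> pC; transitivity (\sum_(a <- r) \sum_(c <- r) p a c / 2 * z a c
    + \sum_(a <- r) \sum_(c <- r) p a c / 2 * z c a).
  by rewrite -big_split; apply: eq_bigr => a _; rewrite -big_split.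
have pC2 a c : p a c / 2 = p c a / 2 by rewrite pC.
rewrite (sum_symm r z pC2).
rewrite -big_split; apply: eq_bigr => a _; rewrite -big_split; apply: eq_bigr => c _ /=.
by rewrite -mulrDl; congr (_ * _); field.
Qed.

Lemma polar_sym (f : g -> R[i]) x y : polar f x y = polar f y x.
Proof. by rewrite /polar [x + y]addrC [in LHS]addrAC. Qed.

(** The coefficients are symmetric, so the two orders of the symmetrization yield the same double
    sum and the halves recombine. *)
Lemma Omega2E (Y : gtensor g) h n : Omega2 B q g0 Y h n =
  \sum_(a <- L1) \sum_(c <- L1) polar (tau2_tilde B q Y) (X B a) (X B c)
    * RX (X B (- a)) (RX (X B (- c)) h) n.
Proof.
pose P a c := polar (tau2_tilde B q Y) (X B a) (X B c).
have PC a c : P a c = P c a by exact: polar_sym.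
pose S a c := RX (X B (- a)) (RX (X B (- c)) h) n.
exact: etrans (symmetrize_sum L1 P (fun a => X B (- a)) (fun cw => cw.1 * foldr RX h cw.2 n))
  (sum_half_symm L1 S PC).
Qed.

(** At the identity X_mu lies in n, where the character and the nbar component vanish; this removes
    one term of the commutator. *)
Lemma pi_s_mu_1 h : pi_s q g0 lam s (X B mu) h \1%VF = 0.
Proof.
have muP : X B mu \in parabolic q.
  by apply/nilrad_parabolic/X_nilrad => //; rewrite mu1 ltr01.
rewrite /pi_s (lfun_inv1 lam_fund n_two_step g0_real nbar_real) id_lfunE.
by rewrite -lam_coefE lam_coef_mu (proj_nbar0 muP) (RX0 g0_real) mulr0 mul0r subr0.
Qed.

Lemma lam_pol_sum f : \sum_(a <- L1) \sum_(c <- L1)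
    pol q mu eps a c * (lc (br (X B (- a)) (X B mu)) * RX (X B (- c)) f \1%VF) =
  - (bb / 4) * Cconst B q mu eps * RX (X B (- eps)) f \1%VF.
Proof.
have muL : mu \in L1 by rewrite mem_level1 muD mu1 eqxx.
have epsL : eps \in L1 by rewrite mem_level1 epsD eps1 eqxx.
have uL : uniq L1 by rewrite filter_uniq ?roots_uniq.
rewrite (bigD1_seq mu) //= [X in _ + X]big_seq_cond [X in _ + X]big1 => [|a /andP[aL amu]]; last first.
  rewrite big1 // => c _; have [_ -> _] := br_mu_level1 aL.
  by rewrite (negPf amu) mul0r mulr0.
have [_ -> _] := br_mu_level1 muL; rewrite eqxx addr0.
rewrite (bigD1_seq eps) //= big_seq_cond big1 => [|c /andP[cL ceps]]; last first.
  rewrite pol_weight0 ?mul0r //; last by rewrite (inj_eq (addrI mu)).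
  by move: cL; rewrite mem_level1 => /andP[].
rewrite addr0 (pol_mu_eps muD mu1 epsD eps1 sumND).
by move: bb (Cconst _ _ _ _) (RX _ _ _) => x y z; field.
Qed.

(** The two character terms have equal sums by symmetry, which doubles the |alpha_q|^2 / 4 of
    [lam_pol_sum]. *)
Lemma commutatorE f : smooth_section q g0 f ->
  op_commutator (pi_s q g0 lam s (X B mu)) (Omega2 B q g0 (Ylow B q mu eps)) f \1%VF =
  - (bb / 2) * Cconst B q mu eps * s * RX (X B (- eps)) f \1%VF
  + RX (bracket_sum q mu eps) f \1%VF.
Proof.
move=> sf; rewrite /op_commutator pi_s_mu_1 sub0r Omega2E.
pose T a c := lc (br (X B (- a)) (X B mu)) * RX (X B (- c)) f \1%VF.
pose U a c := RX (br (X B (- c)) (br (X B (- a)) (X B mu))) f \1%VF.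
have muP : X B mu \in parabolic q.
  by apply/nilrad_parabolic/X_nilrad => //; rewrite mu1 ltr01.
have step a c : a \in L1 -> c \in L1 ->
    RX (X B (- a)) (RX (X B (- c)) (pi_s q g0 lam s (X B mu) f)) \1%VF =
    - (s * (T c a + T a c) + U a c).
  move=> aL cL; have [aP _ aN] := br_mu_level1 aL; have [cP _ _] := br_mu_level1 cL.
  exact: (RX2_pi_s lam_fund n_two_step g0_real nbar_real s sf (X_nbar1 aL) (X_nbar1 cL)
    muP aP cP (aN c cL) lam_coef_mu).
have -> : RX (bracket_sum q mu eps) f \1%VF =
    \sum_(a <- L1) \sum_(c <- L1) pol q mu eps a c * U a c.
  have mem a c : a \in L1 -> c \in L1 ->
      pol q mu eps a c *: br (X B (- c)) (br (X B (- a)) (X B mu)) \in nbar q.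
    by move=> aL cL; have [_ _ aN] := br_mu_level1 aL; exact: memvZ (aN c cL).
  rewrite /bracket_sum big_seq (RX_suml lam_fund n_two_step g0_real nbar_real _ sf N1); last first.
    by move=> a aL; rewrite big_seq; apply: memv_suml => c cL; exact: mem.
  rewrite [RHS]big_seq; apply: eq_bigr => a aL.
  rewrite big_seq (RX_suml lam_fund n_two_step g0_real nbar_real _ sf N1); last first.
    by move=> c cL; exact: mem.
  rewrite [RHS]big_seq; apply: eq_bigr => c cL.
  have [_ _ aN] := br_mu_level1 aL.
  exact: (RXZ lam_fund n_two_step g0_real nbar_real _ sf N1 (aN c cL)).
have Tsum := sum_symm L1 T (polC q mu eps).
have Tval : \sum_(a <- L1) \sum_(c <- L1) pol q mu eps a c * T a c =
    - (bb / 4) * Cconst B q mu eps * RX (X B (- eps)) f \1%VF := lam_pol_sum f.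
have double (u v x y z : R[i]) : u = v -> v = - (x / 4) * y * z ->
    - (x / 2) * y * s * z = s * (u + v) by move=> -> ->; field.
have E := double _ _ _ _ _ Tsum Tval.
rewrite E -big_split mulr_sumr -big_split -sumrN big_seq [RHS]big_seq.
apply: eq_bigr => a aL /=.
rewrite -big_split mulr_sumr -big_split -sumrN big_seq [RHS]big_seq.
apply: eq_bigr => c cL /=; rewrite (step a c aL cL) -/(pol q mu eps a c).
by move: (pol _ _ _ _ _) (T c a) (T a c) (U a c) => p t t' u; ring.
Qed.

End Assembly.

End RootVectors.

Theorem theorem7p16 (R : realType) (g : lieAlgebra R[i])
  (g_simple : simple_lie g) (D : rootDatum g)
  (T : dynkin_type) (g_type : has_type D T)
  (q : 'I_(rk D)) (q_listed : listed_type T q.+1)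
  (q_qH : quasi_heisenberg q)
  (B : rootVectors D)
  (g0 : set g) (g0_real : real_form fullv g0)
  (q_real : real_form (parabolic q) (g0 `&` [set x | x \in parabolic q]))
  (nbar_real : real_form (nbar q) (g0 `&` [set x | x \in nbar q]))
  (lam : hdual (hh D)) (lam_fund : fundamental_weight q lam)
  (mu gamma eps : hdual (hh D))
  (mu_hw : highest_weight q (@br _ g) (grading q 1) mu)
  (gamma_hw : highest_weight q (@br _ g) (zn q) gamma)
  (V : {vspace gtensor g})
  (V_special : special_constituent q mu gamma eps V)
  (V_type : type1a mu eps \/ type2 mu eps) (s : R[i]) :
  let alq := (base D)`_q in
  (type1a mu eps ->
   let s2 := (size (rootsV_at (mu + eps) (grading q 1)))%:R / 2 - 1 in
   forall f : line_section g, smooth_section q g0 f ->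
     op_commutator (pi_s q g0 lam s (X B mu)) (Omega2 B q g0 (Ylow B q mu eps))
       f \1%VF
     = - (ip alq alq / 2) * Cconst B q mu eps * (s - s2)
       * RX g0 (X B (- eps)) f \1%VF) /\
  (type2 mu eps ->
   forall f : line_section g, smooth_section q g0 f ->
     op_commutator (pi_s q g0 lam s (X B mu)) (Omega2 B q g0 (Ylow B q mu eps))
       f \1%VF
     = - (ip alq alq / 2) * Cconst B q mu mu * (s + 1)
       * RX g0 (X B (- mu)) f \1%VF).

Proof.
move=> alq; have [n_two_step _] := q_qH.
have [_ _ _ _ epsL] := V_special.
have [muD mu1] := mu_root mu_hw.
have /andP[epsD /eqP eps1] : (eps \in roots D) && (level q eps == 1).
  by rewrite -(mem_level1 B).
have sumND : mu + eps \notin roots D by case: V_type => [[]|[-> +]].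
(* The bracket sums carry |mu|^2, the coefficient of s carries |alpha_q|^2; equality lets them
   combine into one factor. *)
have normE : ip mu mu = ip alq alq.
  by rewrite (ripE B muD muD) (ripE B (base_root q) (base_root q)) (mu_norm B lam_fund mu_hw).
have mu_max a : a \in roots D -> level q a = 1 -> rip a a <= rip mu mu.
  by move=> aD a1; rewrite (mu_norm B lam_fund mu_hw); exact: (norm_le_simple B aD a1).
have XN : X B (- eps) \in nbar q by exact: (X_nbar1 B epsL).
have comm f (sf : smooth_section q g0 f) :=
  commutatorE B lam_fund n_two_step g0_real nbar_real s muD mu1 epsD eps1 sumND sf.
have RX_eps f (sf : smooth_section q g0 f) c :=
  RXZ B lam_fund n_two_step g0_real nbar_real c sf (Nbar0_1 nbar_real) XN.
split=> [[_ /eqP eps_mu mu_long eps_long] s2 f sf|[em _] f sf].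
  rewrite (comm f sf) (bracket_sum_type1 B muD mu1 epsD eps1 sumND mu_long eps_long eps_mu).
  rewrite (RX_eps f sf) normE -/s2.
  by move: (ip _ _) (Cconst _ _ _ _) (RX _ _ _ _) s2 => x y z t; ring.
rewrite (comm f sf) (bracket_sum_type2 B muD mu1 epsD eps1 sumND mu_max em).
have := RX_eps f sf; rewrite em => ->; rewrite normE.
by move: (ip _ _) (Cconst _ _ _ _) (RX _ _ _ _) => x y z; ring.
Qed.
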